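(* Let $\theta,\alpha$ be elements of the algebraic closure $\overline K$ of a valued field $(K,v)$ with respective minimal polynomials $f,\phi$ over $K$. Suppose that $\deg f>\deg\phi$, and that $K(\theta)|K$ and $K(\alpha)|K$ are both unibranched. Then $(\theta,\alpha)$ is a $(K,v)$-distinguished pair if and only if the following four conditions are satisfied: (i) $(\alpha,\bar v(\theta-\alpha))$ is a $(K,v)$-minimal pair, and $\bar v(\theta-\alpha_i)\le\bar v(\theta-\alpha)$ for all $K$-conjugates $\alpha_i$ of $\alpha$; (ii) $\Gamma_\theta=\Gamma_\alpha+\mathbb Z\,\bar v(\phi(\theta))$; (iii) $k_\theta=k_\alpha\left(\left(\frac{\phi(\theta)^e}{h(\alpha)}\right)^*\right)$, where $e$ is the smallest positive integer such that $e\,\bar v(\phi(\theta))=\bar v(h(\alpha))\in\Gamma_\alpha$ for some $h\in K[x]$ with $\deg h<\deg\phi$; (iv) $d(K(\theta)|K)=d(K(\alpha)|K)$.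
   Context: $(K,v)$ is a valued field of arbitrary rank, $\overline K$ a fixed algebraic closure, $\bar v$ a fixed extension of $v$ to $\overline K$. For $\alpha\in\overline K$: $\deg\alpha=[K(\alpha):K]$; $\Gamma_\alpha$ and $k_\alpha$ are the value group and residue field of the restriction of $\bar v$ to $K(\alpha)$ (residue fields are regarded as subfields of the residue field of $\bar v$); for $a$ in the valuation ring of $\bar v$, $a^*$ denotes its residue. A finite extension $L|K$ is unibranched if $v$ has a unique extension $v_L$ to $L$; in that case $d(L|K)=[L^h:K^h]/(ef)$, where $e,f$ are here the ramification index and inertia degree of $v_L|v$ and $L^h,K^h$ are Henselizations with respect to the extension of $v_L$ to $\overline K$. $(\alpha,\delta)\in\overline K\times\Gamma_{\bar v}$ is a $(K,v)$-minimal pair if $\deg\beta\ge\deg\alpha$ for every $\beta\in\overline K$ with $\bar v(\alpha-\beta)\ge\delta$. $(\theta,\alpha)$ is a $(K,v)$-distinguished pair if: $\deg\theta>\deg\alpha$; $\bar v(\theta-\alpha)=\max\{\bar v(\theta-\beta):\beta\in\overline K,\ \deg\beta<\deg\theta\}$; and $\bar v(\theta-\eta)<\bar v(\theta-\alpha)$ for every $\eta\in\overline K$ with $\deg\eta<\deg\alpha$. *)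

(* Defs.v *)
From HB Require Import structures.
From mathcomp Require Import all_boot all_order all_algebra.
From mathcomp Require Import separable.
From mathcomp Require Import all_classical.

Set Implicit Arguments.
Unset Strict Implicit.
Unset Printing Implicit Defensive.

Import Order.TTheory GRing.Theory Num.Theory.

Local Open Scope classical_set_scope.
Local Open Scope ring_scope.

(* [Num.POrderedZmodule] puts an order and a group law on G without relating
   them. *)

HB.mixin Record POrderedZmodule_isOrderedGroup G of Num.POrderedZmodule G := {
  oag_total : total (<=%R : rel G);
  oag_leD2l : forall x y z : G, x <= y -> z + x <= z + y
}.

#[short(type="oagType")]
HB.structure Definition OrderedGroup :=
  {G of Num.POrderedZmodule G & POrderedZmodule_isOrderedGroup G}.

(* Values lie in [option G], where [None] is the value infinity of 0. *)

Section Values.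
Variable G : oagType.
Implicit Types a b : option G.

Definition vle a b : bool :=
  match a, b with
  | _, None => true
  | None, Some _ => false
  | Some x, Some y => x <= y
  end.

Definition vlt a b : bool := ~~ vle b a.

Definition vadd a b : option G :=
  match a, b with
  | Some x, Some y => Some (x + y)
  | _, _ => None
  end.

Definition vmin a b : option G := if vle a b then a else b.

End Values.

Section Subfields.
Variable L : fieldType.
Implicit Types (E F S : set L) (x : L).

Definition is_subfield E : Prop := divring_closed (mem E).

Definition adjoin F x : set L := smallest is_subfield (F `|` [set x]).

Definition is_basis F E n (b : 'I_n -> L) : Prop :=
  (forall i, E (b i)) /\
  forall y, E y ->
    exists! c : {ffun 'I_n -> L},
      (forall i, F (c i)) /\ y = \sum_(i < n) c i * b i.

(* [E : F], with the value 0 when E is not finite over F. *)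
Definition ext_degree F E : nat :=
  xget 0%N [set n | exists b : 'I_n -> L, is_basis F E b].

(* x is separable over F when it is a root of a polynomial over F that has
   only simple roots. *)
Definition separable_over F x : Prop :=
  exists p : {poly L},
    [/\ forall i, F p`_i, separable_poly p & root p x].

End Subfields.

(* (A : B), with the value 0 when the index is infinite. *)
Definition group_index (G : zmodType) (B A : set G) : nat :=
  xget 0%N [set n | exists t : 'I_n -> G,
    (forall i, A (t i)) /\ forall a, A a -> exists! i, B (a - t i)].

(* [w] matters on E only; its values may generate a proper subgroup of G. *)
Definition valuation_on (L : fieldType) (G : oagType) (E : set L)
    (w : L -> option G) : Prop :=
  [/\ forall x, E x -> (w x = None <-> x = 0),
      forall x y, E x -> E y -> w (x * y) = vadd (w x) (w y)
    & forall x y, E x -> E y -> vle (vmin (w x) (w y)) (w (x + y))].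

Record valuation (L : fieldType) (G : oagType) := Valuation {
  val_fun :> L -> option G;
  val_axiom : valuation_on setT val_fun
}.

Section ResidueField.
Variables (L : fieldType) (G : oagType) (v : valuation L G).

Definition vring : {pred L} := fun x => vle (Some 0) (v x).

Lemma val0 : v 0 = None.
Proof. by have [h _ _] := val_axiom v; apply/h. Qed.

Lemma valM x y : v (x * y) = vadd (v x) (v y).
Proof. by have [_ h _] := val_axiom v; apply/h. Qed.

Lemma valD x y : vle (vmin (v x) (v y)) (v (x + y)).
Proof. by have [_ _ h] := val_axiom v; apply/h. Qed.

Lemma val_neq0 x : x != 0 -> exists g, v x = Some g.
Proof.
have [h _ _] := val_axiom v.
case E: (v x) => [g|]; first by exists g.
by move/eqP; case; apply/(h x).
Qed.

Lemma val1 : v 1 = Some 0.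
Proof.
have [g E] := val_neq0 (oner_neq0 L).
have := valM 1 1; rewrite mulr1 E /= => -[] /eqP.
by rewrite -subr_eq0 opprD addNKr oppr_eq0 => /eqP ->.
Qed.

Lemma oag_double0 (g : G) : g + g = 0 -> g = 0.
Proof.
move=> gg0; have /orP[g0|g0] := oag_total 0 g.
  have := oag_leD2l _ _ g g0; rewrite gg0 addr0 => g0'.
  by apply/eqP; rewrite eq_le g0 g0'.
have := oag_leD2l _ _ g g0; rewrite gg0 addr0 => g0'.
by apply/eqP; rewrite eq_le g0 g0'.
Qed.

Lemma valN x : v (- x) = v x.
Proof.
have vN1 : v (-1) = Some 0.
  have := valM (-1) (-1); rewrite mulrNN mulr1 val1.
  by case: (v (-1)) => //= g [] /esym /oag_double0 ->.
by rewrite -mulN1r valM vN1; case: (v x) => //= g; rewrite add0r.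
Qed.

Lemma vle_trans (a b c : option G) : vle a b -> vle b c -> vle a c.
Proof. by case: a b c => [a|] [b|] [c|] //=; apply: le_trans. Qed.

Lemma val_geD c x y : vle c (v x) -> vle c (v y) -> vle c (v (x + y)).
Proof.
move=> cx cy; apply: vle_trans (valD x y).
by rewrite /vmin; case: ifP.
Qed.

Lemma vring_closed : subring_closed vring.
Proof.
split; first by rewrite unfold_in /vring val1 /=.
- move=> x y; rewrite !unfold_in /vring => x0 y0.
  by rewrite val_geD ?valN.
- move=> x y; rewrite !unfold_in /vring valM.
  case: (v x) (v y) => [a|] [b|] //= a0 b0.
  by apply: le_trans a0 _; rewrite -[leLHS]addr0; apply: oag_leD2l.
Qed.

HB.instance Definition _ := GRing.isSubringClosed.Build L vring vring_closed.

Record valuation_ring := ValuationRing {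
  vring_val :> L;
  vring_valP : vring_val \in vring
}.

HB.instance Definition _ := [isSub for vring_val].
HB.instance Definition _ := [Choice of valuation_ring by <:].
HB.instance Definition _ :=
  [SubChoice_isSubComNzRing of valuation_ring by <:].

Definition max_ideal : {pred valuation_ring} :=
  fun x => vlt (Some 0) (v (val x)).

Lemma max_idealN x : x \notin max_ideal -> v (val x) = Some 0.
Proof.
rewrite unfold_in /max_ideal /vlt negbK.
have := vring_valP x; rewrite unfold_in /vring /=.
case: (v (vring_val x)) => [g|] //= g0 g0'; congr Some.
by apply/eqP; rewrite eq_le g0 g0'.
Qed.

Lemma max_idealE x : (x \in max_ideal) = (v (val x) != Some 0).
Proof.
apply/idP/idP; last by apply: contraNT => /max_idealN ->.
by apply: contraTN => /eqP E; rewrite unfold_in /max_ideal E /vlt /= lexx.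
Qed.

Lemma max_ideal_closed : idealr_closed max_ideal.
Proof.
split.
- by rewrite unfold_in /max_ideal /= val0.
- by rewrite max_idealE /= val1 eqxx.
- move=> a x y; rewrite !unfold_in /max_ideal /= => x0 y0.
  have := vring_valP a; rewrite unfold_in /vring => a0.
  have ax0 : vlt (Some 0) (v (val a * val x)).
    rewrite valM; move: a0 x0; rewrite /vlt.
    case: (v (val a)) (v (val x)) => [b|] [c|] //=.
    move=> b0; apply: contra; apply: le_trans.
    by rewrite addrC -[leLHS]addr0; apply: oag_leD2l.
  move: ax0 y0 (valD (val a * val x) (val y)); rewrite /vlt /vmin.
  case: ifP => _ h1 h2 h; first by apply: contra h1; apply: vle_trans.
  by apply: contra h2; apply: vle_trans.
Qed.

HB.instance Definition _ := isIdealr.Build valuation_ring max_ideal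
  max_ideal_closed.

Definition residue_field := {ideal_quot max_ideal}.
HB.instance Definition _ := GRing.ComNzRing.on residue_field.

(* The residue a^*; the value is 0 when a is outside the valuation ring. *)
Definition residue (a : L) : residue_field :=
  (\pi_{ideal_quot max_ideal} (insubd (0 : valuation_ring) a))%qT.

Definition residue_inv (q : residue_field) : residue_field :=
  residue (val (repr q : valuation_ring))^-1.

Lemma repr_max_ideal (q : residue_field) :
  (repr q : valuation_ring) \in max_ideal = (q == 0).
Proof.
rewrite -[repr q]subr0 Quotient.idealrBE reprK.
by rewrite -(rmorph0 (\pi_{ideal_quot max_ideal})%qT).
Qed.

Lemma residue_mulVf (q : residue_field) : q != 0 -> residue_inv q * q = 1.
Proof.
rewrite -repr_max_ideal => qN0.
have vq := max_idealN qN0.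
have q0 : val (repr q : valuation_ring) != 0.
  by apply: contra_eq_neq vq => ->; rewrite val0.
have vqV : v (val (repr q : valuation_ring))^-1 = Some 0.
  have := valM (val (repr q : valuation_ring)) (val (repr q))^-1.
  rewrite divff // val1 vq.
  by case: (v _^-1) => //= g [->]; rewrite add0r.
rewrite -[q in _ * q]reprK /residue_inv /residue.
rewrite -(rmorphM (\pi_{ideal_quot max_ideal})%qT).
apply: etrans (rmorph1 (\pi_{ideal_quot max_ideal})%qT).
congr (\pi_ _)%qT; apply: val_inj => /=.
rewrite insubdK ?mulVf //.
have vle0 : vle (Some 0) (v (vring_val (repr q))^-1) by rewrite [v _]vqV /=.
exact: vle0.
Qed.

Lemma residue_inv0 : residue_inv 0 = 0.
Proof.
have : (repr (0 : residue_field) : valuation_ring) \in max_ideal.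
  by rewrite repr_max_ideal.
rewrite /residue_inv; set r := val _.
have [-> _|r0] := eqVneq r 0.
  rewrite invr0; apply: etrans (rmorph0 (\pi_{ideal_quot max_ideal})%qT).
  by congr (\pi_ _)%qT; apply: val_inj; rewrite insubdK // rpred0.
rewrite unfold_in /max_ideal -/r => vr.
have [g E] := val_neq0 r0.
have vrV : r^-1 \notin vring.
  have := valM r r^-1; rewrite divff // val1 unfold_in /vring.
  move: vr; rewrite E /vlt /=; case: (v r^-1) => //= h g0 [gh].
  apply: contra g0 => h0.
  by rewrite gh -[leLHS]addr0; apply: oag_leD2l.
rewrite /residue /insubd insubN //=.
exact: (rmorph0 (\pi_{ideal_quot max_ideal})%qT).
Qed.

HB.instance Definition _ := GRing.ComNzRing_isField.Build residue_field
  residue_mulVf residue_inv0.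

End ResidueField.

Arguments residue {L G} v a.

Section ValuedSubfields.
Variables (L : fieldType) (G : oagType) (v : valuation L G).
Implicit Types E F : set L.

Definition value_group E : set G :=
  [set g | exists2 x, E x & v x = Some g].

Definition residue_subfield E : set (residue_field v) :=
  residue v @` (E `&` [set x | vle (Some 0) (v x)]).

Definition ramification_index F E : nat :=
  group_index (value_group F) (value_group E).

Definition inertia_degree F E : nat :=
  ext_degree (residue_subfield F) (residue_subfield E).

(* For L algebraically closed and algebraic over E: the field of the elements
   separable over E that are fixed by the decomposition group of v over E. *)
Definition henselization E : set L :=
  [set x | separable_over E x /\
    forall s : {rmorphism L -> L}, bijective s ->
      (forall y, E y -> s y = y) -> (forall y, v (s y) = v y) -> s x = x].

Definition defect F E : rat :=
  (ext_degree (henselization F) (henselization E))%:R /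
  (ramification_index F E * inertia_degree F E)%:R.

End ValuedSubfields.

Arguments residue_subfield {L G} v E.

Section Elements.
Variables (K L : fieldType) (iota : {rmorphism K -> L}).
Implicit Types x y : L.

Definition simple_ext x : set L := adjoin (range iota) x.

Definition deg x : nat := ext_degree (range iota) (simple_ext x).

Definition is_min_poly x (p : {poly K}) : Prop :=
  [/\ p \is monic, irreducible_poly p & root (map_poly iota p) x].

Definition conjugates x y : Prop :=
  exists2 p, is_min_poly x p & root (map_poly iota p) y.

Variables (G : oagType) (v : valuation K G) (vbar : valuation L G).

(* Valuations are identified when they have the same valuation ring; vbar
   provides one extension of v to E. *)
Definition unibranched (E : set L) : Prop :=
  forall (G' : oagType) (w : L -> option G'),
    valuation_on E w ->
    (forall x : K, vle (Some 0) (w (iota x)) = vle (Some 0) (v x)) ->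
    forall x, E x -> vle (Some 0) (w x) = vle (Some 0) (vbar x).

Definition minimal_pair x (delta : G) : Prop :=
  value_group vbar setT delta /\
  forall y, vle (Some delta) (vbar (x - y)) -> (deg x <= deg y)%N.

Definition is_max (A : set (option G)) (m : option G) : Prop :=
  A m /\ forall a, A a -> vle a m.

Definition distinguished_pair x y : Prop :=
  [/\ (deg y < deg x)%N,
      is_max [set vbar (x - z) | z in [set z | (deg z < deg x)%N]]
             (vbar (x - y))
    & forall z, (deg z < deg y)%N -> vlt (vbar (x - z)) (vbar (x - y))].

End Elements.

(* Main.v *)
(* Let n = deg theta, m = deg alpha, d = theta - alpha, and let Y be the residue
   of phi(theta)^e / h(alpha).  Assume (i), and expand g = sum_k g_k phi^k with
   deg g_k < m.  The exponents k of the terms g_k(alpha) phi(theta)^k of least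
   value agree modulo e; if v(g(theta)) exceeds that value, the residues of these
   terms give an equation for Y over k_alpha of degree at most (deg_phi g)/e.  For
   g = f this yields e [k_alpha(Y) : k_alpha] m <= n.

   If (theta, alpha) is distinguished, then for deg g < n the value v(g(theta)) is
   the Gauss valuation of g on the ball of center alpha and radius v(d), which is
   the least value of the terms.  Hence (ii), (iii) and, lifting the minimal
   polynomial of Y, the equality n = e [k_alpha(Y) : k_alpha] m.  Conversely this
   equality forces v(g(theta)) to be the least value of the terms for deg g < n,
   hence at most the Gauss valuation of g; this excludes roots of g closer to
   theta than alpha.

   The equality is equivalent to (iv) because [K(x)^h : K^h] = [K(x) : K] when
   K(x) is unibranched.  Here the decomposition group acts transitively on the
   conjugates of x, because isometric embeddings extend to isometric
   automorphisms of Kbar. *)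

Require Import Defs.
From HB Require Import structures.
From mathcomp Require Import all_boot all_order all_algebra.
From mathcomp Require Import vector falgebra fieldext separable ring.
From mathcomp Require Import all_classical.

Set Implicit Arguments.
Unset Strict Implicit.
Unset Printing Implicit Defensive.

Import Order.TTheory GRing.Theory Num.Theory.

Local Open Scope classical_set_scope.
Local Open Scope ring_scope.

(** * Ordered groups and valuations *)

(** K(alpha) need not lie in K(theta), so no tower of fields is available. Elements g(alpha) and
    g(theta) with deg g < deg phi are compared instead: minimality of the pair gives g(theta) -
    g(alpha) a larger value than g(alpha). Towers exist only for value groups and residue fields,
    once (ii) and (iii) hold. Isometric embeddings extend in any rank for the following reason. If
    every candidate image of an algebraic y failed, one polynomial g would have the wrong value at
    all candidates at once. A power of g(y) divided by a constant would then have value 0, while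
    none of its conjugates along the embedding would, which contradicts the Newton polygon of their
    common equation. For the trivial valuation the same extension result yields the automorphisms
    that move x to a given conjugate. Inseparability is the obstacle in computing K(x)^h: its
    elements are polynomials in x with coefficients fixed by the decomposition group of K, but these
    coefficients become separable over K only after raising to a power of the characteristic
    exponent. *)

Section OrderedGroup.
Variable G : oagType.
Implicit Types x y z : G.

Lemma oag_le_total x y : (x <= y) || (y <= x).
Proof. exact: oag_total. Qed.

Lemma oag_leD2lE z x y : (z + x <= z + y) = (x <= y).
Proof.
apply/idP/idP; last exact: oag_leD2l.
by move=> /(oag_leD2l _ _ (- z)); rewrite !addKr.
Qed.

Lemma oag_lt0_mulrn x k : 0 < x -> (0 < k)%N -> 0 < x *+ k.
Proof.
move=> x0; case: k => // k _; elim: k => [|k IH] //.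
rewrite mulrS (lt_le_trans x0) // -[leLHS]addr0 oag_leD2lE; exact: ltW.
Qed.

(** Torsion-freeness: it recovers equal values from equal values of powers, as in [vX_eq]. *)
Lemma oag_mulrn_eq0 x k : (0 < k)%N -> x *+ k = 0 -> x = 0.
Proof.
move=> k0 xk; apply/eqP; apply: contraT => x0.
have /orP[h|h] := oag_le_total 0 x.
  by have := @oag_lt0_mulrn x k; rewrite xk ltxx; apply=> //; rewrite lt_neqAle eq_sym x0.
have := @oag_lt0_mulrn (- x) k; rewrite mulNrn xk oppr0 ltxx; apply=> //.
rewrite lt_neqAle eq_sym oppr_eq0 x0 /=.
by rewrite -(oag_leD2lE x) addr0 addrN.
Qed.

Lemma oag_mulrnI k : (0 < k)%N -> injective (fun x : G => x *+ k).
Proof.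
move=> k0 x y /= /eqP; rewrite -subr_eq0 -mulrnBl => /eqP /(oag_mulrn_eq0 k0) /eqP.
by rewrite subr_eq0 => /eqP.
Qed.

End OrderedGroup.

Section ValueOrder.
Variable G : oagType.
Implicit Types a b c : option G.

Lemma vle_refl a : vle a a.
Proof. by case: a => //= x. Qed.

Lemma vle_total a b : vle a b || vle b a.
Proof. by case: a b => [x|] [y|] //=; apply: oag_le_total. Qed.

Lemma vltW a b : vlt a b -> vle a b.
Proof. by rewrite /vlt => /negPf h; have := vle_total a b; rewrite h orbF. Qed.

Lemma vltN a b : ~~ vlt a b = vle b a.
Proof. by rewrite /vlt negbK. Qed.

Lemma vlt_irr a : vlt a a = false.
Proof. by rewrite /vlt vle_refl. Qed.

Lemma vle_lt_trans a b c : vle a b -> vlt b c -> vlt a c.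
Proof. by rewrite /vlt => ab; apply: contra => ca; apply: vle_trans ab. Qed.

Lemma vlt_le_trans a b c : vlt a b -> vle b c -> vlt a c.
Proof. by rewrite /vlt => ab bc; apply: contra ab => ca; apply: vle_trans ca. Qed.

Lemma vle_anti a b : vle a b -> vle b a -> a = b.
Proof.
by case: a b => [x|] [y|] //= h1 h2; congr Some; apply: le_anti; rewrite h1.
Qed.

Lemma vle_eqVlt a b : vle a b -> a = b \/ vlt a b.
Proof.
move=> ab; case: (boolP (vle b a)) => ba; first by left; apply: vle_anti.
by right.
Qed.

Lemma vleN a : vle a None.
Proof. by case: a. Qed.

Lemma vmin_cases a b : vmin a b = a \/ vmin a b = b.
Proof. by rewrite /vmin; case: ifP; [left|right]. Qed.

End ValueOrder.

Section Valuation.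
Variables (L : fieldType) (G : oagType) (v : valuation L G).
Implicit Types x y z : L.

Lemma v0 : v 0 = None. Proof. exact: Defs.val0. Qed.

Lemma v1 : v 1 = Some 0. Proof. exact: Defs.val1. Qed.

Lemma vM x y : v (x * y) = vadd (v x) (v y). Proof. exact: Defs.valM. Qed.

Lemma vN x : v (- x) = v x. Proof. exact: Defs.valN. Qed.

Lemma vD x y : vle (vmin (v x) (v y)) (v (x + y)). Proof. exact: Defs.valD. Qed.

Lemma v_eq0 x : v x = None <-> x = 0.
Proof. by have [h _ _] := val_axiom v; apply: h. Qed.

Lemma v_neq0 x : v x <> None <-> x != 0.
Proof. by split=> [h|/eqP h /v_eq0 //]; apply/eqP => /v_eq0. Qed.

Lemma vB x y : v (x - y) = v (y - x).
Proof. by rewrite -vN opprB. Qed.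

Lemma vle_mul2l z x y : vle (v x) (v y) -> vle (v (z * x)) (v (z * y)).
Proof.
rewrite !vM; case: (v z) (v x) (v y) => [c|] [a|] [b|] //=.
by rewrite oag_leD2lE.
Qed.

Lemma vle_mul2lE z x y : z != 0 -> vle (v (z * x)) (v (z * y)) = vle (v x) (v y).
Proof.
move=> z0; apply/idP/idP; last exact: vle_mul2l.
by move/(vle_mul2l z^-1); rewrite !mulKf.
Qed.

Lemma vlt_mul2lE z x y : z != 0 -> vlt (v (z * x)) (v (z * y)) = vlt (v x) (v y).
Proof. by move=> z0; rewrite /vlt vle_mul2lE. Qed.

Lemma vle_mul x y z t :
  vle (v x) (v y) -> vle (v z) (v t) -> vle (v (x * z)) (v (y * t)).
Proof.
move=> xy zt; apply: (vle_trans (vle_mul2l x zt)).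
by rewrite mulrC [y * t]mulrC vle_mul2l.
Qed.

Lemma vlt_le_mul x y z t : z != 0 ->
  vlt (v x) (v y) -> vle (v z) (v t) -> vlt (v (x * z)) (v (y * t)).
Proof.
move=> z0 xy zt; have := vle_mul2l y zt; apply: vlt_le_trans.
by rewrite mulrC [y * _]mulrC vlt_mul2lE.
Qed.

Lemma vle_divE x y z : y != 0 -> vle (v z) (v (x / y)) = vle (v (z * y)) (v x).
Proof. by move=> y0; rewrite -(vle_mul2lE _ _ y0) mulrCA divff // mulr1 mulrC. Qed.

Lemma vlt_divE x y z : y != 0 -> vlt (v z) (v (x / y)) = vlt (v (z * y)) (v x).
Proof. by move=> y0; rewrite -(vlt_mul2lE _ _ y0) mulrCA divff // mulr1 mulrC. Qed.

(** Writing value zero as [v 1] lets the product rules for [v] apply to it. *)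
Lemma v_div1 x y : y != 0 -> v (x / y) = v 1 <-> v x = v y.
Proof.
move=> y0; split=> [h|h].
  by rewrite -[x](divfK y0) vM h -vM mul1r.
by rewrite vM h -vM divff.
Qed.

Lemma v_mulI z x y : z != 0 -> v (z * x) = v (z * y) -> v x = v y.
Proof.
by move=> z0 e; apply: vle_anti; rewrite -(vle_mul2lE _ _ z0) e vle_refl.
Qed.

Lemma vV x g : v x = Some g -> v x^-1 = Some (- g).
Proof.
move=> h; have x0 : x != 0 by apply/v_neq0; rewrite h.
have := vM x x^-1; rewrite divff // v1 h.
case: (v x^-1) => //= g' [e]; congr Some.
by apply/eqP; rewrite -addr_eq0 addrC -e.
Qed.

Lemma vX x g k : v x = Some g -> v (x ^+ k) = Some (g *+ k).
Proof.
move=> h; elim: k => [|k IH]; first by rewrite expr0 v1.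
by rewrite exprS vM h IH /= mulrS.
Qed.

Lemma vX_eq x y k : (0 < k)%N -> v (x ^+ k) = v (y ^+ k) -> v x = v y.
Proof.
move=> k0 h; have [x0|x0] := eqVneq x 0.
  move: h; rewrite x0 expr0n gtn_eqF //= v0 => /esym /v_eq0 /eqP.
  by rewrite expf_eq0 k0 /= => /eqP ->; rewrite v0.
have [g xg] := val_neq0 v x0.
have [y0|y0] := eqVneq y 0.
  by move: h; rewrite y0 expr0n gtn_eqF //= v0 (vX _ xg).
have [g' yg] := val_neq0 v y0.
by move: h; rewrite (vX _ xg) (vX _ yg) => -[/(oag_mulrnI k0)] e; rewrite xg yg e.
Qed.

Lemma vlt_None x : v x <> None -> vlt (v x) None.
Proof. by case: (v x). Qed.

Lemma val_gtD c x y : vlt c (v x) -> vlt c (v y) -> vlt c (v (x + y)).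
Proof.
move=> cx cy; apply: vlt_le_trans (vD x y).
by have [->|->] := vmin_cases (v x) (v y).
Qed.

Lemma val_ge_sum c (I : Type) (r : seq I) (P : pred I) (F : I -> L) :
  (forall i, P i -> vle c (v (F i))) -> vle c (v (\sum_(i <- r | P i) F i)).
Proof.
move=> h; elim/big_ind: _ => //; first by rewrite v0 vleN.
by move=> x y; apply: val_geD.
Qed.

Lemma val_gt_sum c (I : Type) (r : seq I) (P : pred I) (F : I -> L) : c <> None ->
  (forall i, P i -> vlt c (v (F i))) -> vlt c (v (\sum_(i <- r | P i) F i)).
Proof.
move=> c0 h; elim/big_ind: _ => //; first by rewrite v0; case: c c0 {h}.
by move=> x y; apply: val_gtD.
Qed.

(** If the sum had a larger value than x, so would x = (x + y) - y. *)
Lemma val_addl x y : vlt (v x) (v y) -> v (x + y) = v x.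
Proof.
move=> xy; apply: vle_anti; last by apply: val_geD; rewrite ?vle_refl ?vltW.
apply: contraT => h; have : vlt (v x) (v (x + y - y)) by apply: val_gtD; rewrite ?vN.
by rewrite addrK vlt_irr.
Qed.

Lemma val_eq_gtB x y : vlt (v x) (v (y - x)) -> v y = v x.
Proof. by move=> /val_addl; rewrite addrC subrK. Qed.

Lemma val_ge_horner (p : {poly L}) c x : vle (v 1) (v x) ->
  (forall i, vle c (v p`_i)) -> vle c (v p.[x]).
Proof.
move=> x0 h; rewrite horner_coef; apply: val_ge_sum => i _.
apply: (vle_trans (h i)); rewrite -[X in vle (v X)]mulr1; apply: vle_mul2l.
elim: (val i) => [|k IH]; first by rewrite expr0 vle_refl.
by rewrite exprS -[1]mulr1; apply: vle_mul.
Qed.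

End Valuation.

(** * Subfields and minimal polynomials *)

Section Subfield.
Variables (L : fieldType) (E : set L).

Lemma is_subfieldP : is_subfield E <->
  [/\ E 1, forall x y, E x -> E y -> E (x - y),
      forall x y, E x -> E y -> E (x * y) & forall x, E x -> E x^-1].
Proof.
split=> [[E1 EB ED]|[E1 EB EM EV]].
  have in1 : E 1 by rewrite -in_setE.
  have EV x : E x -> E x^-1.
    by move=> /mem_set Ex; have := ED _ _ (mem_set in1) Ex; rewrite div1r inE.
  split=> // x y /mem_set Ex /mem_set Ey; rewrite -in_setE.
    exact: EB.
  by rewrite -[y]invrK; apply: ED => //; apply/mem_set/EV; rewrite -in_setE.
split; first by rewrite inE.
- by move=> x y; rewrite !inE; apply: EB.
- by move=> x y; rewrite !inE => Ex Ey; apply: EM => //; apply: EV.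
Qed.

Hypothesis HE : is_subfield E.

Lemma subfield1 : E 1. Proof. by have [] := is_subfieldP.1 HE. Qed.

Lemma subfieldB x y : E x -> E y -> E (x - y).
Proof. by have [_ h _ _] := is_subfieldP.1 HE; apply: h. Qed.

Lemma subfieldM x y : E x -> E y -> E (x * y).
Proof. by have [_ _ h _] := is_subfieldP.1 HE; apply: h. Qed.

Lemma subfieldV x : E x -> E x^-1.
Proof. by have [_ _ _ h] := is_subfieldP.1 HE; apply: h. Qed.

Lemma subfield0 : E 0.
Proof. by rewrite -(subrr 1); apply: subfieldB; apply: subfield1. Qed.

Lemma subfieldN x : E x -> E (- x).
Proof. by move=> Ex; rewrite -sub0r; apply: subfieldB => //; apply: subfield0. Qed.

Lemma subfieldD x y : E x -> E y -> E (x + y).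
Proof. by move=> Ex Ey; rewrite -[y]opprK; apply: subfieldB => //; apply: subfieldN. Qed.

Lemma subfieldX x k : E x -> E (x ^+ k).
Proof.
move=> Ex; elim: k => [|k IH]; first by rewrite expr0; apply: subfield1.
by rewrite exprS; apply: subfieldM.
Qed.

Lemma subfield_sum (I : Type) (r : seq I) (P : pred I) (F : I -> L) :
  (forall i, P i -> E (F i)) -> E (\sum_(i <- r | P i) F i).
Proof.
by move=> h; elim/big_ind: _ => //; [apply: subfield0|apply: subfieldD].
Qed.

Lemma subfield_horner (p : {poly L}) x : (forall i, E p`_i) -> E x -> E p.[x].
Proof.
move=> Ep Ex; rewrite horner_coef; apply: subfield_sum => i _.
by apply: subfieldM => //; apply: subfieldX.
Qed.

(** Polynomials over an intermediate field need a coefficient type. A subfield given as a set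
    becomes one here, indexed by the proof of its closure, and [subfield_incl] then plays the part
    of [iota]. *)
Definition subfield_pred of is_subfield E : {pred L} := mem E.
HB.instance Definition _ := GRing.isDivringClosed.Build L (subfield_pred HE) HE.

Record subfield_type := SubfieldElt {
  sf_val :> L;
  sf_valP : sf_val \in subfield_pred HE
}.

HB.instance Definition _ := [isSub for sf_val].
HB.instance Definition _ := [Choice of subfield_type by <:].
HB.instance Definition _ := [SubChoice_isSubIntegralDomain of subfield_type by <:].
HB.instance Definition _ := [SubIntegralDomain_isSubField of subfield_type by <:].

Definition subfield_field : fieldType := GRing.Field.clone subfield_type _.

Definition subfield_incl : {rmorphism subfield_field -> L} :=
  GRing.RMorphism.clone subfield_field L (val : subfield_field -> L) _.

Lemma range_incl : range subfield_incl = E.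
Proof.
apply/seteqP; split=> x /=.
  by case=> [[y yP]] _ <-; rewrite -in_setE.
by move=> /mem_set xE; exists (SubfieldElt xE).
Qed.

Lemma subfield_lift x : E x -> exists y, subfield_incl y = x.
Proof. by move/mem_set => xE; exists (SubfieldElt xE). Qed.

Lemma subfield_inclP y : E (subfield_incl y).
Proof. by rewrite -[E in E _]range_incl; exists y. Qed.

Lemma poly_lift (p : {poly L}) : (forall i, E p`_i) ->
  exists q, map_poly subfield_incl q = p.
Proof.
move=> h; have h' i : {y | subfield_incl y = p`_i} by apply/cid/subfield_lift.
exists (\poly_(i < size p) sval (h' i)); apply/polyP => i.
rewrite coef_map coef_poly; case: ltnP => hi; first exact: (svalP (h' i)).
by rewrite raddf0 nth_default.
Qed.

End Subfield.

Section Adjoin.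
Variables (L : fieldType) (F : set L) (x : L).

Lemma adjoin_min E : is_subfield E -> F `<=` E -> E x -> adjoin F x `<=` E.
Proof.
move=> HE FE Ex y; apply; split=> //.
by move=> z [/FE //|->].
Qed.

Lemma adjoin_sub : F `<=` adjoin F x.
Proof. by move=> y Fy E [_]; apply; left. Qed.

Lemma adjoin_mem : adjoin F x x.
Proof. by move=> E [_]; apply; right. Qed.

Lemma adjoin_subfield : is_subfield (adjoin F x).
Proof.
apply/is_subfieldP; split.
- by move=> E [HE _]; apply: subfield1.
- move=> y z Fy Fz E HE; have [HE' _] := HE.
  by apply: (subfieldB HE'); [apply: Fy|apply: Fz].
- move=> y z Fy Fz E HE; have [HE' _] := HE.
  by apply: (subfieldM HE'); [apply: Fy|apply: Fz].
- move=> y Fy E HE; have [HE' _] := HE.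
  by apply: (subfieldV HE'); apply: Fy.
Qed.

End Adjoin.

Section Degree.
Variables (L : fieldType) (F E : set L).
Hypothesis HF : is_subfield F.

(** Expressing each family in the other gives an m by n matrix [A] and an n by m matrix [B].
    Uniqueness of coordinates forces [A *m B] to be the identity, so m cannot exceed n. *)
Lemma basis_card_le m n (b : 'I_m -> L) (b' : 'I_n -> L) :
  is_basis F E b -> is_basis F E b' -> (m <= n)%N.
Proof.
move=> [Eb bP] [Eb' bP'].
have cP i : {c : {ffun 'I_n -> L} | (forall j, F (c j)) /\ b i = \sum_(j < n) c j * b' j}.
  by apply/cid; have [c [cP _]] := bP' _ (Eb i); exists c.
have cP' i : {c : {ffun 'I_m -> L} | (forall j, F (c j)) /\ b' i = \sum_(j < m) c j * b j}.
  by apply/cid; have [c [cP' _]] := bP _ (Eb' i); exists c.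
pose A := \matrix_(i, j) sval (cP i) j.
pose B := \matrix_(i, j) sval (cP' i) j.
suff : A *m B = 1%:M by exact: mulmx1_min.
apply/matrixP => i k; rewrite [RHS]mxE.
have [c [_ cU]] := bP _ (Eb i).
pose c1 := [ffun k => (A *m B) i k]; pose c2 := [ffun k : 'I_m => (i == k)%:R : L].
suff e : c1 = c2 by have := congr1 (fun f : {ffun _ -> _} => f k) e; rewrite !ffunE.
have e1 : c = c1.
  apply: cU; split=> [j|].
    rewrite ffunE mxE; apply: (subfield_sum HF) => l _; rewrite !mxE.
    by apply: (subfieldM HF); [case: (svalP (cP i))|case: (svalP (cP' l))].
  case: (svalP (cP i)) => _ {1}->.
  under eq_bigr => l _.
    case: (svalP (cP' l)) => _ {1}->; rewrite mulr_sumr; over.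
  rewrite exchange_big /=; apply: eq_bigr => j _; rewrite ffunE mxE mulr_suml.
  by apply: eq_bigr => l _; rewrite !mxE mulrA.
rewrite -e1; apply: cU; split=> [j|].
  by rewrite ffunE; case: (_ == _); [apply: subfield1|apply: subfield0].
rewrite (bigD1 i) //= ffunE eqxx mul1r big1 ?addr0 // => j ji.
by rewrite ffunE eq_sym (negPf ji) mul0r.
Qed.

Lemma ext_degree_eq n (b : 'I_n -> L) : is_basis F E b -> ext_degree F E = n.
Proof.
move=> hb; rewrite /ext_degree; apply: xget_unique; first by exists b.
move=> m [b' hb'].
by apply/eqP; rewrite eqn_leq (basis_card_le hb hb') (basis_card_le hb' hb).
Qed.

End Degree.

Section MinPoly.
Variables (K L : fieldType) (iota : {rmorphism K -> L}).
Local Notation "p ^i" := (map_poly iota p) (at level 2, format "p ^i") : ring_scope.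

Lemma is_subfield_range : is_subfield (range iota).
Proof.
apply/is_subfieldP; split.
- by exists 1; rewrite ?rmorph1.
- by move=> _ _ [a _ <-] [b _ <-]; exists (a - b); rewrite ?rmorphB.
- by move=> _ _ [a _ <-] [b _ <-]; exists (a * b); rewrite ?rmorphM.
- by move=> _ [a _ <-]; exists a^-1; rewrite ?fmorphV.
Qed.

Lemma min_poly_exists x : algebraicOver iota x -> exists p, is_min_poly iota x p.
Proof.
move=> [p0 p0N rp0].
pose P n := `[< exists2 p : {poly K}, p != 0 /\ root p^i x & size p = n >].
have exP : exists n, P n by exists (size p0); apply/asboolP; exists p0.
case: (ex_minnP exP) => n /asboolP [p [pN rp] sp] nmin.
have min q : q != 0 -> root q^i x -> (size p <= size q)%N.
  by move=> qN rq; rewrite sp; apply: nmin; apply/asboolP; exists q.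
have lN : (lead_coef p)^-1 != 0 by rewrite invr_eq0 lead_coef_eq0.
exists ((lead_coef p)^-1 *: p); split.
- by rewrite monicE lead_coefZ mulVf ?lead_coef_eq0.
- split.
    rewrite size_scale //; case: (ltngtP (size p) 1%N) => //.
      by rewrite ltnS leqn0 size_poly_eq0 (negPf pN).
    by move=> /eqP/size_poly1P [a aN pa]; move: rp; rewrite pa map_polyC rootC fmorph_eq0 (negPf aN).
  (* In a factorization p = r q one factor vanishes at x and has full size by minimality. If it is
     r, then q is constant, which [sq] excludes. *)
  move=> q sq; rewrite dvdpZr // => /dvdpP [r pr].
  have rN : r != 0 by apply: contraNneq pN => r0; rewrite pr r0 mul0r.
  have qN : q != 0 by apply: contraNneq pN => q0; rewrite pr q0 mulr0.
  apply: (@eqp_trans _ p); last by rewrite eqp_sym eqp_scale.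
  rewrite -dvdp_size_eqp; last by rewrite pr dvdp_mull.
  have sqp : (size q <= size p)%N by apply: dvdp_leq => //; rewrite pr dvdp_mull.
  rewrite eqn_leq sqp /=; move: (rp); rewrite pr rmorphM rootM => /orP [] rr.
    have := min _ rN rr; rewrite pr size_mul // => h.
    have q0 : (0 < size q)%N by rewrite size_poly_gt0.
    have r0 : (0 < size r)%N by rewrite size_poly_gt0.
    case: (size q) sq h q0 => [//|[//|k]] _.
    by rewrite !addnS /= ltnNge leq_addr.
  by rewrite -pr; apply: min.
- by rewrite map_polyZ rootZ // fmorph_eq0.
Qed.

Variables (x : L) (p : {poly K}).
Hypothesis px : is_min_poly iota x p.

Lemma min_poly_monic : p \is monic. Proof. by case: px. Qed.

Lemma min_poly_root : p^i.[x] = 0. Proof. by case: px => _ _ /rootP. Qed.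

Lemma min_poly_size : (1 < size p)%N. Proof. by case: px => _ []. Qed.

Lemma min_poly_sizeS : size p = (size p).-1.+1.
Proof. by have := min_poly_size; case: (size p). Qed.

Lemma min_poly_deg_gt0 : (0 < (size p).-1)%N.
Proof. by have := min_poly_size; case: (size p) => [|[]]. Qed.

Lemma min_poly_neq0 : p != 0. Proof. exact: monic_neq0 min_poly_monic. Qed.

Lemma min_poly_dvd q : root q^i x = (p %| q).
Proof.
apply/idP/idP => [rq|/dvdpP [r ->]]; last first.
  by rewrite rmorphM rootM [root p^i x](introT rootP min_poly_root) orbT.
have rg : root (gcdp p q)^i x.
  by rewrite gcdp_map root_gcd rq (introT rootP min_poly_root).
have [_ [_ irr] _] := px.
have gN : gcdp p q != 0 by rewrite gcdp_eq0 negb_and min_poly_neq0.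
have sg : size (gcdp p q) != 1%N.
  apply: contraTN rg => /size_poly1P [a aN ->].
  by rewrite map_polyC rootC fmorph_eq0.
have := irr _ sg (dvdp_gcdl _ _); rewrite eqp_sym => /eqp_dvdl h.
by rewrite h dvdp_gcdr.
Qed.

Lemma min_poly_unique q : is_min_poly iota x q -> q = p.
Proof.
move=> [mq [sq irr] rq]; apply/eqP.
rewrite -eqp_monic ?min_poly_monic // eqp_sym; apply: irr.
  by rewrite gtn_eqF // min_poly_size.
by rewrite -min_poly_dvd.
Qed.

Lemma min_poly_size_le q : q != 0 -> root q^i x -> (size p <= size q)%N.
Proof. by move=> qN; rewrite min_poly_dvd; apply: dvdp_leq. Qed.

Lemma min_poly_coprime q : ~~ root q^i x ->
  exists u, q^i.[x] * u^i.[x] = 1.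
Proof.
rewrite min_poly_dvd => npq; have [_ [_ irr] _] := px.
have : coprimep p q.
  rewrite coprimep_def; apply: contraT => sg.
  have := irr _ sg (dvdp_gcdl _ _); rewrite eqp_sym => /eqp_dvdl h.
  by move: npq; rewrite h dvdp_gcdr.
move=> /Bezout_eq1_coprimepP [[u w] /= e]; exists w.
have := congr1 (fun r => r^i.[x]) e.
rewrite rmorphD !rmorphM rmorph1 hornerD !hornerM hornerC min_poly_root mulr0 add0r.
by rewrite mulrC.
Qed.

(** Bezout's identity turns the inverse of a nonzero q(x) into the value of a polynomial, so the
    remainders modulo p already give a field. *)
Lemma adjoinE : adjoin (range iota) x = [set q^i.[x] | q in [set q : {poly K} | (size q < size p)%N]].
Proof.
apply/seteqP; split; last first.
  move=> _ [q _ <-]; apply: (subfield_horner (adjoin_subfield _ _)); last exact: adjoin_mem.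
  by move=> i; apply: adjoin_sub; rewrite coef_map; exists q`_i.
have red q : exists2 r : {poly K}, (size r < size p)%N & r^i.[x] = q^i.[x].
  exists (q %% p); first by rewrite ltn_modpN0 ?min_poly_neq0.
  rewrite [in RHS](divp_eq q p) rmorphD rmorphM hornerD hornerM min_poly_root.
  by rewrite mulr0 add0r.
apply: adjoin_min.
- apply/is_subfieldP; split.
  + by have [r sr e] := red 1; exists r; rewrite ?e ?rmorph1 ?hornerC.
  + move=> _ _ [q1 _ <-] [q2 _ <-].
    by have [r sr e] := red (q1 - q2); exists r; rewrite ?e ?rmorphB ?hornerD ?hornerN.
  + move=> _ _ [q1 _ <-] [q2 _ <-].
    by have [r sr e] := red (q1 * q2); exists r; rewrite ?e ?rmorphM ?hornerM.
  + move=> _ [q1 _ <-]; case: (boolP (root q1^i x)) => [/rootP ->|].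
      have [r sr e] := red 0; exists r => //.
      by rewrite e rmorph0 horner0 invr0.
    move=> /min_poly_coprime [u e]; have [r sr e'] := red u; exists r => //.
    have q0 : q1^i.[x] != 0.
      by apply: contra_eq_neq e => ->; rewrite mul0r eq_sym oner_neq0.
    by rewrite e'; apply: (mulfI q0); rewrite e mulfV.
- move=> _ [a _ <-]; have [r sr e] := red a%:P; exists r => //.
  by rewrite e map_polyC hornerC.
- by have [r sr e] := red 'X; exists r => //; rewrite e map_polyX hornerX.
Qed.

Lemma adjoin_horner q : adjoin (range iota) x q^i.[x].
Proof.
apply: (subfield_horner (adjoin_subfield _ _)); last exact: adjoin_mem.
by move=> i; apply: adjoin_sub; rewrite coef_map; exists q`_i.
Qed.

Lemma min_poly_small_root (q : {poly K}) : (size q < size p)%N -> q^i.[x] = 0 -> q = 0.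
Proof.
move=> sq /rootP rq; apply/eqP; apply: contraT => qN.
by have := min_poly_size_le qN rq; rewrite leqNgt sq.
Qed.

Lemma adjoin_basis :
  is_basis (range iota) (adjoin (range iota) x) (fun i : 'I_(size p).-1 => x ^+ i).
Proof.
have sp : ((size p).-1.+1 = size p)%N by rewrite prednK // ltnW // min_poly_size.
split=> [i|y].
  by apply: (subfieldX (adjoin_subfield _ _)); apply: adjoin_mem.
rewrite adjoinE => -[q sq <-] /=.
have sq' : (size q <= (size p).-1)%N by rewrite -ltnS sp.
exists [ffun i : 'I_(size p).-1 => iota q`_i]; split=> [|c [Fc]].
  split=> [i|]; first by rewrite ffunE; exists q`_i.
  rewrite (horner_coef_wide _ (n := (size p).-1)) ?size_map_poly //.
  by apply: eq_bigr => i _; rewrite ffunE coef_map.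
have c' i : {a | iota a = c i} by apply/cid; have [a _ <-] := Fc i; exists a.
pose r := \poly_(i < (size p).-1) (if insub i is Some j then sval (c' j) else 0).
have rE (i : 'I_(size p).-1) : iota r`_i = c i.
  by rewrite coef_poly ltn_ord valK (svalP (c' i)).
have sr : (size r <= (size p).-1)%N by apply: size_poly.
move=> e; have : (q - r) = 0.
  apply: min_poly_small_root; first by
    rewrite -sp ltnS (leq_trans (size_polyD _ _)) // size_polyN geq_max sq' sr.
  rewrite rmorphB hornerD hornerN e.
  rewrite (horner_coef_wide _ (n := (size p).-1) (p := r^i)) ?size_map_poly //.
  by apply/eqP; rewrite subr_eq0; apply/eqP; apply: eq_bigr => i _; rewrite coef_map -(rE i).
move/eqP; rewrite subr_eq0 => /eqP qr; apply/ffunP => i.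
by rewrite ffunE qr; apply: rE.
Qed.

Lemma adjoin_ext_degree : ext_degree (range iota) (adjoin (range iota) x) = (size p).-1.
Proof. exact: ext_degree_eq is_subfield_range _ _ adjoin_basis. Qed.

End MinPoly.

(** * Extension of isometric embeddings *)

Section CompanionEigenvalues.

Lemma eigenvalue_horner_mx (F : fieldType) n (M : 'M[F]_n.+1) (g : {poly F}) y :
  eigenvalue M y -> eigenvalue (horner_mx M g) g.[y].
Proof.
move=> /eigenvalueP [u uM u0]; apply/eigenvalueP; exists u => //.
elim/poly_ind: g => [|g c IH]; first by rewrite rmorph0 horner0 mulmx0 scale0r.
rewrite rmorphD rmorphM /= horner_mx_X horner_mx_C mulmxDr.
rewrite [u *m (_ * _)]mulmxA IH -scalemxAl uM mul_mx_scalar scalerA.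
by rewrite hornerMXaddC scalerDl.
Qed.

(** The eigenvector is annihilated by the product of the M - z over the roots z of g - b. When the
    factors are applied one at a time, the last nonzero vector is an eigenvector of M for such a
    z. *)
Lemma eigenvalue_horner_mx_inv (F : closedFieldType) n (M : 'M[F]_n.+1)
    (g : {poly F}) b :
  eigenvalue (horner_mx M g) b -> exists2 y, eigenvalue M y & g.[y] = b.
Proof.
move=> /eigenvalueP [u uM u0].
have {uM} : u *m horner_mx M (g - b%:P) = 0.
  by rewrite rmorphB /= horner_mx_C mulmxBr uM mul_mx_scalar subrr.
(* If g is the constant b, any eigenvalue of M serves; one exists because F is closed and M has
   positive size. *)
have [q0 _|qN] := eqVneq (g - b%:P) 0.
  have [y ry] : exists y, root (char_poly M) y.
    by apply/closed_rootP; rewrite size_char_poly.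
  exists y; first by rewrite eigenvalue_root_char.
  by move/eqP: q0; rewrite subr_eq0 => /eqP ->; rewrite hornerC.
have [r qr] := closed_field_poly_normal (g - b%:P).
have gr z : z \in r -> g.[z] = b.
  move=> zr; have : root (g - b%:P) z.
    by rewrite qr rootZ ?lead_coef_eq0 // root_prod_XsubC.
  by rewrite rootE hornerD hornerN hornerC subr_eq0 => /eqP.
rewrite qr -mul_polyC rmorphM /= horner_mx_C [_ * _]mul_scalar_mx -scalemxAr.
move/eqP; rewrite scalemx_eq0 lead_coef_eq0 (negPf qN) /= => /eqP.
move: {qr} r gr u u0; elim=> [|z r IH] gr u u0.
  by rewrite big_nil rmorph1 mulmx1 => e; rewrite e eqxx in u0.
rewrite big_cons rmorphM mulmxA.
have [e _|w0 e] := eqVneq (u *m horner_mx M ('X - z%:P)) 0; last first.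
  by apply: IH e => // t tr; apply: gr; rewrite inE tr orbT.
exists z; last by apply: gr; rewrite mem_head.
apply/eigenvalueP; exists u => //; apply/eqP; rewrite -subr_eq0.
by move/eqP: e; rewrite rmorphB /= horner_mx_X horner_mx_C mulmxBr mul_mx_scalar.
Qed.

(* [chi] is the characteristic polynomial of multiplication by [g] modulo [p]. *)
Lemma poly_of_horner_roots (F : fieldType) (p g : {poly F}) :
    p \is monic -> (1 < size p)%N ->
  exists2 chi : {poly F}, chi != 0 &
    forall (L : closedFieldType) (i : {rmorphism F -> L}) b,
      root (map_poly i chi) b <->
      exists2 y, root (map_poly i p) y & (map_poly i g).[y] = b.
Proof.
move=> pm sp.
have [n [M Mp]] : exists n (M : 'M[F]_n.+1), char_poly M = p.
  have := companionmxK pm; move: (companionmx p).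
  by case: (size p) sp => [//|[//|k]] _ M <-; exists k, M.
exists (char_poly (horner_mx M g)) => [|L i b]; first exact: monic_neq0 (char_poly_monic _).
rewrite map_char_poly map_horner_mx -eigenvalue_root_char -Mp map_char_poly.
split=> [/eigenvalue_horner_mx_inv [y hy <-]|[y hy <-]].
  by exists y => //; rewrite -eigenvalue_root_char.
by apply: eigenvalue_horner_mx; rewrite eigenvalue_root_char.
Qed.

End CompanionEigenvalues.

(** * Terms of least value and Newton polygons *)

Section MinimalTerm.
Variables (L : fieldType) (G : oagType) (v : valuation L G).

Lemma exists_min_value n (f : 'I_n.+1 -> L) :
  exists i, forall j, vle (v (f i)) (v (f j)).
Proof.
have tr : transitive (@vle G) by move=> b a c; apply: vle_trans.
have [i _ h] := extremumP (P := xpredT) (i0 := ord0) (fun i => v (f i))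
  (@vle_refl G) tr (@vle_total G) isT.
by exists i => j; apply: h.
Qed.

Lemma val_sum_unique_min n (f : 'I_n -> L) k :
    (forall j, j != k -> vlt (v (f k)) (v (f j))) ->
  f k != 0 -> v (\sum_i f i) = v (f k).
Proof.
move=> h fk; rewrite (bigD1 k) //=; apply: val_addl.
by apply: val_gt_sum => //; apply/(v_neq0 v).
Qed.

(** A single term of least value would give the sum its own finite value, so in a vanishing sum the
    least value occurs twice. *)
Lemma sum0_equal_values n (f : 'I_n -> L) : \sum_i f i = 0 ->
  (exists i, f i != 0) -> exists i j : 'I_n, [/\ (i < j)%N, f i != 0 & v (f i) = v (f j)].
Proof.
case: n f => [|n] f s0 [i0 fi0]; first by case: i0 fi0.
have [k km] := exists_min_value f.
have fk : f k != 0.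
  apply/(v_neq0 v) => e; move: (km i0); rewrite e.
  by move=> h; have /(v_neq0 v) := fi0; apply; exact: vle_anti (vleN _) h.
suff [j jk e] : exists2 j, j != k & v (f k) = v (f j).
  case: (ltngtP j k) => h; [exists j, k|exists k, j|] => //.
    by rewrite e; split=> //; apply/(v_neq0 v); rewrite -e; apply/(v_neq0 v).
  by move/val_inj: h jk => ->; rewrite eqxx.
apply: contrapT => /forall2NP h.
have km' l : l != k -> vlt (v (f k)) (v (f l)).
  by move=> lk; have [e|//] := vle_eqVlt (km l); case: (h l) => [|/(_ e)//]; rewrite lk.
have /(v_neq0 v) := fk; apply.
by rewrite -(val_sum_unique_min km' fk) s0 v0.
Qed.

(** Two terms q_s a^s and q_t a^t of the algebraic relation have the same value, whence a^(t - s)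
    has the value of q_s / q_t. *)
Lemma value_torsion (F : fieldType) (i : {rmorphism F -> L}) a :
    algebraicOver i a -> a != 0 ->
  exists k c, [/\ (0 < k)%N, c != 0 & v (a ^+ k) = v (i c)].
Proof.
move=> [q qN rq] a0.
have /rootP := rq; rewrite horner_coef => /sum0_equal_values [].
  have lt : ((size q).-1 < size (map_poly i q))%N.
    by rewrite size_map_poly prednK // size_poly_gt0.
  exists (Ordinal lt) => /=; rewrite coef_map mulf_eq0 negb_or expf_neq0 //.
  by rewrite andbT fmorph_eq0 -lead_coefE lead_coef_eq0.
move=> s [t [st fs e]].
rewrite !coef_map /= in fs e.
have : q`_t != 0.
  apply/negP => /eqP qt; move: e; rewrite qt rmorph0 mul0r v0 => /v_eq0 e.
  by rewrite e eqxx in fs.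
have : q`_s != 0 by apply: contraNneq fs => ->; rewrite rmorph0 mul0r.
move=> qs qt; exists (t - s)%N, (q`_s / q`_t); split; first by rewrite subn_gt0.
  by rewrite mulf_neq0 // invr_eq0.
apply: (@v_mulI _ _ v (i q`_t * a ^+ s)).
  by rewrite mulf_neq0 ?fmorph_eq0 ?expf_neq0.
rewrite -mulrA -exprD subnKC ?(ltnW st) // -e fmorph_div.
by congr (v _); field; rewrite fmorph_eq0.
Qed.

(** The Newton polygon has no side of slope zero. The index of the least coefficient counts the
    roots of positive value: multiplying by X - t raises it by one if v(t) > 0 and keeps it if v(t)
    < 0. *)
Lemma poly_unique_min_coef (q : {poly L}) (r : seq L) c : c != 0 ->
    q = c *: \prod_(z <- r) ('X - z%:P) ->
    (forall b, b \in r -> v b <> v 1) ->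
  exists k, forall l, l != k -> vlt (v q`_k) (v q`_l).
Proof.
move=> c0 ->; elim: r => [|t r IH] h.
  exists 0%N => l l0; rewrite big_nil alg_polyC !coefC /= (negPf l0) v0.
  by apply/vlt_None/v_neq0.
have [|k kP] := IH; first by move=> b br; apply: h; rewrite inE br orbT.
move: kP; rewrite big_cons mulrC scalerAl; move: (c *: _) => {IH c0}q kP.
have qk : v q`_k <> None.
  by move=> e; have := kP k.+1; rewrite e gtn_eqF // => /(_ isT); case: (v _).
have kle l : vle (v q`_k) (v q`_l).
  by have [->|/kP/vltW //] := eqVneq l k; rewrite vle_refl.
have cE l : (q * ('X - t%:P))`_l = (if l == 0%N then 0 else q`_l.-1) - t * q`_l.
  by rewrite mulrBr coefB coefMX coefMC mulrC.
case: (boolP (vle (v 1) (v t))) => [/vle_eqVlt [e|t1]|t1].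
  by case: (h t (mem_head _ _)); rewrite e.
  have tq l : vlt (v q`_k) (v (t * q`_l)).
    have := vlt_le_mul _ t1 (kle l); rewrite mul1r; apply; exact/(v_neq0 v).
  exists k.+1 => l lk; rewrite !cE /= (val_addl (y := - _)) ?vN //.
  case: l lk => [|l] lk /=; first by rewrite sub0r vN.
  by apply: val_gtD; rewrite ?vN //; apply: kP.
have t1' : vlt (v t) (v 1) by [].
have tk : vlt (v (t * q`_k)) (v q`_k).
  by rewrite mulrC -[X in vlt _ (v X)]mulr1 vlt_mul2lE //; apply/(v_neq0 v).
have t0 : t != 0 by apply: contraNneq t1 => ->; rewrite v0 vleN.
have pr l : vlt (v (t * q`_k)) (v (if l == 0%N then 0 else q`_l.-1)).
  case: l => [|l] /=; last exact: vlt_le_trans tk (kle _).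
  by rewrite v0; apply: vlt_None; apply/(v_neq0 v); rewrite mulf_neq0 //; apply/(v_neq0 v).
exists k => l lk; rewrite !cE [v (_ - t * q`_k)](_ : _ = v (t * q`_k)); last first.
  by rewrite addrC -[RHS]vN; apply: val_addl; rewrite vN.
by apply: val_gtD; rewrite ?vN // vlt_mul2lE //; apply: kP.
Qed.

End MinimalTerm.

Section IsometricStep.
Variables (L : closedFieldType) (G : oagType) (v : valuation L G).
Variables (F : fieldType) (i j : {rmorphism F -> L}).
Hypothesis iso : forall c, v (i c) = v (j c).

(* If [p] had no root of value 0 along [j], exactly one of its coefficients
   would have the least value, so [p] could not vanish at [a]. *)
Lemma isometric_unit_root (p : {poly F}) a : p != 0 ->
  root (map_poly i p) a -> v a = v 1 ->
  exists2 b, root (map_poly j p) b & v b = v 1.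
Proof.
move=> pN /rootP pa a1; apply: contrapT => /forall2NP h.
have [r rE] := closed_field_poly_normal (map_poly j p).
have lN : lead_coef (map_poly j p) != 0 by rewrite lead_coef_eq0 map_poly_eq0.
have [b|k kP] := poly_unique_min_coef (v := v) lN rE.
  by case: (h b) => // nr br; case: nr; rewrite rE rootZ // root_prod_XsubC.
have aX l : v (a ^+ l) = v 1.
  by rewrite (vX l (etrans a1 (v1 v))) mul0rn v1.
have vE l : v ((map_poly i p)`_l * a ^+ l) = v (map_poly j p)`_l.
  by rewrite vM aX -vM mulr1 !coef_map /= iso.
have jk : (map_poly j p)`_k != 0.
  apply/(v_neq0 v) => e; have := kP k.+1; rewrite e gtn_eqF // => /(_ isT).
  by case: (v _).
have lt : (k < size (map_poly i p))%N.
  rewrite size_map_poly ltnNge; apply: contra jk => h'.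
  by rewrite coef_map nth_default ?raddf0.
have /(v_neq0 v) := jk; apply; rewrite -vE -[in LHS]/(nat_of_ord (Ordinal lt)).
rewrite -(val_sum_unique_min (v := v) (k := Ordinal lt)
  (f := fun l : 'I_(size (map_poly i p)) => (map_poly i p)`_l * a ^+ l)).
- by rewrite -horner_coef pa v0.
- by move=> l lk; rewrite !vE; apply: kP.
- by apply/(v_neq0 v); rewrite vE; apply/(v_neq0 v).
Qed.

(** Each z excludes at most one t, so all large t survive. The conclusion is folded over the list
    because [T] carries no equality test. *)
Lemma avoid_finitely_many (T : Type) (s : seq T) (B : T -> nat -> Prop) :
    (forall z t t', B z t -> B z t' -> t = t') ->
  exists t0, forall t, (t0 <= t)%N -> foldr (fun z P => ~ B z t /\ P) True s.
Proof.
move=> h; elim: s => [|z s [t0 IH]]; first by exists 0%N.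
have [[t1 zt1]|nz] := pselect (exists t, B z t); last first.
  by exists t0 => t /IH ?; split=> // zt; apply: nz; exists t.
exists (maxn t0 t1.+1) => t; rewrite geq_max => /andP [/IH st t1t]; split=> //.
by move=> zt; move: t1t; rewrite (h _ _ _ zt zt1) ltnn.
Qed.

Variables (p : {poly F}) (y : L).
Hypothesis py : is_min_poly i y p.

(** Suppose that each root along [j] disagrees with y on some polynomial. These polynomials combine
    into one g that disagrees at all roots. Some power of g(y) has the value of a constant c;
    dividing by c gives a unit, and [isometric_unit_root] produces a root along [j] where g has the
    right value after all. *)
Lemma isometric_step :
  exists2 y', root (map_poly j p) y' &
    forall g, v (map_poly i g).[y] = v (map_poly j g).[y'].
Proof.
apply: contrapT => /forall2NP noy.
have bad y' : root (map_poly j p) y' -> exists2 g : {poly F},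
    (map_poly i g).[y] != 0 & v (map_poly i g).[y] <> v (map_poly j g).[y'].
  move=> ry'; case: (noy y') => // /existsNP [g ne]; exists g => //.
  apply/negP; rewrite -rootE (min_poly_dvd py) => /dvdpP [q gq]; apply: ne.
  by rewrite gq !rmorphM !hornerM (min_poly_root py) (rootP ry') !mulr0 !v0.
have pN := min_poly_neq0 py.
have [r rE] := closed_field_poly_normal (map_poly j p).
have rP b : (b \in r) = root (map_poly j p) b.
  by rewrite rE rootZ ?root_prod_XsubC // lead_coef_eq0 map_poly_eq0.
(* The values of [g(y)] and [g(y')] differ by a homomorphism in [g] with
   torsion-free target, so finitely many nontrivial ones avoid 0 together. *)
have [g gy gP] : exists2 g : {poly F}, (map_poly i g).[y] != 0 &
    forall y', y' \in r -> v (map_poly i g).[y] <> v (map_poly j g).[y'].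
  have : {subset r <= r} by [].
  elim: {-2}r => [|y1 s IH] sr.
    by exists 1 => //; rewrite rmorph1 hornerC oner_neq0.
  have [g gy gs] : exists2 g : {poly F}, (map_poly i g).[y] != 0 &
      forall y', y' \in s -> v (map_poly i g).[y] <> v (map_poly j g).[y'].
    by apply: IH => z zs; apply: sr; rewrite inE zs orbT.
  have [|b bY bne] := bad y1; first by rewrite -rP sr // mem_head.
  pose eqv (h : {poly F}) z := v (map_poly i h).[y] = v (map_poly j h).[z].
  have hX h t (k : {rmorphism F -> L}) z :
      (map_poly k (b * h ^+ t)).[z] = (map_poly k b).[z] * (map_poly k h).[z] ^+ t.
    by rewrite rmorphM rmorphXn hornerM horner_exp.
  have hM h1 h2 (k : {rmorphism F -> L}) z :
      (map_poly k (h1 * h2)).[z] = (map_poly k h1).[z] * (map_poly k h2).[z].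
    by rewrite rmorphM hornerM.
  have eq0 h z : (map_poly i h).[y] != 0 -> eqv h z -> (map_poly j h).[z] != 0.
    by move=> hy e; apply/(v_neq0 v); rewrite -e; apply/(v_neq0 v).
  have bgy t : (map_poly i (b * g ^+ t)).[y] != 0.
    by rewrite hX mulf_neq0 // expf_neq0.
  (* Dividing the two agreements leaves agreement for g^(t' - t), hence for g by torsion-freeness.
     So a root at which g already disagrees excludes at most one exponent. *)
  have dup z t t' : (t < t')%N -> eqv (b * g ^+ t) z -> eqv (b * g ^+ t') z ->
      eqv g z.
    move=> tt' et et'; have z0 := eq0 _ _ (bgy t) et.
    have := et'; rewrite /eqv -(subnKC (ltnW tt')) exprD mulrA.
    rewrite (hM (b * g ^+ t) _ i) (hM (b * g ^+ t) _ j) vM et -vM => /(v_mulI z0).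
    rewrite !rmorphXn !horner_exp; apply: vX_eq; by rewrite subn_gt0.
  have dup' z t t' : ~ eqv g z -> eqv (b * g ^+ t) z -> eqv (b * g ^+ t') z -> t = t'.
    move=> ng et et'; case: (ltngtP t t') => // tt'; case: ng.
      exact: dup tt' et et'.
    exact: dup tt' et' et.
  have [t0 t0P] := @avoid_finitely_many L (y1 :: s)
    (fun z t => eqv (b * g ^+ t) z /\ ~ eqv g z)
    (fun z t t' h1 h2 => dup' z t t' h1.2 h1.1 h2.1).
  exists (b * g ^+ t0) => // z; have := t0P _ (leqnn t0).
  rewrite inE => /= -[n1 ns] /orP [/eqP ->|zs].
    (* If g agrees at y1, then b g^t0 can agree there only if b does, against the choice of b. *)
    move=> e; case: (pselect (eqv g y1)) => ge; last by apply: n1.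
    apply: bne; have := e; rewrite !hX.
    have gX : v ((map_poly i g).[y] ^+ t0) = v ((map_poly j g).[y1] ^+ t0).
      by elim: (t0) => [|k IHk]; rewrite ?expr0 // !exprS vM ge IHk -vM.
    rewrite vM gX -vM mulrC [_ * _ ^+ _]mulrC; apply: v_mulI.
    by rewrite expf_neq0 //; apply: eq0 ge.
  move=> e; move: zs ns gs; elim: (s) => //= z' s' IHs.
  rewrite inE => /orP [/eqP <- [nz _] gs|zs' [_ ns] gs].
    by apply: nz; split=> // ge; apply: (gs z) => //; rewrite mem_head.
  by apply: IHs zs' ns _ => w ws; apply: gs; rewrite inE ws orbT.
have alg : algebraicOver i (map_poly i g).[y].
  have [chi chiN chiP] := poly_of_horner_roots g (min_poly_monic py) (min_poly_size py).
  exists chi => //; apply/chiP; exists y => //; exact/rootP/(min_poly_root py).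
have [k [c [k0 c0 kc]]] := value_torsion v alg gy.
(* g2 has value 0 at y, and at no root along [j], since c has the same value under both
   embeddings. *)
pose g2 := c^-1 *: g ^+ k.
have g2E (m : {rmorphism F -> L}) z :
    (map_poly m g2).[z] = (map_poly m g).[z] ^+ k / m c.
  by rewrite map_polyZ hornerZ rmorphXn horner_exp fmorphV mulrC.
(* [chi] has coefficients in F, so the same polynomial describes the conjugates of g2(y) along both
   embeddings. *)
have [chi chiN chiP] := poly_of_horner_roots g2 (min_poly_monic py) (min_poly_size py).
have [||_ /chiP [y' ry' <-]] := @isometric_unit_root chi (map_poly i g2).[y] chiN.
- by apply/chiP; exists y => //; apply/rootP/(min_poly_root py).
- by rewrite g2E; apply/v_div1; rewrite ?fmorph_eq0.
rewrite g2E => /v_div1; rewrite fmorph_eq0 => /(_ c0); rewrite -iso -kc.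
move=> /(vX_eq k0) e; apply: (gP y'); [by rewrite rP|by rewrite e].
Qed.

End IsometricStep.

Section IsometricExtension.
Variables (K : fieldType) (L : closedFieldType) (iota : {rmorphism K -> L}).
Hypothesis alg : forall x, algebraicOver iota x.
Variables (G : oagType) (v : valuation L G).

(* Partial isometric K-embeddings of L are encoded by their graphs, so that
   unions of chains are unions of sets. *)
Definition isometric_graph (S : set (L * L)) : Prop :=
  [/\ forall k, S (iota k, iota k),
      forall x x' y y', S (x, x') -> S (y, y') -> S (x - y, x' - y'),
      forall x x' y y', S (x, x') -> S (y, y') -> S (x * y, x' * y'),
      forall x x', S (x, x') -> S (x^-1, x'^-1)
    & forall x x', S (x, x') -> v x = v x'].

(** The pair of differences (x - x, y - y') lies in S, so y - y' has the value infinity of 0. *)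
Lemma isometric_graph_fun S x y y' :
  isometric_graph S -> S (x, y) -> S (x, y') -> y = y'.
Proof.
move=> [_ SB _ _ Sv] xy xy'; have /Sv := SB _ _ _ _ xy xy'.
by rewrite subrr v0 => /esym /v_eq0 /eqP; rewrite subr_eq0 => /eqP.
Qed.

(** Only 0 has value infinity, so the isometry carries every polynomial relation at y over to y'.
    Applied to a relation g u = 1, this gives the closure under inverses. *)
Lemma horner_isometric_graph (F : fieldType) (i j : {rmorphism F -> L}) p y y' :
    (forall k, exists2 c, i c = iota k & j c = iota k) ->
    is_min_poly i y p ->
    (forall g, v (map_poly i g).[y] = v (map_poly j g).[y']) ->
  isometric_graph [set z | exists g, z = ((map_poly i g).[y], (map_poly j g).[y'])].
Proof.
move=> ijK py iso.
split=> [k|x x' z z' [g [-> ->]] [h [-> ->]]|x x' z z' [g [-> ->]] [h [-> ->]]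
        |x x' [g [-> ->]]|x x' [g [-> ->]] //].
- by have [c ic jc] := ijK k; exists c%:P; rewrite !map_polyC !hornerC /= ic jc.
- by exists (g - h); rewrite !rmorphB !hornerD !hornerN.
- by exists (g * h); rewrite !rmorphM !hornerM.
case: (boolP (root (map_poly i g) y)) => [/rootP|] gy.
  exists 0; rewrite !rmorph0 !horner0; have := iso g; rewrite gy v0.
  by move=> /esym /v_eq0 ->; rewrite !invr0.
have [u gu] := min_poly_coprime py gy; exists u.
have gu' : (map_poly j g).[y'] * (map_poly j u).[y'] = 1.
  have := iso (g * u - 1).
  rewrite !rmorphB !rmorphM !rmorph1 !hornerD !hornerN !hornerM !hornerC gu subrr v0.
  by move=> /esym /v_eq0 /eqP; rewrite subr_eq0 => /eqP.
have inv (a b : L) : a * b = 1 -> a^-1 = b.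
  move=> ab; have a0 : a != 0 by apply: contra_eq_neq ab => ->; rewrite mul0r eq_sym oner_neq0.
  by apply: (mulfI a0); rewrite ab mulfV.
by rewrite (inv _ _ gu) (inv _ _ gu').
Qed.

(** The domain of S is a field containing K; [i] is its inclusion and [j] the isometric embedding
    with graph S. An image for y then comes from [isometric_step]. *)
Lemma isometric_graph_extend S y : isometric_graph S ->
  exists S', [/\ isometric_graph S', S `<=` S' & exists y', S' (y, y')].
Proof.
move=> HS; have [SK SB SM SV Sv] := HS.
pose E := [set x | exists x', S (x, x')].
have HE : is_subfield E.
  apply/is_subfieldP; split.
  - by exists 1; rewrite -(rmorph1 iota).
  - by move=> x z [x' Sx] [z' Sz]; exists (x' - z'); apply: SB.
  - by move=> x z [x' Sx] [z' Sz]; exists (x' * z'); apply: SM.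
  - by move=> x [x' Sx]; exists x'^-1; apply: SV.
pose i := subfield_incl HE.
pose jf (a : subfield_field HE) : L := sval (cid (subfield_inclP a)).
have jfP a : S (i a, jf a) by apply: (svalP (cid (subfield_inclP a))).
have jE a x' : S (i a, x') -> jf a = x' by apply: isometric_graph_fun (jfP a).
have jfB : zmod_morphism jf.
  by move=> a b; apply: jE; rewrite rmorphB; apply: SB.
have jfM : monoid_morphism jf.
  split; first by apply: jE; rewrite rmorph1 -(rmorph1 iota).
  by move=> a b; apply: jE; rewrite rmorphM; apply: SM.
pose jA := GRing.isZmodMorphism.Build _ _ jf jfB.
pose jM := GRing.isMonoidMorphism.Build _ _ jf jfM.
pose j : {rmorphism subfield_field HE -> L} := HB.pack jf jA jM.
have jjE a : j a = jf a by [].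
have iK k : exists2 c, i c = iota k & j c = iota k.
  have [c ic] : exists c, i c = iota k by apply: subfield_lift; exists (iota k).
  by exists c => //; rewrite jjE; apply: jE; rewrite ic.
have algi : algebraicOver i y.
  have [q qN rq] := alg y.
  have [l|q' q'E] := @poly_lift _ _ HE (map_poly iota q).
    by rewrite coef_map; exists (iota q`_l); apply: SK.
  exists q'; last by rewrite q'E.
  by rewrite -(map_poly_eq0 i) q'E map_poly_eq0.
have [p py] := min_poly_exists algi.
have iso c : v (i c) = v (j c) by apply: Sv; apply: jfP.
have [y' _ y'P] := isometric_step iso py.
eexists; split; first exact: horner_isometric_graph iK py y'P.
  move=> [x x'] Sx; have [a ax] : exists a, i a = x by apply: subfield_lift; exists x'.
  exists a%:P; rewrite !map_polyC !hornerC; congr (_, _); first exact: esym ax.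
  by apply/esym/jE; rewrite ax.
by exists y', 'X; rewrite !map_polyX !hornerX.
Qed.

(** An injective map over K permutes the finitely many roots of each polynomial over K, and every
    element of L is such a root. *)
Lemma rmorphism_bijective (s : {rmorphism L -> L}) :
  (forall k, s (iota k) = iota k) -> bijective s.
Proof.
move=> sK; have sinj : injective s by apply: fmorph_inj.
have surj y : exists x, s x = y.
  have [q qN rq] := alg y.
  have [r rE] := closed_field_poly_normal (map_poly iota q).
  have rP b : (b \in r) = root (map_poly iota q) b.
    by rewrite rE rootZ ?root_prod_XsubC // lead_coef_eq0 map_poly_eq0.
  have sq : map_poly s (map_poly iota q) = map_poly iota q.
    by rewrite -map_poly_comp; apply: eq_map_poly => k /=.
  have [|||_ h] := @uniq_min_size _ (map s (undup r)) (undup r).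
  - by rewrite map_inj_uniq ?undup_uniq.
  - move=> _ /mapP [b br ->]; move: br; rewrite !mem_undup !rP => rb.
    by rewrite -sq fmorph_root.
  - by rewrite size_map.
  - have : y \in undup r by rewrite mem_undup rP.
    by rewrite -h => /mapP [x _ ->]; exists x.
exists (fun y => sval (cid (surj y))) => y.
  by apply: sinj; apply: (svalP (cid (surj (s y)))).
exact: (svalP (cid (surj y))).
Qed.

Theorem isometric_automorphism S : isometric_graph S ->
  exists s : {rmorphism L -> L}, [/\ bijective s, forall k, s (iota k) = iota k,
    forall x, v (s x) = v x & forall x y, S (x, y) -> s x = y].
Proof.
move=> HS.
(* Zorn's lemma is applied to the increments A with S [|] A a graph, so that the empty chain, with
   empty union, is covered by S itself. *)
have [|A [PA Amax]] := @Zorn_bigcup _ [set A | isometric_graph (S `|` A)].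
  move=> C CP tot.
  have [[A0 CA0]|C0] := pselect (exists A, C A); last first.
    rewrite (_ : \bigcup_(X in C) X = set0) /= ?setU0 //.
    by apply/seteqP; split=> // z [A CA _]; apply: C0; exists A.
  have both z1 z2 : (S `|` \bigcup_(X in C) X) z1 -> (S `|` \bigcup_(X in C) X) z2 ->
      exists2 A, C A & (S `|` A) z1 /\ (S `|` A) z2.
    move=> [s1|[A1 C1 a1]] [s2|[A2 C2 a2]].
    - by exists A0 => //; split; left.
    - by exists A2 => //; split; [left|right].
    - by exists A1 => //; split; [right|left].
    - have [h|h] := tot _ _ C1 C2.
        by exists A2 => //; split; right => //; apply: h.
      by exists A1 => //; split; right => //; apply: h.
  have up A z : C A -> (S `|` A) z -> (S `|` \bigcup_(X in C) X) z.
    by move=> CA [?|?]; [left|right => //; exists A].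
  split.
  - by have [SK _ _ _ _] := HS => k; left.
  - move=> x x' y y' h1 h2; have [A CA [a1 a2]] := both _ _ h1 h2.
    by apply: (up A) => //; have [_ SB _ _ _] := CP _ CA; apply: SB.
  - move=> x x' y y' h1 h2; have [A CA [a1 a2]] := both _ _ h1 h2.
    by apply: (up A) => //; have [_ _ SM _ _] := CP _ CA; apply: SM.
  - move=> x x' h1; have [A CA [a1 _]] := both _ _ h1 h1.
    by apply: (up A) => //; have [_ _ _ SV _] := CP _ CA; apply: SV.
  - move=> x x' h1; have [A CA [a1 _]] := both _ _ h1 h1.
    by have [_ _ _ _ Sv] := CP _ CA; apply: Sv.
rewrite /= in PA; set T := S `|` A in PA *.
have tot x : exists x', T (x, x').
  have [T' [HT' TT' [x' xx']]] := isometric_graph_extend x PA.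
  exists x'; apply: contrapT => nT.
  apply: (Amax T').
    split; first by apply: subset_trans TT' => z; right.
    by move=> T'A; apply: nT; right; apply: T'A.
  rewrite /= (_ : S `|` T' = T') //; apply/setUidPr; apply: subset_trans TT' => z.
  by left.
pose sf x := sval (cid (tot x)).
have sP x : T (x, sf x) by apply: (svalP (cid (tot x))).
have sE x x' : T (x, x') -> sf x = x' by apply: isometric_graph_fun (sP x).
have [TK TB TM _ Tv] := PA.
have sB : zmod_morphism sf by move=> x y; apply: sE; apply: TB.
have sM : monoid_morphism sf.
  split; first by apply: sE; rewrite -(rmorph1 iota).
  by move=> x y; apply: sE; apply: TM.
pose aA := GRing.isZmodMorphism.Build _ _ sf sB.
pose aM := GRing.isMonoidMorphism.Build _ _ sf sM.
pose s : {rmorphism L -> L} := HB.pack sf aA aM.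
have sK k : s (iota k) = iota k by apply: sE; apply: TK.
exists s; split=> //; first exact: rmorphism_bijective.
  by move=> x; apply/esym/Tv/sP.
by move=> x y Sxy; apply: sE; left.
Qed.

End IsometricExtension.

(** * Conjugates and automorphisms over the base field *)

Section Automorphisms.
Variables (K : fieldType) (L : closedFieldType) (iota : {rmorphism K -> L}).
Hypothesis alg : forall x, algebraicOver iota x.

(** Every field embedding is isometric for this valuation, so the extension theorem for isometries
    also extends arbitrary embeddings over K. *)
Definition trivial_val (G : oagType) (x : L) : option G :=
  if x == 0 then None else Some 0.

Lemma trivial_valP (G : oagType) : valuation_on setT (@trivial_val G).
Proof.
rewrite /trivial_val; split=> [x _|x y _ _|x y _ _].
- by case: eqP => h; split.
- rewrite mulf_eq0; case: eqP => //= _; case: eqP => //= _; by rewrite addr0.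
- have [->|x0] := eqVneq x 0; first by rewrite add0r; case: (y == 0) => //=.
  have [->|y0] := eqVneq y 0; first by rewrite addr0 (negPf x0) /vmin /=.
  by case: (x + y == 0) => //=; rewrite /vmin /= lexx /=.
Qed.

Definition trivial_valuation (G : oagType) : valuation L G :=
  Valuation (trivial_valP G).

Lemma min_poly_root_conj x x' p q : is_min_poly iota x p ->
    root (map_poly iota p) x' ->
  ((map_poly iota q).[x] == 0) = ((map_poly iota q).[x'] == 0).
Proof.
move=> px px'; rewrite -!rootE (min_poly_dvd px) (@min_poly_dvd _ _ iota x' p) //.
by case: px.
Qed.

Lemma conjugate_automorphism (G : oagType) x x' p :
    is_min_poly iota x p -> root (map_poly iota p) x' ->
  exists s : {rmorphism L -> L},
    [/\ bijective s, forall k, s (iota k) = iota k & s x = x'].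
Proof.
move=> px px'.
have [|s [sb sK _ sE]] := @isometric_automorphism _ _ _ alg _ (trivial_valuation G)
    [set z | exists g, z = ((map_poly iota g).[x], (map_poly iota g).[x'])].
  apply: (horner_isometric_graph _ px) => [k|g]; first by exists k.
  by rewrite /= /trivial_val (min_poly_root_conj g px px').
exists s; split=> //; apply: sE.
by exists 'X; rewrite !map_polyX !hornerX.
Qed.

(* All values on L are torsion over those of K. *)
Lemma isometric_of_valuation_ring (G : oagType) (v : valuation L G)
    (s : {rmorphism L -> L}) (E : set L) :
    is_subfield E -> (forall k, E (iota k)) -> (forall k, s (iota k) = iota k) ->
    (forall x, E x -> vle (Some 0) (v (s x)) = vle (Some 0) (v x)) ->
  forall x, E x -> v (s x) = v x.
Proof.
move=> HE EK sK sv x Ex; have [->|x0] := eqVneq x 0; first by rewrite rmorph0.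
have [k [c [k0 c0 xk]]] := value_torsion v (alg x) x0.
have ic0 : iota c != 0 by rewrite fmorph_eq0.
have xk0 : x ^+ k != 0 by rewrite expf_neq0.
(* x^k / c and its inverse both have value 0. Their images under s stay in the valuation ring, which
   gives the two inequalities between values. *)
have E1 : E (x ^+ k / iota c).
  by apply: (subfieldM HE); [apply: subfieldX|apply: (subfieldV HE)].
have E2 : E (iota c / x ^+ k).
  by apply: (subfieldM HE) => //; apply: (subfieldV HE); apply: subfieldX.
apply: (vX_eq k0); rewrite -rmorphXn xk; apply: vle_anti.
  have := sv _ E2; rewrite -(v1 v) fmorph_div sK !vle_divE ?fmorph_eq0 // !mul1r.
  by rewrite xk vle_refl.
have := sv _ E1; rewrite -(v1 v) fmorph_div sK !vle_divE ?fmorph_eq0 // !mul1r.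
by rewrite xk vle_refl.
Qed.

End Automorphisms.

(** * Separable elements *)

Section Separability.
Variables (F : fieldType) (L : closedFieldType) (i : {rmorphism F -> L}).
Hypothesis alg : forall x, algebraicOver i x.

Lemma separable_overP x : separable_over (range i) x <->
  exists2 p : {poly F}, separable_poly p & root (map_poly i p) x.
Proof.
split=> [[p [pF sp rp]]|[p sp rp]]; last first.
  exists (map_poly i p); split=> //; last by rewrite separable_map.
  by move=> k; rewrite coef_map; exists p`_k.
have cP k : {c | i c = p`_k} by apply/cid; have [c _ <-] := pF k; exists c.
have pE : p = map_poly i (\poly_(k < size p) sval (cP k)).
  apply/polyP => k; rewrite coef_map coef_poly; case: ltnP => h.
    by rewrite /= (svalP (cP k)).
  by rewrite raddf0 nth_default.
move: sp rp; rewrite pE separable_map => sp rp.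
by exists (\poly_(k < size p) sval (cP k)).
Qed.

(** Automorphisms reach every root of the minimal polynomial of x, so x is its only root; being
    separable, this polynomial is linear. *)
Lemma separable_fixed_base (G : oagType) x : separable_over (range i) x ->
  (forall s : {rmorphism L -> L}, bijective s -> (forall c, s (i c) = i c) -> s x = x) ->
  range i x.
Proof.
move=> /separable_overP [q sq rq] fx.
have [p px] := min_poly_exists (alg x).
have sp : separable_poly (map_poly i p).
  by rewrite separable_map; apply: dvdp_separable sq; rewrite -(min_poly_dvd px).
have [r rE] := closed_field_poly_normal (map_poly i p).
have pm : map_poly i p \is monic by rewrite map_monic (min_poly_monic px).
rewrite (monicP pm) scale1r in rE.
have rx z : z \in r -> z = x.
  rewrite -root_prod_XsubC -rE => rz.
  have [s [sb sF <-]] := conjugate_automorphism alg G px rz.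
  exact: fx.
have ur : uniq r by rewrite -separable_prod_XsubC -rE.
have sr : (size (map_poly i p) = (size r).+1)%N by rewrite rE size_prod_XsubC.
rewrite size_map_poly in sr.
case: r rE rx ur sr => [|z1 [|z2 r]] rE rx ur sr.
- by have := min_poly_size px; rewrite sr.
- have := rx z1 (mem_head _ _) => z1x; rewrite big_seq1 z1x in rE.
  have := congr1 (fun q : {poly L} => q`_0) rE.
  rewrite coef_map coefB coefX coefC sub0r => /(congr1 -%R); rewrite opprK => <-.
  by exists (- p`_0); rewrite ?rmorphN.
- move: ur; rewrite (rx z1) ?mem_head // (rx z2) ?inE ?eqxx ?orbT //=.
  by rewrite mem_head.
Qed.

(** Separability is available inside finite extensions; closure under the field operations concerns
    two elements at a time, and these lie in one such extension. *)
Lemma fieldExt_two_generators x y :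
  exists (M : fieldExtType F) (j : {rmorphism M -> L}) a b,
    [/\ forall c, j c%:A = i c, j a = x & j b = y].
Proof.
have [p px] := min_poly_exists (alg x).
have [_ irrp rp] := px.
pose M1 : fieldExtType F := SubFieldExtType rp irrp.
pose j1 : {rmorphism M1 -> L} := @subfx_inj _ _ i x p.
have j1A c : j1 c%:A = i c by apply: (subfx_inj_base rp (irredp_neq0 irrp)).
have alg1 : algebraicOver j1 y.
  have [q qN rq] := alg y; exists (map_poly (in_alg M1) q).
    by rewrite map_poly_eq0.
  by rewrite -map_poly_comp (eq_map_poly j1A).
have [q qy] := min_poly_exists alg1.
have [_ irrq rq] := qy.
pose M2 : fieldExtType M1 := SubFieldExtType rq irrq.
pose j2 : {rmorphism M2 -> L} := @subfx_inj _ _ j1 y q.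
have j2A c : j2 c%:A = j1 c by apply: (subfx_inj_base rq (irredp_neq0 irrq)).
exists (baseFieldType M2), j2, ((subfx_root i x p : M1)%:A : M2),
  (subfx_root j1 y q : M2); split.
- move=> c; rewrite -[c%:A]/((in_alg M1 c *: (1 : M2)) : M2) /=.
  by rewrite [LHS]j2A; exact: j1A.
- by rewrite j2A; apply: (subfx_inj_root rp (irredp_neq0 irrp)).
- exact: (subfx_inj_root rq (irredp_neq0 irrq)).
Qed.

Lemma separable_over_fieldExt (M : fieldExtType F) (j : {rmorphism M -> L}) a :
    (forall c, j c%:A = i c) ->
  separable_over (range i) (j a) <-> separable_element 1%VS a.
Proof.
move=> jA; have jAp (p : {poly F}) : map_poly j (map_poly (in_alg M) p) = map_poly i p.
  by rewrite -map_poly_comp; apply: eq_map_poly.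
rewrite separable_overP; split=> [[p sp rp]|/separable_elementP [p [/polyOver1P [q pq] rp sp]]].
  apply/separable_elementP; exists (map_poly (in_alg M) p); split.
  - by apply/polyOver1P; exists p.
  - by rewrite -(fmorph_root j) jAp.
  - by rewrite separable_map.
exists q; first by move: sp; rewrite pq separable_map.
by rewrite -jAp fmorph_root -pq.
Qed.

Lemma separable_over_subfield : is_subfield (separable_over (range i)).
Proof.
apply/is_subfieldP.
have cl x y : separable_over (range i) x -> separable_over (range i) y ->
    [/\ separable_over (range i) (x - y), separable_over (range i) (x * y)
      & separable_over (range i) x^-1].
  have [M [j [a [b [jA <- <-]]]]] := fieldExt_two_generators x y.
  move=> /(separable_over_fieldExt _ jA) sa /(separable_over_fieldExt _ jA) sb.
  have /separableP sep : separable 1%VS <<1 & [:: a; b]>>%VS.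
    by apply: separable_Fadjoin_seq; rewrite /= sa sb.
  have am : a \in <<1 & [:: a; b]>>%VS by apply: seqv_sub_adjoin; rewrite mem_head.
  have bm : b \in <<1 & [:: a; b]>>%VS by apply: seqv_sub_adjoin; rewrite !inE eqxx orbT.
  rewrite -rmorphB -rmorphM -fmorphV; split; apply/(separable_over_fieldExt _ jA).
  - by apply: sep; rewrite rpredB.
  - by apply: sep; rewrite rpredM.
  - by apply: sep; rewrite rpredV.
split=> [|x y sx sy|x y sx sy|x sx].
- apply/separable_overP; exists ('X - 1%:P).
    by have := separable_prod_XsubC [:: 1 : F]; rewrite big_seq1.
  by rewrite rmorphB /= map_polyX map_polyC /= rmorph1 root_XsubC.
- by have [] := cl x y sx sy.
- by have [] := cl x y sx sy.
- by have [] := cl x x sx sx.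
Qed.

Lemma separable_over_power x :
  exists2 n, [pchar L].-nat n & separable_over (range i) (x ^+ n).
Proof.
have [M [j [a [b [jA <- _]]]]] := fieldExt_two_generators x x.
have [n /andP [nM sn]] := separable_exponent_pchar 1%VS a.
exists n; last by rewrite -rmorphXn; apply/(separable_over_fieldExt _ jA).
by move: nM; rewrite -(eq_pnat _ (fmorph_pchar j)).
Qed.

(** Here n is a power of the characteristic, or 1 in characteristic 0. If s fixes x^n, then (s x -
    x)^n = 0, so s fixes x and [separable_fixed_base] applies. *)
Lemma separable_over_purely_inseparable (G : oagType) x n :
    [pchar L].-nat n -> separable_over (range i) x -> range i (x ^+ n) ->
  range i x.
Proof.
move=> nL sx [c _ ic]; apply: (separable_fixed_base G sx) => s _ sF.
have sn : s x ^+ n = x ^+ n by rewrite -rmorphXn -ic sF.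
have := exprDn_pchar (s x - x) x nL; rewrite subrK sn -{1}[x ^+ n]add0r => /addIr /esym /eqP.
rewrite expf_eq0 => /andP [_].
by rewrite subr_eq0 => /eqP.
Qed.

End Separability.

Lemma separable_overS (L : fieldType) (E F : set L) x :
  E `<=` F -> separable_over E x -> separable_over F x.
Proof. by move=> EF [p [pE sp rp]]; exists p; split=> // k; apply: EF. Qed.

Lemma separable_over_mem (L : fieldType) (E : set L) x :
  is_subfield E -> E x -> separable_over E x.
Proof.
move=> HE Ex; exists ('X - x%:P); split; last by rewrite root_XsubC.
  move=> k; rewrite coefB coefX coefC; apply: (subfieldB HE).
    by case: (k == 1)%N; [apply: subfield1|apply: subfield0].
  by case: (k == 0)%N => //; apply: subfield0.
by have := separable_prod_XsubC [:: x]; rewrite big_seq1.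
Qed.

(** * Degrees of Henselizations of unibranched extensions *)

Section HenselizationDegree.
Variables (K : fieldType) (L : closedFieldType) (iota : {rmorphism K -> L}).
Hypothesis alg : forall x, algebraicOver iota x.
Variables (G : oagType) (v : valuation K G) (vbar : valuation L G).
Hypothesis vbar_ext : forall x, vbar (iota x) = v x.

Lemma algebraicOver_incl E (HE : is_subfield E) x :
  range iota `<=` E -> algebraicOver (subfield_incl HE) x.
Proof.
move=> KE; have [q qN rq] := alg x.
have [l|q' q'E] := @poly_lift _ _ HE (map_poly iota q).
  by apply: KE; rewrite coef_map; exists q`_l.
exists q'; last by rewrite q'E.
by rewrite -(map_poly_eq0 (subfield_incl HE)) q'E map_poly_eq0.
Qed.

Lemma rmorphism_inverse (s : {rmorphism L -> L}) : bijective s ->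
  exists t : {rmorphism L -> L}, [/\ bijective t, cancel s t & cancel t s].
Proof.
move=> [t st ts].
have tB : zmod_morphism t by move=> x y; apply: (can_inj st); rewrite rmorphB !ts.
have tM : monoid_morphism t.
  by split=> [|x y]; apply: (can_inj st); rewrite ?rmorph1 ?rmorphM !ts.
pose aA := GRing.isZmodMorphism.Build _ _ t tB.
pose aM := GRing.isMonoidMorphism.Build _ _ t tM.
pose t' : {rmorphism L -> L} := HB.pack t aA aM.
by exists t'; split=> //; exists s.
Qed.

Definition decomposition (E : set L) (s : {rmorphism L -> L}) : Prop :=
  [/\ bijective s, forall y, E y -> s y = y & forall y, vbar (s y) = vbar y].

Lemma decomposition_comp E s t : decomposition E s -> decomposition E t ->
  decomposition E (s \o t).
Proof.
move=> [bs Es vs] [bt Et vt]; split; first exact: bij_comp.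
  by move=> y Ey /=; rewrite Et ?Es.
by move=> y /=; rewrite vs vt.
Qed.

Lemma decomposition_inv E s : decomposition E s ->
  exists t, [/\ decomposition E t, cancel s t & cancel t s].
Proof.
move=> [bs Es vs]; have [t [bt st ts]] := rmorphism_inverse bs.
exists t; split=> //; split=> // y; first by move=> Ey; rewrite -{1}(Es _ Ey) st.
by rewrite -[in RHS](ts y) vs.
Qed.

Lemma decompositionS E F s : F `<=` E -> decomposition E s -> decomposition F s.
Proof. by move=> FE [bs Es vs]; split=> // y /FE; apply: Es. Qed.

Lemma fixed_subfield (s : {rmorphism L -> L}) : is_subfield [set y | s y = y].
Proof.
apply/is_subfieldP; split=> [|x y /= sx sy|x y /= sx sy|x /= sx].
- by rewrite /= rmorph1.
- by rewrite rmorphB sx sy.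
- by rewrite rmorphM sx sy.
- by rewrite fmorphV sx.
Qed.

Lemma decomposition_adjoin (s : {rmorphism L -> L}) F x :
  decomposition F s -> s x = x -> decomposition (adjoin F x) s.
Proof.
move=> [bs Fs vs] sx; split=> //.
exact: (adjoin_min (fixed_subfield s)).
Qed.

Lemma henselizationP E y : henselization vbar E y <->
  separable_over E y /\ forall s, decomposition E s -> s y = y.
Proof.
split=> -[sy fy]; split=> //; first by move=> s [*]; apply: fy.
by move=> s *; apply: fy.
Qed.

Lemma henselization_subfield E : is_subfield E -> range iota `<=` E ->
  is_subfield (henselization vbar E).
Proof.
move=> HE KE.
have sepE : is_subfield (separable_over E).
  rewrite -(range_incl HE); apply: separable_over_subfield => x.
  exact: algebraicOver_incl.
apply/is_subfieldP; split=> [|x y|x y|x]; rewrite !henselizationP.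
- by split=> [|s _]; [apply: (subfield1 sepE)|rewrite rmorph1].
- move=> [sx fx] [sy fy]; split=> [|s Ds]; first exact: (subfieldB sepE).
  by rewrite rmorphB fx ?fy.
- move=> [sx fx] [sy fy]; split=> [|s Ds]; first exact: (subfieldM sepE).
  by rewrite rmorphM fx ?fy.
- move=> [sx fx]; split=> [|s Ds]; first exact: (subfieldV sepE).
  by rewrite fmorphV fx.
Qed.

Lemma separable_over_aut (s : {rmorphism L -> L}) y :
  (forall k, s (iota k) = iota k) -> separable_over (range iota) y ->
  separable_over (range iota) (s y).
Proof.
move=> sK /separable_overP [p sp rp]; apply/separable_overP; exists p => //.
rewrite (_ : map_poly iota p = map_poly s (map_poly iota p)) ?fmorph_root //.
by rewrite -map_poly_comp; apply: eq_map_poly => k /=.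
Qed.

(** Newton's scheme: a multiple of the polynomial vanishing at the earlier nodes corrects the value
    at the new one. *)
Lemma interpolation (F : fieldType) (r : seq F) (f : F -> F) : uniq r ->
  exists2 q : {poly F}, (size q <= size r)%N & forall z, z \in r -> q.[z] = f z.
Proof.
elim: r => [|z r IH] /=; first by exists 0; rewrite ?size_poly0.
move=> /andP [zr /IH [q sq qf]].
pose P := \prod_(w <- r) ('X - w%:P).
have Pz : P.[z] != 0 by rewrite -rootE root_prod_XsubC.
exists (q + ((f z - q.[z]) / P.[z]) *: P).
  rewrite (leq_trans (size_polyD _ _)) // geq_max (leq_trans sq) //=.
  by rewrite (leq_trans (size_scale_leq _ _)) // size_prod_XsubC.
move=> w; rewrite hornerD hornerZ inE => /orP [/eqP ->|wr].
  by rewrite divfK // addrC subrK.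
have /rootP -> : root P w by rewrite root_prod_XsubC.
by rewrite mulr0 addr0 qf.
Qed.

Lemma expr_pchar_sum (F : fieldType) n (I : Type) (r : seq I) (f : I -> F) :
  [pchar F].-nat n -> (\sum_(k <- r) f k) ^+ n = \sum_(k <- r) f k ^+ n.
Proof.
move=> nF; elim: r => [|k r IH]; last by rewrite !big_cons exprDn_pchar // IH.
by rewrite !big_nil expr0n; case: n nF.
Qed.

Variables (x : L) (p : {poly K}).
Hypothesis px : is_min_poly iota x p.
Local Notation E := (simple_ext iota x).
Hypothesis unib : unibranched iota v vbar E.
Local Notation D := (decomposition (range iota)).

Let HE : is_subfield E. Proof. exact: adjoin_subfield. Qed.
Let KE : range iota `<=` E. Proof. exact: adjoin_sub. Qed.

(** An automorphism s with s x = x' makes [vbar \o s] a second extension of v to K(x). The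
    unibranched hypothesis identifies the valuation rings, and torsion over the values of K then
    identifies the values. So s is isometric on K(x), and this restriction extends to an isometric
    automorphism. *)
Lemma decomposition_transitive x' : root (map_poly iota p) x' ->
  exists2 d, D d & d x = x'.
Proof.
move=> rx'; have [s [bs sK sx]] := conjugate_automorphism alg G px rx'.
have wE : valuation_on E (vbar \o s).
  split=> [y _|y z _ _|y z _ _] /=.
  - split=> [/v_eq0/eqP|->]; first by rewrite fmorph_eq0 => /eqP.
    by rewrite rmorph0 v0.
  - by rewrite rmorphM vM.
  - by rewrite rmorphD; apply: vD.
have ring_eq := unib wE (fun k => congr1 (vle (Some 0)) (etrans (congr1 vbar (sK k)) (vbar_ext k))).
have iso := isometric_of_valuation_ring alg HE (fun k => KE (imageT iota k)) sK ring_eq.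
have [|d [bd dK vd dS]] := isometric_automorphism alg (v := vbar)
    (S := [set z | E z.1 /\ z.2 = s z.1]).
  split=> [k|y y' z z' [/= Ey ->] [/= Ez ->]|y y' z z' [/= Ey ->] [/= Ez ->]
          |y y' [/= Ey ->]|y y' [/= Ey ->]] /=.
  - by rewrite sK; split=> //; apply: KE.
  - by rewrite rmorphB; split=> //; apply: (subfieldB HE).
  - by rewrite rmorphM; split=> //; apply: (subfieldM HE).
  - by rewrite fmorphV; split=> //; apply: (subfieldV HE).
  - by rewrite iso.
exists d; last by apply: dS; split=> //; apply: adjoin_mem.
by split=> // _ [k _ <-].
Qed.

(* A minimal nonzero polynomial with separable coefficients all of whose
   K-conjugates vanish at x would be K-rational. *)
Lemma no_small_conjugate_relation (q : {poly L}) :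
    (forall k, separable_over (range iota) q`_k) ->
    (forall s : {rmorphism L -> L}, (forall k, s (iota k) = iota k) ->
       (map_poly s q).[x] = 0) ->
  (size q < size p)%N -> q = 0.
Proof.
have sepK := separable_over_subfield alg.
move: {2}(size q) (leqnn (size q)) => n; elim: n q => [|n IH] q size_q sq qx qp.
  by apply/eqP; rewrite -size_poly_eq0 -leqn0.
apply/eqP; apply: contraT => qN.
pose q1 := (lead_coef q)^-1 *: q.
have lN : (lead_coef q)^-1 != 0 by rewrite invr_eq0 lead_coef_eq0.
have q1s k : separable_over (range iota) q1`_k.
  by rewrite coefZ; apply: (subfieldM sepK); [apply: (subfieldV sepK); apply: sq|apply: sq].
have q1x (s : {rmorphism L -> L}) : (forall k, s (iota k) = iota k) ->
    (map_poly s q1).[x] = 0.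
  by move=> sK; rewrite map_polyZ hornerZ qx // mulr0.
have sq1 : size q1 = size q by rewrite size_scale.
have lq1 : lead_coef q1 = 1 by rewrite lead_coefZ mulVf ?lead_coef_eq0.
have fixed (s : {rmorphism L -> L}) : (forall k, s (iota k) = iota k) ->
    map_poly s q1 = q1.
  move=> sK; apply/eqP; rewrite -subr_eq0; apply/eqP.
  (* Both polynomials are monic of the same size, so their difference is shorter; it inherits the
     hypotheses and vanishes by induction. *)
  have small : (size (map_poly s q1 - q1)%R < size q)%N.
    rewrite -sq1 [size q1]polySpred -?size_poly_eq0 ?sq1 ?size_poly_eq0 // ltnS.
    apply/leq_sizeP => j; rewrite leq_eqVlt => /orP [/eqP <-|hj].
      rewrite coefB coef_map /= -sq1 -lead_coefE lq1 rmorph1 subrr //.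
    rewrite nth_default // (leq_trans (size_polyD _ _)) // size_polyN size_map_poly maxnn.
    by rewrite sq1 -[size q]prednK ?size_poly_gt0.
  apply: IH => [|k|t tK|].
  - by rewrite -ltnS (leq_trans small).
  - rewrite coefB coef_map; apply: (subfieldB sepK) => //.
    exact: separable_over_aut.
  - rewrite rmorphB hornerD hornerN (q1x t) // subr0 /= -map_poly_comp.
    by apply: (q1x (t \o s)) => k /=; rewrite sK.
  - exact: ltn_trans small qp.
have q1K k : range iota q1`_k.
  apply: (separable_fixed_base alg G) => // s _ sK.
  by rewrite -{2}(fixed s sK) coef_map.
have [r rE] : exists r, map_poly iota r = q1.
  have cP k : {c | iota c = q1`_k} by apply/cid; have [c _ <-] := q1K k; exists c.
  exists (\poly_(k < size q1) sval (cP k)); apply/polyP => k.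
  rewrite coef_map coef_poly; case: ltnP => h; first by rewrite /= (svalP (cP k)).
  by rewrite raddf0 nth_default.
have r0 : r = 0.
  apply: (min_poly_small_root px); first by rewrite -(size_map_poly iota) rE sq1.
  by rewrite rE -(q1x idfun) ?map_poly_id.
by move: lq1; rewrite -rE r0 rmorph0 lead_coef0 => /eqP; rewrite eq_sym oner_eq0.
Qed.

Let Hh : is_subfield (henselization vbar (range iota)).
Proof. by apply: henselization_subfield => //; apply: is_subfield_range. Qed.

Lemma range_sub_henselization : range iota `<=` henselization vbar (range iota).
Proof.
move=> y Ky; apply/henselizationP; split=> [|s [_ sK _]]; last exact: sK.
by apply: separable_over_mem => //; apply: is_subfield_range.
Qed.

(** With t inverse to s, one has t x = d x for some d in the decomposition group, and d fixes the
    coefficients of q. So the conjugate of q by s takes the value s (d (q(x))) = 0 at x. *)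
Lemma henselization_independent (q : {poly L}) :
    (forall k, henselization vbar (range iota) q`_k) -> q.[x] = 0 ->
  (size q < size p)%N -> q = 0.
Proof.
move=> qh qx; apply: no_small_conjugate_relation => [k|s sK].
  by have /henselizationP [] := qh k.
have [t [bt st ts]] := rmorphism_inverse (rmorphism_bijective alg sK).
have tK k : t (iota k) = iota k by rewrite -{1}sK st.
have rt : root (map_poly iota p) (t x).
  have -> : map_poly iota p = map_poly t (map_poly iota p).
    by rewrite -map_poly_comp; apply: eq_map_poly => k /=.
  by rewrite fmorph_root; case: px.
have [d Dd dx] := decomposition_transitive rt.
have dq : map_poly d q = q.
  apply/polyP => k; rewrite coef_map /=.
  by have /henselizationP [_] := qh k; apply.
by rewrite -{1}(ts x) horner_map -dx -{1}dq horner_map qx !rmorph0.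
Qed.

Lemma min_poly_henselization :
  exists2 ph, is_min_poly (subfield_incl Hh) x ph & size ph = size p.
Proof.
have algh := algebraicOver_incl Hh x range_sub_henselization.
have [ph hph] := min_poly_exists algh; exists ph => //.
apply/eqP; rewrite eqn_leq; apply/andP; split; last first.
  rewrite leqNgt -(size_map_poly (subfield_incl Hh)); apply/negP => lt.
  have := min_poly_neq0 hph; rewrite -(map_poly_eq0 (subfield_incl Hh)) => /eqP.
  apply; apply: henselization_independent => // [k|].
    by rewrite coef_map; apply: subfield_inclP.
  exact: min_poly_root hph.
have [l|q' q'E] := @poly_lift _ _ Hh (map_poly iota p).
  by apply: range_sub_henselization; rewrite coef_map; exists p`_l.
rewrite -(size_map_poly iota p) -q'E size_map_poly; apply: (min_poly_size_le hph).
  by rewrite -(map_poly_eq0 (subfield_incl Hh)) q'E map_poly_eq0 (min_poly_neq0 px).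
by rewrite q'E; case: px.
Qed.

(** The polynomial interpolates d x |-> d y on the conjugates of x, with d in the decomposition
    group of K. Two choices of d for the same node differ by an element that fixes x, hence y. So
    the polynomial and its image under s agree at all nodes, and their sizes are at most the number
    of nodes. *)
Lemma decomposition_interpolation y : (forall s, decomposition E s -> s y = y) ->
  exists2 q : {poly L}, (forall k s, D s -> s q`_k = q`_k) & q.[x] = y.
Proof.
move=> fy; have [r0 rE] := closed_field_poly_normal (map_poly iota p).
pose r := undup r0.
have rP z : (z \in r) = root (map_poly iota p) z.
  rewrite mem_undup rE rootZ ?root_prod_XsubC // lead_coef_eq0 map_poly_eq0.
  exact: min_poly_neq0 px.
have dP z : {d | z \in r -> D d /\ d x = z}.
  apply/cid; case: (boolP (z \in r)); last by exists idfun.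
  by rewrite rP => /decomposition_transitive [d Dd dx]; exists d.
have [q sq qf] := interpolation (fun z => sval (dP z) y) (undup_uniq r0).
exists q; last first.
  have xr : x \in r by rewrite rP; case: px.
  rewrite qf //; have [Dd dx] := svalP (dP x) xr.
  by apply: fy; apply: decomposition_adjoin.
move=> k s Ds; suff e : map_poly s q = q by rewrite -{2}e coef_map.
apply/eqP; rewrite -subr_eq0; apply/eqP/(@roots_geq_poly_eq0 _ _ r); last first.
- by rewrite (leq_trans (size_polyD _ _)) // size_polyN size_map_poly maxnn.
- exact: undup_uniq.
apply/allP => z zr; have [t [Dt st ts]] := decomposition_inv Ds.
have tzr : t z \in r.
  have tK : map_poly t (map_poly iota p) = map_poly iota p.
    have [_ tK _] := Dt.
    by rewrite -map_poly_comp; apply: eq_map_poly => c /=; apply: tK; exists c.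
  by rewrite rP -tK fmorph_root -rP.
rewrite rootE hornerD hornerN subr_eq0 -{1}(ts z) horner_map /= !qf //.
have [Dz dz] := svalP (dP z) zr; have [Dw dw] := svalP (dP (t z)) tzr.
have [u [Du zu uz]] := decomposition_inv Dz.
have De := decomposition_comp Du (decomposition_comp Ds Dw).
have := fy _ (decomposition_adjoin (x := x) De _) => /= h.
by rewrite -[X in _ == sval (dP z) X]h ?uz // dw ts -{1}dz zu.
Qed.

(** The point is the equality of K(x)^h and K^h(x). An element y of the former is q(x) with
    coefficients fixed by the decomposition group of K. Their N-th powers are separable over K,
    hence in K^h, so y^N lies in K^h(x); y is separable over K(x), which brings y itself into
    K^h(x). *)
Theorem henselization_degree :
  ext_degree (henselization vbar (range iota)) (henselization vbar E) = (size p).-1.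
Proof.
have [ph hph sph] := min_poly_henselization.
have := adjoin_ext_degree hph; rewrite range_incl sph => <-; congr ext_degree.
set W := adjoin _ x; have HW : is_subfield W by apply: adjoin_subfield.
have KW : range iota `<=` W.
  by apply: subset_trans range_sub_henselization _; apply: adjoin_sub.
have EW : E `<=` W by apply: adjoin_min => //; apply: adjoin_mem.
apply/seteqP; split; last first.
  apply: adjoin_min; first exact: henselization_subfield.
    move=> y /henselizationP [sy fy]; apply/henselizationP; split.
      exact: separable_overS sy.
    by move=> s Ds; apply: fy; apply: decompositionS Ds.
  apply/henselizationP; split; last by move=> s [_ sE _]; apply: sE; apply: adjoin_mem.
  by apply: separable_over_mem => //; apply: adjoin_mem.
move=> y /henselizationP [sy fy].
have [q qD qx] := decomposition_interpolation fy.
have nP k : {n | [pchar L].-nat n & separable_over (range iota) (q`_k ^+ n)}.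
  by apply/cid2/separable_over_power.
pose n k := s2val (nP k).
(* A common multiple of the exponents of the coefficients of q, and still a power of the
   characteristic exponent, so that raising to the power N is additive. *)
pose N := (\prod_(k < size q) n k)%N.
have NL : [pchar L].-nat N.
  by rewrite /N; elim/big_ind: _ => // [a b|k _]; [rewrite pnatM => -> ->|apply: (s2valP (nP k))].
suff yN : W (y ^+ N).
  rewrite -(range_incl HW); apply: (separable_over_purely_inseparable _ G NL).
  - by move=> z; apply: algebraicOver_incl.
  - by rewrite range_incl; apply: separable_overS sy.
  - by rewrite range_incl.
rewrite -qx horner_coef expr_pchar_sum //; apply: (subfield_sum HW) => k _.
rewrite exprMn; apply: (subfieldM HW); last first.
  by do 2!apply: (subfieldX HW); apply: adjoin_mem.
apply: adjoin_sub; apply/henselizationP; split; last first.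
  by move=> s Ds; rewrite rmorphXn qD.
rewrite /N (bigD1 k) //= exprM.
by apply: (subfieldX (separable_over_subfield alg)); apply: (s2valP' (nP k)).
Qed.

End HenselizationDegree.

(** * Gauss valuations of balls *)

Section GaussValuation.
Variables (L : closedFieldType) (G : oagType) (v : valuation L G).
Implicit Types p q : {poly L}.

Fact content_subproof p : exists k, forall j, vle (v p`_k) (v p`_j).
Proof.
have [k kP] := exists_min_value v (fun k : 'I_(size p).+1 => p`_k).
exists k => j; case: (ltnP j (size p).+1) => [h|h]; first exact: (kP (Ordinal h)).
by rewrite [p`_j]nth_default ?v0 ?vleN // ltnW.
Qed.

(** A coefficient of least value, and not that value itself: Gauss values can then be multiplied and
    compared as values of elements of L. *)
Definition content p : L := p`_(sval (cid (content_subproof p))).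

Lemma content_le p k : vle (v (content p)) (v p`_k).
Proof. exact: (svalP (cid (content_subproof p))). Qed.

Lemma content_ge c p : (forall k, vle c (v p`_k)) -> vle c (v (content p)).
Proof. exact. Qed.

Lemma content_eq0 p : (content p == 0) = (p == 0).
Proof.
apply/eqP/eqP => [p0|->]; last by rewrite /content coef0.
apply/polyP => k; rewrite coef0; apply/(v_eq0 v).
by apply: vle_anti (vleN _) _; have := content_le p k; rewrite p0 v0.
Qed.

Lemma content0 : content 0 = 0. Proof. by rewrite /content coef0. Qed.

Lemma content_first p : p != 0 ->
  exists2 k, v p`_k = v (content p) & forall j, (j < k)%N -> vlt (v (content p)) (v p`_j).
Proof.
move=> pN; have ex : exists k, v p`_k == v (content p).
  by exists (sval (cid (content_subproof p))).
case: (ex_minnP ex) => k /eqP kE kmin; exists k => // j jk.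
have [e|//] := vle_eqVlt (content_le p j).
by have := kmin j; rewrite e eqxx leqNgt jk => /(_ isT).
Qed.

(** Gauss's lemma. If k and l are the first indices of least value, then exactly one product in the
    coefficient of index k + l has the least value. *)
Lemma contentM p q : v (content (p * q)) = v (content p * content q).
Proof.
have [->|pN] := eqVneq p 0; first by rewrite !(mul0r, content0).
have [->|qN] := eqVneq q 0; first by rewrite !(mulr0, content0).
have cp : content p != 0 by rewrite content_eq0.
have cq : content q != 0 by rewrite content_eq0.
apply: vle_anti; last first.
  apply: content_ge => k; rewrite coefM; apply: val_ge_sum => j _.
  by apply: vle_mul; apply: content_le.
have [k kE klt] := content_first pN; have [l lE llt] := content_first qN.
have lt : (k < (k + l).+1)%N by rewrite ltnS leq_addr.
have vkl : v (p`_k * q`_l) = v (content p * content q) by rewrite !vM kE lE.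
rewrite -vkl; apply: (vle_trans (content_le _ (k + l))); rewrite coefM.
have -> : p`_k * q`_l = p`_(Ordinal lt) * q`_(k + l - Ordinal lt) by rewrite /= addKn.
rewrite (val_sum_unique_min (v := v) (k := Ordinal lt)
    (f := fun j : 'I_(k + l).+1 => p`_j * q`_(k + l - j))) ?vle_refl //=.
  move=> j; rewrite -val_eqE /= addKn vkl => jk.
  case: (ltngtP j k) jk => // h _.
    by apply: vlt_le_mul => //; [apply: klt|apply: content_le].
  rewrite mulrC [X in vlt _ (v X)]mulrC; apply: vlt_le_mul => //; last exact: content_le.
  by apply: llt; rewrite ltn_subLR ?ltn_add2r // -ltnS.
by rewrite addKn; apply/(v_neq0 v); rewrite vkl; apply/(v_neq0 v); rewrite mulf_neq0.
Qed.

Lemma contentC c : v (content c%:P) = v c.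
Proof.
apply: vle_anti; first by have := content_le c%:P 0; rewrite coefC.
apply: content_ge => k; rewrite coefC; case: eqP => _; first exact: vle_refl.
by rewrite v0 vleN.
Qed.

Variables a d : L.
Hypothesis d0 : d != 0.
Local Notation sub p := (p \Po (d *: 'X + a%:P)).

(* [v (ball_content p)] is the Gauss valuation of [p] on the ball of center [a]
   and radius [v d]. *)
Definition ball_content p : L := content (sub p).

Lemma ball_contentM p q :
  v (ball_content (p * q)) = v (ball_content p * ball_content q).
Proof. by rewrite /ball_content rmorphM contentM. Qed.

Lemma ball_contentC c : v (ball_content c%:P) = v c.
Proof. by rewrite /ball_content comp_polyC contentC. Qed.

Lemma ball_content_eq0 p : (ball_content p == 0) = (p == 0).
Proof.
rewrite content_eq0; apply/idP/idP => [|/eqP ->]; last by rewrite comp_poly0.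
rewrite comp_poly_eq0 // size_polyDl ?size_scale ?size_polyX //.
by rewrite size_polyC; case: (a != 0).
Qed.

Lemma ball_content0 : ball_content 0 = 0.
Proof. by rewrite /ball_content comp_poly0 content0. Qed.

Lemma ball_content_geD c p q : vle c (v (ball_content p)) ->
  vle c (v (ball_content q)) -> vle c (v (ball_content (p + q))).
Proof.
move=> hp hq; apply: content_ge => k; rewrite comp_polyD coefD; apply: val_geD.
  exact: vle_trans hp (content_le _ _).
exact: vle_trans hq (content_le _ _).
Qed.

Lemma ball_content_gtD c p q : vlt c (v (ball_content p)) ->
  vlt c (v (ball_content q)) -> vlt c (v (ball_content (p + q))).
Proof.
move=> hp hq; rewrite /ball_content /content comp_polyD coefD; apply: val_gtD.
  exact: vlt_le_trans hp (content_le _ _).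
exact: vlt_le_trans hq (content_le _ _).
Qed.

Lemma ball_contentN p : v (ball_content (- p)) = v (ball_content p).
Proof. by rewrite -mulN1r -polyCN ball_contentM vM ball_contentC vN -vM mul1r. Qed.

Lemma ball_content_gt_sum c (I : Type) (r : seq I) (P : pred I) (F : I -> {poly L}) :
  c <> None -> (forall k, P k -> vlt c (v (ball_content (F k)))) ->
  vlt c (v (ball_content (\sum_(k <- r | P k) F k))).
Proof.
move=> c0 h; elim/big_ind: _ => //; last by move=> p q; apply: ball_content_gtD.
by rewrite ball_content0 v0; case: c c0 {h}.
Qed.

Lemma ball_content_ge_sum c (I : Type) (r : seq I) (P : pred I) (F : I -> {poly L}) :
  (forall k, P k -> vle c (v (ball_content (F k)))) ->
  vle c (v (ball_content (\sum_(k <- r | P k) F k))).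
Proof.
move=> h; elim/big_ind: _ => //; last by move=> p q; apply: ball_content_geD.
by rewrite ball_content0 v0 vleN.
Qed.

Lemma ball_contentX p k : v (ball_content (p ^+ k)) = v (ball_content p ^+ k).
Proof.
elim: k => [|k IH]; first by rewrite !expr0 -polyC1 ball_contentC.
by rewrite !exprS ball_contentM vM IH -vM.
Qed.

Lemma ball_content_le_horner p t : vle (v 1) (v t) ->
  vle (v (ball_content p)) (v p.[d * t + a]).
Proof.
move=> t0; have -> : p.[d * t + a] = (sub p).[t].
  by rewrite horner_comp hornerD hornerZ hornerX hornerC.
by apply: val_ge_horner => // k; apply: content_le.
Qed.

Lemma ball_content_le_center p : vle (v (ball_content p)) (v p.[a]).
Proof. by have := @ball_content_le_horner p 0; rewrite mulr0 add0r v0 vleN; apply. Qed.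

Lemma ball_content_le p : vle (v (ball_content p)) (v p.[a + d]).
Proof. by have := @ball_content_le_horner p 1; rewrite mulr1 addrC vle_refl; apply. Qed.

Lemma sub_XsubC b : sub ('X - b%:P) = d *: 'X + (a - b)%:P.
Proof. by rewrite comp_polyB comp_polyX comp_polyC -addrA -polyCB. Qed.

(** The substituted polynomial is d X + (a - b), and a - b = (a + d - b) - d has value at least v(a
    + d - b). *)
Lemma ball_content_XsubC b : vle (v (a + d - b)) (v d) ->
  v (ball_content ('X - b%:P)) = v (a + d - b).
Proof.
move=> h; apply: vle_anti.
  by have := ball_content_le ('X - b%:P); rewrite !hornerE.
apply: content_ge => k; rewrite sub_XsubC coefD coefZ coefX coefC.
case: k => [|[|k]] /=; rewrite ?mulr0 ?mulr1 ?add0r ?addr0 ?v0 ?vleN //.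
have -> : a - b = (a + d - b) - d by ring.
by apply: val_geD; rewrite ?vle_refl ?vN.
Qed.

Lemma ball_content_XsubC_le b : vle (v (ball_content ('X - b%:P))) (v d).
Proof.
have := content_le (sub ('X - b%:P)) 1.
by rewrite {2}sub_XsubC coefD coefZ coefX coefC /= mulr1 addr0.
Qed.

(** Multiplicativity reduces the claim to linear factors, where only a root strictly closer to a + d
    than v d could spoil equality. *)
Lemma ball_content_horner p : (forall b, root p b -> vle (v (a + d - b)) (v d)) ->
  v (ball_content p) = v p.[a + d].
Proof.
have [->|pN] := eqVneq p 0.
  by rewrite ball_content0 horner0.
have [r rE] := closed_field_poly_normal p.
have lN : lead_coef p != 0 by rewrite lead_coef_eq0.
move=> h; have {h} : forall b, b \in r -> vle (v (a + d - b)) (v d).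
  by move=> b br; apply: h; rewrite rE rootZ ?root_prod_XsubC.
rewrite rE; move: (lead_coef p) => c; elim: r {rE} => [|z r IH] h.
  by rewrite big_nil alg_polyC ball_contentC hornerC.
rewrite big_cons scalerAr ball_contentM hornerM !vM.
rewrite IH; last by move=> b br; apply: h; rewrite inE br orbT.
by rewrite ball_content_XsubC ?h ?mem_head // !hornerE.
Qed.

(** The linear factor of b has Gauss value at most v d but a larger value at a + d, and the cofactor
    cannot compensate for this. *)
Lemma ball_content_lt_horner p b : p != 0 -> root p b -> vlt (v d) (v (a + d - b)) ->
  vlt (v (ball_content p)) (v p.[a + d]).
Proof.
move=> pN /factor_theorem [q pq] db; rewrite pq in pN *.
rewrite mulrC ball_contentM hornerM; apply: vlt_le_mul.
- by rewrite ball_content_eq0; apply: contraNneq pN => ->; rewrite mul0r.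
- by rewrite !hornerE; apply: vle_lt_trans (ball_content_XsubC_le b) db.
- exact: ball_content_le.
Qed.

(** A root b outside the ball contributes a factor d X + (a - b) with dominant constant term, and
    products preserve dominance. *)
Lemma sub_dominant_constant p : p != 0 ->
    (forall b, root p b -> vlt (v (a - b)) (v d)) ->
  forall k, vlt (v (sub p)`_0) (v (sub p)`_k.+1).
Proof.
move=> pN; have [r rE] := closed_field_poly_normal p.
have lN : lead_coef p != 0 by rewrite lead_coef_eq0.
move=> h; have {h} : forall b, b \in r -> vlt (v (a - b)) (v d).
  by move=> b br; apply: h; rewrite rE rootZ ?root_prod_XsubC.
rewrite rE; move: (lead_coef p) lN => c c0; elim: r {rE} => [|z r IH] h k.
  rewrite big_nil alg_polyC comp_polyC !coefC /= v0; apply: vlt_None; exact/(v_neq0 v).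
have {}IH := IH (fun b br => h b (mem_behead (s := z :: r) br)).
rewrite big_cons scalerAr rmorphM /= sub_XsubC; move: (sub (c *: _)) IH => q IH.
have q0 : q`_0 != 0.
  by apply/(v_neq0 v) => e; have := IH 0; rewrite e; case: (v _).
have qle l : vle (v q`_0) (v q`_l) by case: l => [|l]; rewrite ?vle_refl ?vltW.
have zd := h z (mem_head _ _).
have az : a - z != 0 by apply/(v_neq0 v) => e; move: zd; rewrite e; case: (v d).
rewrite mulrDl -scalerAl !coefD !coefZ !coefCM !coefXM /= mulr0 add0r.
apply: val_gtD; first exact: vlt_le_mul.
by rewrite vlt_mul2lE.
Qed.

(** Subtracting p(a) removes precisely the dominant coefficient, and all the others have larger
    values. *)
Lemma ball_content_near_constant p : p != 0 ->
    (forall b, root p b -> vlt (v (a - b)) (v d)) ->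
  vlt (v p.[a]) (v (ball_content (p - p.[a]%:P))).
Proof.
move=> pN h; have dom := sub_dominant_constant pN h.
have p0 : (sub p)`_0 = p.[a].
  by rewrite -horner_coef0 horner_comp hornerD hornerZ hornerX hornerC mulr0 add0r.
rewrite /ball_content /content rmorphB /= comp_polyC; move: (sval _) => k.
rewrite coefB coefC -p0; case: k => [|k] /=; last by rewrite subr0.
by rewrite subrr v0; have := dom 0; case: (v _) => //; case: (v _).
Qed.

(* The factors [phi - t] of [Q \Po phi] have Gauss value at most
   min (v (phi(a + d)), v t), as evaluating them at the root [a] shows. *)
Lemma ball_content_comp_le (phi Q : {poly L}) : phi.[a] = 0 ->
    v (ball_content phi) = v phi.[a + d] -> Q != 0 ->
  forall k, vle (v (ball_content (Q \Po phi))) (v (Q`_k * phi.[a + d] ^+ k)).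
Proof.
move=> phia phid QN; have [r rE] := closed_field_poly_normal Q.
rewrite rE; move: (lead_coef Q) => c; elim: r {QN rE Q} => [|t r IH] k.
  rewrite big_nil alg_polyC comp_polyC ball_contentC coefC.
  by case: k => [|k] /=; rewrite ?expr0 ?mulr1 ?vle_refl // mul0r v0 vleN.
rewrite big_cons scalerAr rmorphM /= comp_polyB comp_polyX comp_polyC.
move: (c *: _) IH => q IH; rewrite ball_contentM mulrC.
have t_le : vle (v (ball_content (phi - t%:P))) (v t).
  by have := ball_content_le_center (phi - t%:P); rewrite !hornerE phia sub0r vN.
have phi_le : vle (v (ball_content (phi - t%:P))) (v phi.[a + d]).
  apply: contraT; rewrite -phid => h.
  have : vlt (v (ball_content phi)) (v (ball_content ((phi - t%:P) + t%:P))).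
    by apply: ball_content_gtD => //; rewrite ball_contentC; apply: vlt_le_trans t_le.
  by rewrite subrK vlt_irr.
rewrite mulrBl coefB coefXM coefCM mulrBl; apply: val_geD.
  case: k => [|k] /=; first by rewrite mul0r v0 vleN.
  by rewrite exprSr mulrA; apply: vle_mul.
by rewrite vN -mulrA mulrC; apply: vle_mul => //; rewrite mulrC.
Qed.

End GaussValuation.

(** * Expansions along a minimal pair *)

Section Residues.
Variables (L : fieldType) (G : oagType) (v : valuation L G).
Local Notation O x := (vle (Some 0) (v x)).
Local Notation res := (residue v).

Lemma residue_sub x (Ox : x \in vring v) :
  res x = (\pi_{ideal_quot (max_ideal (v := v))} (ValuationRing Ox))%qT.
Proof.
rewrite /residue; congr (\pi_ _)%qT; apply: val_inj => /=.
by rewrite insubdK.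
Qed.

Lemma residueD x y : O x -> O y -> res (x + y) = res x + res y.
Proof.
move=> Ox Oy; have Ox' : x \in vring v by []. have Oy' : y \in vring v by [].
have Oxy : x + y \in vring v by apply: val_geD.
rewrite (residue_sub Ox') (residue_sub Oy') (residue_sub Oxy).
rewrite -(rmorphD (\pi_{ideal_quot (max_ideal (v := v))})%qT).
by congr (\pi_ _)%qT; apply: val_inj.
Qed.

Lemma vringM x y : O x -> O y -> O (x * y).
Proof. by rewrite -(v1 v) => Ox Oy; rewrite -[X in vle (v X)]mulr1; apply: vle_mul. Qed.

Lemma residueM x y : O x -> O y -> res (x * y) = res x * res y.
Proof.
move=> Ox Oy; have Ox' : x \in vring v by []. have Oy' : y \in vring v by [].
have Oxy : x * y \in vring v by apply: vringM.
rewrite (residue_sub Ox') (residue_sub Oy') (residue_sub Oxy).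
rewrite -(rmorphM (\pi_{ideal_quot (max_ideal (v := v))})%qT).
by congr (\pi_ _)%qT; apply: val_inj.
Qed.

Lemma vring1 : O 1. Proof. by rewrite v1 vle_refl. Qed.

Lemma residue1 : res 1 = 1.
Proof.
have O1 : (1 : L) \in vring v by exact: vring1.
rewrite (residue_sub O1) -(rmorph1 (\pi_{ideal_quot (max_ideal (v := v))})%qT).
by congr (\pi_ _)%qT; apply: val_inj.
Qed.

Lemma residue_eq0 x : O x -> (res x == 0) = vlt (Some 0) (v x).
Proof.
move=> Ox; have Ox' : x \in vring v by [].
rewrite (residue_sub Ox') -(rmorph0 (\pi_{ideal_quot (max_ideal (v := v))})%qT).
by rewrite -Quotient.idealrBE subr0.
Qed.

Lemma residue0 : res 0 = 0.
Proof. by apply/eqP; rewrite residue_eq0 ?v0 ?vleN. Qed.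

Lemma residueN x : O x -> res (- x) = - res x.
Proof.
move=> Ox; apply/eqP; rewrite -addr_eq0 -residueD ?vN //.
by rewrite addNr residue0.
Qed.

Lemma residue_eq x y : O x -> O y -> (res x == res y) = vlt (Some 0) (v (x - y)).
Proof.
move=> Ox Oy; rewrite -subr_eq0 -residueN // -residueD ?vN // residue_eq0 //.
by apply: val_geD; rewrite ?vN.
Qed.

Lemma vringX x k : O x -> O (x ^+ k).
Proof.
by move=> Ox; elim: k => [|k IH]; [apply: vring1|rewrite exprS; apply: vringM].
Qed.

Lemma residueX x k : O x -> res (x ^+ k) = res x ^+ k.
Proof.
move=> Ox; elim: k => [|k IH]; first by rewrite !expr0 residue1.
by rewrite !exprS residueM ?IH //; apply: vringX.
Qed.

Lemma residue_sum (I : Type) (r : seq I) (P : pred I) (f : I -> L) :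
  (forall k, P k -> O (f k)) ->
  res (\sum_(k <- r | P k) f k) = \sum_(k <- r | P k) res (f k).
Proof.
move=> Of; elim: r => [|k r IH]; first by rewrite !big_nil residue0.
rewrite !big_cons; case: ifP => // Pk; rewrite residueD ?IH //; first exact: Of.
exact: val_ge_sum.
Qed.

(** The residue is 0 on the maximal ideal, and also outside the valuation ring by the default value
    of [residue]. *)
Lemma residue_neq0 x : res x != 0 -> v x = Some 0.
Proof.
case: (boolP (O x)) => Ox.
  by rewrite residue_eq0 // vltN => h; apply: vle_anti.
by rewrite /residue /insubd insubN //= -(rmorph0 (\pi_{ideal_quot (max_ideal (v := v))})%qT) eqxx.
Qed.

Lemma residue_unit x : v x = Some 0 -> res x != 0.
Proof. by move=> x0; rewrite residue_eq0 x0 ?vlt_irr ?vle_refl. Qed.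

Lemma residueV x : v x = Some 0 -> res x^-1 = (res x)^-1.
Proof.
move=> x0; have x00 : x != 0 by apply/(v_neq0 v); rewrite x0.
have xV : v x^-1 = Some 0 by rewrite (vV x0) oppr0.
apply: (mulfI (residue_unit x0)); rewrite mulfV ?residue_unit //.
by rewrite -residueM ?x0 ?xV ?vle_refl // mulfV // residue1.
Qed.

Lemma residue_subfield_subfield E : is_subfield E ->
  is_subfield (residue_subfield v E).
Proof.
move=> HE; apply/is_subfieldP; split.
- by exists 1; rewrite ?residue1 //; split; [apply: subfield1|apply: vring1].
- move=> _ _ [x [Ex Ox] <-] [y [Ey Oy] <-]; exists (x - y).
    by split; [apply: (subfieldB HE)|apply: val_geD; rewrite ?vN].
  by rewrite residueD ?vN // residueN.
- move=> _ _ [x [Ex Ox] <-] [y [Ey Oy] <-]; exists (x * y).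
    by split; [apply: (subfieldM HE)|apply: vringM].
  by rewrite residueM.
- move=> _ [x [Ex Ox] <-]; have [->|r0] := eqVneq (res x) 0.
    exists 0; rewrite ?residue0 ?invr0 //.
    by split; [apply: (subfield0 HE)|rewrite /= v0].
  have x0 := residue_neq0 r0; exists x^-1; last by rewrite residueV.
  by split; [apply: (subfieldV HE)|rewrite /= (vV x0) oppr0].
Qed.

End Residues.

(** * Polynomials near a minimal pair *)

Section MinimalPairExpansion.
Variables (K : fieldType) (L : closedFieldType) (iota : {rmorphism K -> L}).
Hypothesis alg : forall x, algebraicOver iota x.
Variables (G : oagType) (v : valuation L G).
Variables (theta alpha : L) (phi : {poly K}).
Hypothesis phi_min : is_min_poly iota alpha phi.
Local Notation "p ^i" := (map_poly iota p) (at level 2, format "p ^i") : ring_scope.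
Local Notation d := (theta - alpha).
Local Notation phit := (phi^i.[theta]).
Hypothesis d0 : d != 0.
Hypothesis phit0 : phit != 0.
Hypothesis alpha_minimal : forall b, vle (v d) (v (alpha - b)) ->
  (deg iota alpha <= deg iota b)%N.
Hypothesis conj_le : forall b, root phi^i b -> vle (v (theta - b)) (v d).

Lemma deg_min_poly x p : is_min_poly iota x p -> deg iota x = (size p).-1.
Proof. exact: adjoin_ext_degree. Qed.

Lemma deg_root_lt (g : {poly K}) b : g != 0 -> root g^i b ->
  (deg iota b < size g)%N.
Proof.
move=> gN rb; have [q qb] := min_poly_exists (alg b).
rewrite (deg_min_poly qb); have := min_poly_size_le qb gN rb.
by have := min_poly_size qb; case: (size q).
Qed.

Local Notation m := (size phi).-1.

Let alphad : alpha + d = theta. Proof. by rewrite addrC subrK. Qed.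

(** A root of g has smaller degree than alpha, so minimality keeps it from lying within v d of
    alpha. *)
Lemma root_small_far (g : {poly K}) b : (size g < size phi)%N -> g != 0 ->
  root g^i b -> vlt (v (alpha - b)) (v d).
Proof.
move=> sg gN rb; apply: contraT; rewrite vltN => /alpha_minimal.
rewrite (deg_min_poly phi_min) => h; have := leq_ltn_trans h (deg_root_lt gN rb).
move=> /leq_trans /(_ (_ : (size g <= m)%N)); rewrite ltnn; apply.
by rewrite -ltnS -(min_poly_sizeS phi_min).
Qed.

Lemma small_horner_neq0 (g : {poly K}) : (size g < size phi)%N -> g != 0 ->
  g^i.[alpha] != 0.
Proof. by move=> sg; apply: contra => /eqP /(min_poly_small_root phi_min sg) ->. Qed.

Lemma near_small_ball (g : {poly K}) : (size g < size phi)%N -> g != 0 ->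
  vlt (v g^i.[alpha]) (v (ball_content v alpha d (g^i - g^i.[alpha]%:P))).
Proof.
move=> sg gN; apply: ball_content_near_constant => //; first by rewrite map_poly_eq0.
by move=> b; apply: root_small_far.
Qed.

Lemma near_small (g : {poly K}) : (size g < size phi)%N -> g != 0 ->
  vlt (v g^i.[alpha]) (v (g^i.[theta] - g^i.[alpha])).
Proof.
move=> sg gN; apply: (vlt_le_trans (near_small_ball sg gN)).
by have := ball_content_le v alpha d (g^i - g^i.[alpha]%:P); rewrite alphad !hornerE.
Qed.

Lemma val_small (g : {poly K}) : (size g < size phi)%N ->
  v g^i.[theta] = v g^i.[alpha].
Proof.
move=> sg; have [->|gN] := eqVneq g 0; first by rewrite rmorph0 !horner0.
exact/val_eq_gtB/near_small.
Qed.

Lemma ball_content_phi : v (ball_content v alpha d phi^i) = v phit.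
Proof. by rewrite -{2}alphad ball_content_horner // => b; rewrite alphad; apply: conj_le. Qed.

Lemma phi_expansion (g : {poly K}) n : (size g <= n * m)%N ->
  exists2 c : nat -> {poly K}, (forall k, (size (c k) < size phi)%N) &
    g = \sum_(k < n) c k * phi ^+ k.
Proof.
elim: n g => [|n IH] g sg.
  exists (fun=> 0) => [k|]; first by rewrite size_poly0 (min_poly_sizeS phi_min).
  by rewrite big_ord0; apply/eqP; rewrite -size_poly_leq0.
have phiN := min_poly_neq0 phi_min.
have [|c sc gc] := IH (g %/ phi).
  by rewrite size_divp // leq_subLR addnC -mulSnr.
exists (fun k => if k is k'.+1 then c k' else g %% phi).
  by case=> [|k] //; rewrite ltn_modpN0.
rewrite big_ord_recl /= expr0 mulr1 {1}(divp_eq g phi) addrC; congr (_ + _).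
rewrite {1}gc mulr_suml; apply: eq_bigr => k _.
by rewrite -mulrA -exprSr.
Qed.

Lemma simple_ext_small x : simple_ext iota alpha x ->
  exists2 g : {poly K}, (size g < size phi)%N & g^i.[alpha] = x.
Proof. by rewrite /simple_ext (adjoinE phi_min) => -[g sg <-]; exists g. Qed.

Section Expansion.
Variable c : nat -> {poly K}.
Hypothesis sc : forall k, (size (c k) < size phi)%N.
Local Notation T k := ((c k)^i.[alpha] * phit ^+ k).
Local Notation T' k := ((c k)^i.[theta] * phit ^+ k).

(** [T'] gives the actual terms of g(theta), while [T] has its coefficients in K(alpha). By
    [near_term] the two agree up to elements of larger value. *)
Lemma val_term k : v (T' k) = v (T k).
Proof. by rewrite !vM val_small. Qed.

Lemma near_term k : c k != 0 -> vlt (v (T k)) (v (T' k - T k)).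
Proof.
move=> ck; rewrite -mulrBl mulrC [X in vlt _ (v X)]mulrC vlt_mul2lE ?expf_neq0 //.
exact: near_small.
Qed.

Lemma horner_expansion n :
  (\sum_(k < n) c k * phi ^+ k)^i.[theta] = \sum_(k < n) T' k.
Proof.
rewrite rmorph_sum horner_sum; apply: eq_bigr => k _.
by rewrite rmorphM rmorphXn hornerM horner_exp.
Qed.

Lemma expansion_min_term n : \sum_(k < n) c k * phi ^+ k != 0 ->
  exists2 k0 : 'I_n, c k0 != 0 & forall k : 'I_n, vle (v (T k0)) (v (T k)).
Proof.
case: n => [|n]; first by rewrite big_ord0 eqxx.
have [k0 k0min] := exists_min_value v (fun k : 'I_n.+1 => T k).
move=> gN; exists k0 => //; apply: contraNneq gN => ck0.
apply/eqP/big1 => k _; apply/eqP; rewrite mulf_eq0; apply/orP; left.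
apply: contraT => ck; have := k0min k; rewrite ck0 rmorph0 horner0 mul0r v0 => h.
have /(v_neq0 v) [] : T k != 0 by rewrite mulf_neq0 ?small_horner_neq0 ?expf_neq0.
exact: vle_anti (vleN _) h.
Qed.

(* Replacing each [c k] by the constant [c k (alpha)] changes [g] by an amount of
   larger Gauss value. *)
Lemma val_expansion_of_roots n (g : {poly K}) : g != 0 ->
    g = \sum_(k < n) c k * phi ^+ k ->
    (forall b, root g^i b -> vle (v (theta - b)) (v d)) ->
  forall k : 'I_n, vle (v g^i.[theta]) (v (T k)).
Proof.
move=> gN gE rg; have := gN; rewrite {1}gE => /expansion_min_term [k0 ck0 k0min] k.
apply: vle_trans (k0min k); apply: contraT => gk0.
(* The hypothesis on the roots of g makes v(g(theta)) equal to the Gauss value of g. *)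
have {}gk0 : vlt (v (T k0)) (v (ball_content v alpha d g^i)).
  by rewrite ball_content_horner // => [|b /rg]; rewrite alphad.
pose Q := \poly_(k < n) (c k)^i.[alpha].
have Qk0 : Q`_k0 = (c k0)^i.[alpha] by rewrite coef_poly ltn_ord.
have QN : Q != 0.
  apply/eqP => Q0; move: Qk0; rewrite Q0 coef0 => /esym/eqP.
  by rewrite (negPf (small_horner_neq0 (sc _) ck0)).
have Qphi : Q \Po phi^i = \sum_(k < n) (c k)^i.[alpha]%:P * phi^i ^+ k.
  rewrite /Q poly_def rmorph_sum; apply: eq_bigr => l _.
  by rewrite /= comp_polyZ comp_Xn_poly mul_polyC.
have QphiE : Q \Po phi^i =
    g^i - \sum_(k < n) ((c k)^i - (c k)^i.[alpha]%:P) * phi^i ^+ k.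
  rewrite Qphi gE rmorph_sum -sumrB; apply: eq_bigr => l _.
  by rewrite rmorphM rmorphXn -mulrBl opprB addrCA subrr addr0.
(* Q composed with phi has Gauss value at most v(T k0), yet by [QphiE] it is a difference of two
   polynomials of larger Gauss value. *)
have := ball_content_comp_le (v := v) (d := d) (min_poly_root phi_min) _ QN k0.
rewrite ball_content_phi alphad Qk0 => /(_ erefl) bad.
suff : vlt (v (T k0)) (v (ball_content v alpha d (Q \Po phi^i))) by rewrite /vlt bad.
rewrite QphiE; apply: ball_content_gtD => //.
rewrite ball_contentN; apply: ball_content_gt_sum => //.
  by apply/(v_neq0 v); rewrite mulf_neq0 ?small_horner_neq0 ?expf_neq0.
move=> l _.
have phiX : v (phit ^+ l) = v (ball_content v alpha d (phi^i ^+ l)).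
  rewrite ball_contentX; elim: (nat_of_ord l) => [|q IH]; rewrite ?expr0 //.
  by rewrite !exprS !vM IH ball_content_phi.
rewrite ball_contentM; have [->|cl] := eqVneq (c l) 0.
  rewrite rmorph0 horner0 subrr ball_content0 !mul0r v0; apply/vlt_None/(v_neq0 v).
  by rewrite mulf_neq0 ?small_horner_neq0 ?expf_neq0.
apply: vle_lt_trans (k0min l) _; apply: vlt_le_mul; first by rewrite expf_neq0.
  exact: near_small_ball.
by rewrite phiX vle_refl.
Qed.

Section InitialForm.
Variables (e : nat) (h : {poly K}).
Hypotheses (e_gt0 : (0 < e)%N) (sh : (size h < size phi)%N).
Hypothesis vh : v h^i.[alpha] = v (phit ^+ e).
Hypothesis e_min : forall k (p : {poly K}), (0 < k)%N -> (size p < size phi)%N ->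
  v p^i.[alpha] = v (phit ^+ k) -> (e <= k)%N.
Local Notation Ea := (simple_ext iota alpha).
Local Notation ha := (h^i.[alpha]).
Local Notation y := (phit ^+ e / ha).

Let HEa : is_subfield Ea. Proof. exact: adjoin_subfield. Qed.

Lemma ha_neq0 : ha != 0.
Proof. by apply/(v_neq0 v); rewrite vh; apply/(v_neq0 v); rewrite expf_neq0. Qed.

Lemma val_phi_ratio : v y = Some 0.
Proof. by rewrite -(v1 v); apply/v_div1; rewrite ?ha_neq0. Qed.

(** Otherwise the remainder of k modulo e would be a smaller positive multiplier taking
    v(phi(theta)) into the value group of K(alpha). *)
Lemma value_index_dvd x k : Ea x -> v x = v (phit ^+ k) -> (e %| k)%N.
Proof.
move=> Ex vx; rewrite /dvdn -leqn0 leqNgt; apply/negP => r0.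
have hq : ha ^+ (k %/ e) != 0 by rewrite expf_neq0 ?ha_neq0.
have [|p sp px] := @simple_ext_small (x / ha ^+ (k %/ e)).
  by apply: (subfieldM HEa) => //; apply: (subfieldV HEa); apply: (subfieldX HEa); apply: adjoin_horner.
have := e_min r0 sp; rewrite leqNgt ltn_pmod //= => h'.
suff : v p^i.[alpha] = v (phit ^+ (k %% e)) by move/h'.
apply: (v_mulI hq); rewrite px mulrC divfK // vx {1}(divn_eq k e) exprD !vM.
congr (vadd _ _); rewrite mulnC exprM.
by elim: (k %/ e)%N => [|l IH]; rewrite ?expr0 // !exprS !vM IH vh.
Qed.

Lemma value_index_mod a b k l : Ea a -> Ea b -> a != 0 ->
  v (a * phit ^+ k) = v (b * phit ^+ l) -> k = l %[mod e].
Proof.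
wlog kl : a b k l / (k <= l)%N.
  move=> H Ha Hb a0 vab; case/orP: (leq_total k l) => kl; first exact: H vab.
  apply/esym/(H b a) => //; apply/(v_neq0 v) => b0.
  have /(v_neq0 v) : a * phit ^+ k != 0 by rewrite mulf_neq0 ?expf_neq0.
  by apply; rewrite vab vM b0.
move=> Ha Hb a0 vab; have b0 : b != 0.
  apply/eqP => b0; have /(v_neq0 v) : a * phit ^+ k != 0 by rewrite mulf_neq0 ?expf_neq0.
  by apply; rewrite vab b0 mul0r v0.
have /value_index_dvd : Ea (a / b) by apply: (subfieldM HEa) => //; apply: (subfieldV HEa).
move=> /(_ (l - k)%N) dv; apply/eqP; rewrite eq_sym eqn_mod_dvd //; apply: dv.
apply: (@v_mulI _ _ v (b * phit ^+ k)); first by rewrite mulf_neq0 ?expf_neq0.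
rewrite -[b * _ * _ ^+ (l - k)]mulrA -exprD subnKC // -vab; congr (v _); field; exact: b0.
Qed.

(* The residues of the terms of least value give a relation for the residue of
   [y]: those terms have degrees in a single class modulo [e]. *)
Lemma initial_form J k0 : (k0 < J * e)%N -> c k0 != 0 ->
    (forall k, (k < J * e)%N -> vle (v (T k0)) (v (T k))) ->
    vlt (v (T k0)) (v (\sum_(k < J * e) T' k)) ->
  exists P : {poly residue_field v},
    [/\ P != 0, (size P <= J)%N, forall j, residue_subfield v Ea P`_j
      & root P (residue v y)].
Proof.
move=> k0J ck0 k0min k0lt.
pose r := (k0 %% e)%N; pose j0 := (k0 %/ e)%N.
(* Normalization at the least term: T(j e + r) = u_j y^j B, where B has the least value and u_j0 =
   1. *)
pose C := (c k0)^i.[alpha] * ha ^+ j0.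
have C0 : C != 0 by rewrite mulf_neq0 ?small_horner_neq0 // expf_neq0 ?ha_neq0.
pose u j := (c (j * e + r)%N)^i.[alpha] * ha ^+ j / C.
pose B := C * phit ^+ r.
have B0 : B != 0 by rewrite mulf_neq0 // expf_neq0.
have TE j : T (j * e + r)%N = u j * y ^+ j * B.
  rewrite /u /B exprD mulnC exprM expr_div_n.
  have := ha_neq0; move: ha (_.[alpha]) => H a H0.
  by field; rewrite C0 expf_neq0.
have k0E : k0 = (j0 * e + r)%N by rewrite /r /j0 -divn_eq.
have uj0 : u j0 = 1 by rewrite /u -k0E -/C mulfV.
have vyj j : v (y ^+ j) = v 1 by rewrite (vX _ val_phi_ratio) mul0rn v1.
have vTu j : v (T (j * e + r)%N) = v (B * u j).
  by rewrite TE vM [v (u j * _)]vM vyj -vM mulr1 -vM mulrC.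
have vT0 : v (T k0) = v B by rewrite {1 2}k0E vTu uj0 mulr1.
have jr j : (j < J)%N -> (j * e + r < J * e)%N.
  move=> jJ; apply: (@leq_trans (j.+1 * e)); last by rewrite leq_mul2r jJ orbT.
  by rewrite mulSnr ltn_add2l ltn_pmod.
have uO j : (j < J)%N -> vle (Some 0) (v (u j)).
  move=> jJ; rewrite -(v1 v) -(vle_mul2lE v _ _ B0) mulr1 -vTu -vT0.
  exact/k0min/jr.
have Eu j : Ea (u j).
  apply: (subfieldM HEa); last first.
    apply: (subfieldV HEa); apply: (subfieldM HEa); first exact: adjoin_horner.
    by apply: (subfieldX HEa); apply: adjoin_horner.
  apply: (subfieldM HEa); first exact: adjoin_horner.
  by apply: (subfieldX HEa); apply: adjoin_horner.
have vBN : v B <> None by apply/(v_neq0 v).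
(* The exponents are cut into J blocks of length e. Each block has one exponent of class r, whose
   coefficient is moved from theta to alpha; every other exponent has a term above the least value,
   by [value_index_mod]. *)
have diff : vlt (v B) (v (\sum_(k < J * e) T' k - (\sum_(j < J) u j * y ^+ j) * B)).
  rewrite -(big_mkord xpredT (fun k => T' k)) big_nat_mul big_mkord mulr_suml -sumrB.
  apply: val_gt_sum => // j _.
  rewrite (bigD1_seq (j * e + r)%N) ?iota_uniq //=; last first.
    by rewrite mem_index_iota leq_addr mulSnr ltn_add2l ltn_pmod.
  rewrite addrAC -TE; apply: val_gtD.
    have [->|cj] := eqVneq (c (j * e + r)%N) 0.
      by rewrite rmorph0 !horner0 !mul0r subrr v0; apply: vlt_None.
    apply: vle_lt_trans (near_term cj).
    by rewrite -vT0; apply/k0min/jr.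
  rewrite big_seq_cond; apply: val_gt_sum => // k; rewrite mem_index_iota.
  move=> /andP [/andP [jk kj] kjr].
  have kJ : (k < J * e)%N by apply: (leq_trans kj); rewrite leq_mul2r ltn_ord orbT.
  rewrite val_term -vT0; have [eqv|//] := vle_eqVlt (k0min _ kJ).
  case/negP: kjr; apply/eqP.
  have := value_index_mod (adjoin_horner _) (adjoin_horner _)
    (small_horner_neq0 (sc _) ck0) eqv.
  rewrite -/r => rk; rewrite {1}(divn_eq k e) -rk; congr (_ * _ + _)%N.
  apply/eqP; rewrite eqn_leq -ltnS ltn_divLR // kj /=.
  by rewrite leq_divRL.
have sum0 : vlt (Some 0) (v (\sum_(j < J) u j * y ^+ j)).
  rewrite -(v1 v) -(vlt_mul2lE v _ _ B0) mulr1 [B * _]mulrC.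
  set S := _ * B in diff *; rewrite -[S](subKr (\sum_(k < J * e) T' k)).
  by apply: val_gtD; rewrite ?vN // -vT0.
have uyO (j : 'I_J) : vle (Some 0) (v (u j * y ^+ j)).
  by apply: vringM; [apply: uO|rewrite vyj v1 vle_refl].
have j0J : (j0 < J)%N by rewrite ltn_divLR.
(* The coefficient of index j0 is 1, since u_j0 = 1, so the relation is not trivial. *)
exists (\poly_(j < J) residue v (u j)); split.
- apply/eqP => /(congr1 (fun P : {poly _} => P`_j0)); rewrite coef0 coef_poly j0J uj0.
  by rewrite residue1 => /eqP; rewrite oner_eq0.
- exact: size_poly.
- move=> j; rewrite coef_poly; case: ltnP => jJ.
    by exists (u j) => //; split=> //; apply: uO.
  exact: subfield0 (residue_subfield_subfield v HEa).
rewrite rootE horner_poly; have := sum0; rewrite -residue_eq0; last exact: val_ge_sum.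
rewrite residue_sum // => /eqP S0; apply/eqP; rewrite -[RHS]S0; apply: eq_bigr => j _.
have yO : vle (Some 0) (v y) by rewrite val_phi_ratio vle_refl.
rewrite (@residueM _ _ v (u j)); [by rewrite (residueX j yO)|apply: uO; apply: ltn_ord|apply: vringX yO].
Qed.

End InitialForm.
End Expansion.

(** * The degree of theta and the degree of the residue Y *)

Section ResidualDegree.
Variables (e : nat) (h : {poly K}).
Hypotheses (e_gt0 : (0 < e)%N) (sh : (size h < size phi)%N).
Hypothesis vh : v h^i.[alpha] = v (phit ^+ e).
Hypothesis e_min : forall k (p : {poly K}), (0 < k)%N -> (size p < size phi)%N ->
  v p^i.[alpha] = v (phit ^+ k) -> (e <= k)%N.
Variable f : {poly K}.
Hypothesis f_min : is_min_poly iota theta f.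
Local Notation n := (size f).-1.
Local Notation Ea := (simple_ext iota alpha).
Local Notation Et := (simple_ext iota theta).
Local Notation ha := (h^i.[alpha]).
Local Notation y := (phit ^+ e / ha).
Local Notation Y := (residue v y).
Local Notation ka := (residue_subfield v Ea).

Let HEa : is_subfield Ea. Proof. exact: adjoin_subfield. Qed.
Let HEt : is_subfield Et. Proof. exact: adjoin_subfield. Qed.
Let ha0 : ha != 0. Proof. exact: ha_neq0 vh. Qed.
Let vy0 : v y = Some 0. Proof. exact: val_phi_ratio vh. Qed.
Let yO : vle (Some 0) (v y). Proof. by rewrite vy0 vle_refl. Qed.

Lemma residue_subfield_alpha : is_subfield ka.
Proof. exact: residue_subfield_subfield. Qed.

Local Notation inck := (subfield_incl residue_subfield_alpha).

(** f vanishes at theta, so its value there exceeds that of the least term and [initial_form]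
    applies. *)
Lemma relation_of_min_poly J : (size f <= J * e * m)%N ->
  exists P : {poly subfield_field residue_subfield_alpha},
    [/\ P != 0, (size P <= J)%N & root (map_poly inck P) Y].
Proof.
move=> sf; have [c sc fc] := phi_expansion sf.
have := min_poly_neq0 f_min; rewrite {1}fc => /(expansion_min_term sc) [k0 ck0 k0min].
have [k kJ||P [PN sP Pk rP]] := initial_form sc e_gt0 vh e_min (ltn_ord k0) ck0.
- exact: (k0min (Ordinal kJ)).
- rewrite -horner_expansion -fc (min_poly_root f_min) v0.
  by apply/vlt_None/(v_neq0 v); rewrite mulf_neq0 ?small_horner_neq0 ?expf_neq0.
have [P' P'E] := poly_lift residue_subfield_alpha Pk; exists P'; split.
- by rewrite -(map_poly_eq0 inck) P'E.
- by rewrite -(size_map_poly inck) P'E.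
- by rewrite P'E.
Qed.

Lemma Y_algebraic : algebraicOver inck Y.
Proof.
(* J = size f is large enough because e and deg phi are positive. *)
have [|P [PN _ rP]] := @relation_of_min_poly (size f); last by exists P.
by rewrite -mulnA leq_pmulr // muln_gt0 e_gt0 (min_poly_deg_gt0 phi_min).
Qed.

Variable mu : {poly subfield_field residue_subfield_alpha}.
Hypothesis mu_min : is_min_poly inck Y mu.
(** The degree of Y over the residue field of K(alpha); it is not derived from the polynomial f. *)
Local Notation f' := (size mu).-1.

Lemma degree_ge : (f' * e * m <= n)%N.
Proof.
rewrite leqNgt; apply/negP => lt.
have [|P [PN sP rP]] := @relation_of_min_poly f'; first by rewrite (min_poly_sizeS f_min).
by have := leq_trans (min_poly_size_le mu_min PN rP) sP; rewrite (min_poly_sizeS mu_min) ltnn.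
Qed.

(** A cancellation among the terms of least value would give an equation for Y of degree below
    f'. *)
Lemma val_small_expansion (c : nat -> {poly K}) : (forall k, (size (c k) < size phi)%N) ->
  let g := \sum_(k < f' * e) c k * phi ^+ k in g != 0 ->
  forall k : 'I_(f' * e), vle (v g^i.[theta]) (v ((c k)^i.[alpha] * phit ^+ k)).
Proof.
move=> sc g gN k; have [k0 ck0 k0min] := expansion_min_term sc gN.
apply: vle_trans (k0min k); apply: contraT => lt.
have [l lJ||P [PN sP Pk rP]] := initial_form sc e_gt0 vh e_min (ltn_ord k0) ck0.
- exact: (k0min (Ordinal lJ)).
- by rewrite -horner_expansion.
have [P' P'E] := poly_lift residue_subfield_alpha Pk.
have P'N : P' != 0 by rewrite -(map_poly_eq0 inck) P'E.
have := min_poly_size_le mu_min P'N; rewrite P'E => /(_ rP).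
by rewrite -(size_map_poly inck P') P'E (min_poly_sizeS mu_min) ltnNge sP.
Qed.

Lemma ball_content_small (g : {poly K}) : (size g < size phi)%N ->
  v (ball_content v alpha d g^i) = v g^i.[alpha].
Proof.
move=> sg; have [->|gN] := eqVneq g 0; first by rewrite rmorph0 horner0 ball_content0.
rewrite -(val_small sg) -{2}alphad ball_content_horner // => b rb.
have far := root_small_far sg gN rb; rewrite alphad.
have -> : theta - b = (alpha - b) + d by ring.
by rewrite (val_addl far); apply: vltW.
Qed.

Lemma closest_of_degree : (n <= f' * e * m)%N -> forall b, (deg iota b < n)%N ->
  vle (v (theta - b)) (v d).
Proof.
move=> nle b bn; apply: contraT => lt.
have [g gb] := min_poly_exists (alg b).
have sg : (size g <= f' * e * m)%N.
  apply: leq_trans nle; move: bn; rewrite (deg_min_poly gb).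
  by have := min_poly_size gb; case: (size g).
have [c sc gE] := phi_expansion sg.
have gN := min_poly_neq0 gb.
have gN' : \sum_(k < f' * e) c k * phi ^+ k != 0 by rewrite -gE.
have := val_small_expansion sc gN'; rewrite -gE => h1.
have : vlt (v (ball_content v alpha d g^i)) (v g^i.[theta]).
  rewrite -[theta in X in vlt _ X]alphad; apply: (ball_content_lt_horner _ (b := b)) => //.
  - by rewrite map_poly_eq0.
  - by case: gb.
  - by rewrite alphad.
(* By multiplicativity c_k phi^k has the Gauss value v(c_k(alpha) phi(theta)^k), which is at least
   v(g(theta)). This bound passes to the sum and contradicts the strict inequality caused by the
   close root b. *)
have : vle (v g^i.[theta]) (v (ball_content v alpha d g^i)).
  rewrite {2}gE rmorph_sum; apply: ball_content_ge_sum => k _.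
  apply: vle_trans (h1 k) _.
  rewrite rmorphM rmorphXn /= ball_contentM [X in vle _ X]vM ball_content_small //.
  rewrite vM (_ : v (ball_content _ _ _ (_ ^+ _)) = v (phit ^+ k)) ?vle_refl //.
  rewrite ball_contentX; elim: (nat_of_ord k) => [|q IH]; rewrite ?expr0 //.
  by rewrite !exprS !vM IH ball_content_phi.
by move=> h2; rewrite /vlt h2.
Qed.

Section DegreeBound.
Hypothesis theta_closest : forall b, (deg iota b < n)%N -> vle (v (theta - b)) (v d).

(** Homogenizing by powers of h(alpha) makes H_j(alpha) phi(theta)^(j e) / h(alpha)^f' a lift of
    mu_j Y^j. Taking H = 1 at the top gives the lifted polynomial the exact degree f' e m. *)
Lemma lift_coefficient j : exists2 H : {poly K}, (size H < size phi)%N &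
  exists a, [/\ vle (Some 0) (v a), residue v a = inck mu`_j,
    H^i.[alpha] = a * ha ^+ (f' - j) & j = f' -> H = 1].
Proof.
have [->|jf] := eqVneq j f'.
  exists 1; first by rewrite size_poly1 (min_poly_size phi_min).
  exists 1; rewrite rmorph1 hornerC subnn expr0 mulr1 vring1 residue1; split=> //.
  by have /monicP := min_poly_monic mu_min; rewrite lead_coefE => ->; rewrite rmorph1.
have [a [Ea_a Oa] ra] := subfield_inclP mu`_j.
have [|H sH HE] := @simple_ext_small (a * ha ^+ (f' - j)).
  by apply: (subfieldM HEa) => //; apply: (subfieldX HEa); apply: adjoin_horner.
by exists H => //; exists a; split=> // jf'; rewrite jf' eqxx in jf.
Qed.

(* Lifting the minimal polynomial of [Y] yields a polynomial of degree
   [f' * e * m] whose value at [theta] is exceptionally large. *)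
Lemma degree_le : (n <= f' * e * m)%N.
Proof.
rewrite leqNgt; apply/negP => lt.
pose H j := s2val (cid2 (lift_coefficient j)).
have sH j : (size (H j) < size phi)%N by apply: (s2valP (cid2 (lift_coefficient j))).
have HP j := s2valP' (cid2 (lift_coefficient j)).
have Hf' : H f' = 1 by have [a [_ _ _ H1]] := HP f'; apply: H1.
pose c k := if (e %| k)%N then H (k %/ e)%N else 0.
have sc k : (size (c k) < size phi)%N.
  by rewrite /c; case: ifP => // _; rewrite size_poly0 (min_poly_sizeS phi_min).
pose g := \sum_(k < f'.+1 * e) c k * phi ^+ k.
have gE : g = \sum_(j < f'.+1) H j * phi ^+ (j * e).
  rewrite /g -(big_mkord xpredT (fun k => c k * phi ^+ k)) big_nat_mul big_mkord.
  apply: eq_bigr => j _; rewrite (bigD1_seq (j * e)%N) ?iota_uniq //=; last first.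
    by rewrite mem_index_iota leqnn mulSnr -[X in (X < _)%N]addn0 ltn_add2l.
  rewrite {1}/c dvdn_mull // mulnK // big_seq_cond big1 ?addr0 // => k.
  rewrite mem_index_iota => /andP [/andP [jk kj] kne].
  rewrite /c; case: ifP => [/dvdnP [q kq]|]; last by rewrite mul0r.
  case/eqP: kne; rewrite kq in jk kj *; congr (_ * _)%N; apply/eqP.
  by rewrite eqn_leq -ltnS -(ltn_pmul2r e_gt0) kj -(leq_pmul2r e_gt0) jk.
have phiN := min_poly_neq0 phi_min.
have sphiX k : size (phi ^+ k) = (k * m).+1.
  by rewrite -[LHS]prednK ?size_poly_gt0 ?expf_neq0 // size_exp mulnC.
have sg : size g = (f' * e * m).+1.
  rewrite gE big_ord_recr /= Hf' mul1r addrC size_polyDl sphiX //.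
  rewrite ltnS (leq_trans (size_sum _ _ _)) //; apply/bigmax_leqP => j _.
  rewrite (leq_trans (size_polyMleq _ _)) // sphiX addnS /=.
  apply: (@leq_trans (m + j * e * m)); first by rewrite leq_add2r -ltnS -(min_poly_sizeS phi_min).
  rewrite -mulSn leq_mul2r; apply/orP; right.
  apply: (@leq_trans (j.+1 * e)); last by rewrite leq_mul2r ltn_ord orbT.
  by rewrite mulSnr -addn1 leq_add2l.
have gN : g != 0 by rewrite -size_poly_eq0 sg.
have kf : (f' * e < f'.+1 * e)%N by rewrite ltn_pmul2r.
(* Roots of g have degree at most f' e m, which is below n, so none is closer to theta than alpha.
   Hence v(g(theta)) cannot exceed the value of the top term phi(theta)^(f' e), whereas [large] will
   say that it does. *)
have rg b : root g^i b -> vle (v (theta - b)) (v d).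
  by move=> rb; apply: theta_closest; apply: (leq_trans (deg_root_lt gN rb)); rewrite sg.
have := val_expansion_of_roots sc gN erefl rg (Ordinal kf).
rewrite /= {1}/c dvdn_mull // mulnK // Hf' rmorph1 hornerC mul1r.
suff large : vlt (v (phit ^+ (f' * e))) (v g^i.[theta]) by rewrite /vlt in large; rewrite (negPf large).
have haX : ha ^+ f' != 0 by rewrite expf_neq0.
pose z := phit ^+ (f' * e) / ha ^+ f'.
have zy : z = y ^+ f' by rewrite /z expr_div_n -exprM mulnC.
have vz : v z = v 1 by rewrite zy (vX _ vy0) mul0rn v1.
have vphi : v (phit ^+ (f' * e)) = v (ha ^+ f') by apply/(v_div1 v).
have -> : g^i.[theta] = ha ^+ f' * (g^i.[theta] / ha ^+ f') by rewrite mulrC divfK.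
rewrite vphi -[X in vlt (v X) _]mulr1 vlt_mul2lE // v1.
have aP j : exists a, [/\ vle (Some 0) (v a), residue v a = inck mu`_j
    & (H j)^i.[alpha] = a * ha ^+ (f' - j)].
  by have [a [? ? ? _]] := HP j; exists a.
pose a j := sval (cid (aP j)).
have aO j : vle (Some 0) (v (a j)) by have [] := svalP (cid (aP j)).
have ar j : residue v (a j) = inck mu`_j by have [] := svalP (cid (aP j)).
have aH j : (H j)^i.[alpha] = a j * ha ^+ (f' - j) by have [] := svalP (cid (aP j)).
have ayO j : vle (Some 0) (v (a j * y ^+ j)) by apply: vringM => //; apply: vringX.
have ayE (j : 'I_f'.+1) : (H j)^i.[alpha] * phit ^+ (j * e) / ha ^+ f' = a j * y ^+ j.
  have jf : (j <= f')%N by rewrite -ltnS.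
  rewrite aH expr_div_n mulnC exprM -[in ha ^+ f'](subnK jf) exprD.
  have := expf_neq0 j ha0; have := expf_neq0 (f' - j) ha0.
  move: (ha ^+ _) (ha ^+ _) => A B A0 B0.
  by field; rewrite A0 B0.
(* The residue of this sum is mu(Y) = 0. The sum differs from g(theta) / h(alpha)^f' only by the
   passage from H_j(alpha) to H_j(theta), and that difference has positive value. *)
have sum_gt : vlt (Some 0) (v (\sum_(j < f'.+1) a j * y ^+ j)).
  rewrite -residue_eq0; last exact: val_ge_sum.
  rewrite residue_sum //; apply/eqP.
  transitivity (map_poly inck mu).[Y]; last exact: min_poly_root mu_min.
  rewrite (horner_coef_wide _ (p := map_poly inck mu) (n := f'.+1)); last first.
    by rewrite size_map_poly -(min_poly_sizeS mu_min).
  apply: eq_bigr => j _; rewrite residueM ?residueX //; last exact: vringX.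
  by rewrite ar coef_map.
rewrite -[X in v X](subrK (\sum_(j < f'.+1) a j * y ^+ j)); apply: val_gtD => //.
rewrite gE rmorph_sum horner_sum mulr_suml -sumrB; apply: val_gt_sum => // j _.
rewrite rmorphM rmorphXn hornerM horner_exp /= -ayE -!mulrBl.
have [Hj|Hj] := eqVneq (H j) 0; first by rewrite Hj !rmorph0 !horner0 subrr !mul0r v0.
apply: (@vle_lt_trans _ _ (v ((H j)^i.[alpha] * phit ^+ (j * e) / ha ^+ f'))).
  by rewrite ayE.
rewrite -!mulrA mulrC [X in vlt _ (v X)]mulrC vlt_mul2lE; first exact: near_small.
by rewrite mulf_neq0 ?expf_neq0 ?invr_eq0.
Qed.

End DegreeBound.

Section Extension.
Hypothesis n_le : (n <= f' * e * m)%N.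

Lemma theta_expansion x : Et x -> exists c : nat -> {poly K},
  [/\ forall k, (size (c k) < size phi)%N,
      x = \sum_(k < f' * e) (c k)^i.[theta] * phit ^+ k
    & forall k : 'I_(f' * e), vle (v x) (v ((c k)^i.[alpha] * phit ^+ k))].
Proof.
rewrite /simple_ext (adjoinE f_min) => -[g /= sg <-].
have [->|gN] := eqVneq g 0.
  exists (fun=> 0); split=> [k||k]; first by rewrite size_poly0 (min_poly_sizeS phi_min).
    rewrite rmorph0 horner0 big1 // => k _.
    by rewrite mul0r.
  by rewrite /= rmorph0 !horner0 mul0r vle_refl.
have [|c sc gE] := @phi_expansion g (f' * e).
  by apply: leq_trans n_le; rewrite -ltnS -(min_poly_sizeS f_min).
exists c; split=> //; first by rewrite gE horner_expansion.
by move: gN; rewrite gE => gN; apply: val_small_expansion.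
Qed.

Lemma value_group_theta gamma : v phit = Some gamma ->
  value_group v Et = [set g + gamma *~ z | g in value_group v Ea & z in [set: int]].
Proof.
move=> vphi; have vphiz z : v (phit ^ z) = Some (gamma *~ z).
  case: z => k; first exact: vX.
  rewrite -[phit ^ _]/(phit ^- k.+1) -[gamma *~ _]/(- (gamma *+ k.+1)).
  by rewrite -exprVn (vX _ (vV vphi)) mulNrn.
apply/seteqP; split=> g.
  move=> [x Ex vx]; have [c [sc xE xle]] := theta_expansion Ex.
  (* If all terms had values above v(x), so would their sum x. *)
  have [k vk] : exists k : 'I_(f' * e), v ((c k)^i.[alpha] * phit ^+ k) = v x.
    apply: contrapT => /forallNP nk.
    suff : vlt (v x) (v x) by rewrite vlt_irr.
    rewrite {2}xE; apply: val_gt_sum => [|k _]; first by rewrite vx.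
    by rewrite val_term //; have [/esym /nk //|//] := vle_eqVlt (xle k).
  move: vk; rewrite vx vM (vX _ vphi); case vc: (v _.[alpha]) => [g'|] //= -[<-].
  exists g'; first by exists (c k)^i.[alpha] => //; apply: adjoin_horner.
  by exists (Posz k).
move=> [g' [x Ex vx] [z _ <-]]; have [p sp px] := simple_ext_small Ex.
exists (p^i.[theta] * phit ^ z).
  apply: (subfieldM HEt); first exact: adjoin_horner.
  case: z => k; last apply: (subfieldV HEt);
    by apply: (subfieldX HEt); apply: adjoin_horner.
by rewrite vM vphiz val_small // px vx.
Qed.

Lemma residue_subfield_theta : residue_subfield v Et = adjoin ka Y.
Proof.
have Hka := adjoin_subfield ka Y.
have near_res (p : {poly K}) : (size p < size phi)%N -> vle (Some 0) (v p^i.[alpha]) ->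
    residue v p^i.[theta] = residue v p^i.[alpha].
  move=> sp pO; have [->|pN] := eqVneq p 0; first by rewrite rmorph0 !horner0.
  apply/eqP; rewrite residue_eq ?val_small //.
  exact: vle_lt_trans pO (near_small sp pN).
apply/seteqP; split.
  move=> _ [x [Ex Ox] <-]; have [c [sc xE xle]] := theta_expansion Ex.
  have cO (k : 'I_(f' * e)) : vle (Some 0) (v ((c k)^i.[theta] * phit ^+ k)).
    by rewrite val_term //; apply: vle_trans Ox (xle k).
  rewrite xE residue_sum //; apply: (subfield_sum Hka) => k _.
  have [r0|rN] := eqVneq (residue v ((c k)^i.[theta] * phit ^+ k)) 0.
    by rewrite r0; apply: subfield0.
  have := residue_neq0 rN; rewrite val_term // => vk.
  have ck : c k != 0.
    by apply/eqP => c0; move: vk; rewrite c0 rmorph0 horner0 mul0r v0.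
  have /eqP -> : residue v ((c k)^i.[theta] * phit ^+ k) ==
                 residue v ((c k)^i.[alpha] * phit ^+ k).
    rewrite residue_eq ?cO ?vk ?vle_refl // -vk; exact: near_term.
  (* The term has the value 0 of 1 = 1 * phi(theta)^0, so its exponent is a multiple of e and it can
     be rewritten through y. *)
  have : (nat_of_ord k = 0 %[mod e])%N.
    apply: (value_index_mod _ vh e_min (a := (c k)^i.[alpha]) (b := 1)) => //.
    - exact: adjoin_horner.
    - exact: subfield1 HEa.
    - exact: small_horner_neq0.
    by rewrite vk expr0 mulr1 v1.
  rewrite mod0n => /eqP/dvdnP [j kj].
  pose a := (c k)^i.[alpha] * ha ^+ j.
  have Ea_a : Ea a.
    apply: (subfieldM HEa); first exact: adjoin_horner.
    by apply: (subfieldX HEa); apply: adjoin_horner.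
  have kE : (c k)^i.[alpha] * phit ^+ k = a * y ^+ j.
    rewrite /a expr_div_n kj mulnC exprM; have := expf_neq0 j ha0.
    by move: (ha ^+ j) => A A0; field.
  have vyj : v (y ^+ j) = v 1 by rewrite (vX _ vy0) mul0rn v1.
  have va : v a = Some 0 by rewrite -vk kE [RHS]vM vyj -vM mulr1.
  have aO : vle (Some 0) (v a) by rewrite va vle_refl.
  rewrite kE (residueM aO (vringX j yO)) (residueX j yO).
  apply: (subfieldM Hka); last by apply: (subfieldX Hka); apply: adjoin_mem.
  by apply: adjoin_sub; exists a => //; split=> //.
apply: adjoin_min; first exact: (residue_subfield_subfield v HEt).
  move=> _ [x [Ex Ox] <-]; have [p sp px] := simple_ext_small Ex.
  exists p^i.[theta]; last by rewrite near_res ?px.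
  by split; [exact: adjoin_horner|rewrite /= val_small ?px].
have ht : v h^i.[theta] = v ha by rewrite val_small.
have ht0 : h^i.[theta] != 0 by apply/(v_neq0 v); rewrite ht; apply/(v_neq0 v).
have hN : h != 0 by apply: contraNneq ha0 => ->; rewrite rmorph0 horner0.
have vy' : v (phit ^+ e / h^i.[theta]) = Some 0.
  by rewrite -(v1 v); apply/v_div1; rewrite // ht vh.
(* h(alpha) need not lie in K(theta); replacing it by h(theta) multiplies the quotient by an element
   of residue 1. *)
exists (phit ^+ e / h^i.[theta]).
  split; last by rewrite /= vy'.
  apply: (subfieldM HEt); first by apply: (subfieldX HEt); apply: adjoin_horner.
  by apply: (subfieldV HEt); apply: adjoin_horner.
apply/eqP; rewrite residue_eq ?vy' ?vle_refl //.
have -> : phit ^+ e / h^i.[theta] - y = y * ((ha - h^i.[theta]) / h^i.[theta]).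
  by field; rewrite ht0 ha0.
rewrite vM vy0 -(v1 v) -vM mul1r vlt_divE // mul1r ht vB.
exact: near_small.
Qed.

End Extension.

End ResidualDegree.
End MinimalPairExpansion.

(** * Indices and degrees *)

Section FiniteIndex.
Variable G : zmodType.
Implicit Types (A B : set G) (T : finType).

Definition subgroup A : Prop := A 0 /\ forall x y, A x -> A y -> A (x - y).

Lemma subgroupN A x : subgroup A -> A x -> A (- x).
Proof. by move=> [A0 AB] Ax; rewrite -sub0r; apply: AB. Qed.

Lemma subgroupD A x y : subgroup A -> A x -> A y -> A (x + y).
Proof.
by move=> HA Ax Ay; rewrite -[y]opprK; apply: (HA.2) => //; apply: subgroupN.
Qed.

Lemma subgroup_mulrz A x z : subgroup A -> A x -> A (x *~ z).
Proof.
move=> HA Ax; have An n : A (x *+ n).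
  elim: n => [|n IH]; first by case: HA.
  by rewrite mulrS; apply: subgroupD.
by case: z => n; [apply: An|apply: subgroupN => //; apply: An].
Qed.

(** Indexing by any finite type allows the representatives in a two-step tower to be indexed by
    pairs. *)
Definition coset_reps B A T (t : T -> G) : Prop :=
  (forall i, A (t i)) /\ forall a, A a -> exists! i, B (a - t i).

Lemma coset_reps_card_le B A T T' (t : T -> G) (t' : T' -> G) : subgroup B ->
  coset_reps B A t -> coset_reps B A t' -> (#|T| <= #|T'|)%N.
Proof.
move=> HB [At tP] [At' tP'].
have fP i : {j | B (t i - t' j)} by apply/cid; have [j [Bj _]] := tP' _ (At i); exists j.
apply: (@leq_card _ _ (fun i => sval (fP i))) => i1 i2 e.
have B12 : B (t i1 - t i2).
  have := svalP (fP i1); rewrite e => B1; have B2 := svalP (fP i2).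
  by have := HB.2 _ _ B1 B2; rewrite opprB addrA subrK.
have [i [_ iU]] := tP _ (At i1); rewrite -(iU i1) ?subrr ?(iU i2) //.
exact: HB.1.
Qed.

Lemma group_index_coset_reps B A T (t : T -> G) : subgroup B ->
  coset_reps B A t -> group_index B A = #|T|.
Proof.
move=> HB [At tP]; apply: xget_unique.
  exists (fun i => t (enum_val i)); split=> // a /tP [i [Bi iU]].
  exists (enum_rank i); split=> [|j /iU ->]; first by rewrite enum_rankK.
  by rewrite enum_valK.
move=> n [t' t'P]; have tT : coset_reps B A t by [].
have := coset_reps_card_le HB tT t'P; have := coset_reps_card_le HB t'P tT.
by rewrite !card_ord => h1 h2; apply/eqP; rewrite eqn_leq h1 h2.
Qed.

(** The bound provides a family of pairwise incongruent elements of maximal length; an element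
    congruent to none of them could be added. *)
Lemma bounded_coset_reps B A N : subgroup B ->
    (forall k (t : 'I_k -> G), (forall i, A (t i)) ->
       (forall i j, B (t i - t j) -> i = j) -> (k <= N)%N) ->
  exists n (t : 'I_n -> G), coset_reps B A t.
Proof.
move=> HB bound.
pose P k := `[< exists t : 'I_k -> G, (forall i, A (t i)) /\
  (forall i j, B (t i - t j) -> i = j) >].
have exP : exists k, P k.
  exists 0; apply/asboolP.
  have f : 'I_0 -> G by case.
  by exists f; split; case.
have bP k : P k -> (k <= N)%N.
  by move=> /asboolP [t [At tU]]; apply: bound At tU.
case: (ex_maxnP exP bP) => n /asboolP [t [At tU]] nmax.
exists n, t; split=> // a Aa.
suff [i Bi] : exists i, B (a - t i).
  exists i; split=> // j Bj; apply: tU.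
  by have := HB.2 _ _ Bj Bi; rewrite opprB addrC addrA subrK.
apply: contrapT => /forallNP nB.
have : P n.+1.
  apply/asboolP; exists (fun i => if unlift ord0 i is Some j then t j else a).
  split=> [i|i j]; first by case: unliftP.
  case: unliftP => [i' ->|->]; case: unliftP => [j' ->|->] // h.
  - by rewrite (tU _ _ h).
  - by case: (nB i'); rewrite -opprB; apply: subgroupN.
  - by case: (nB j').
by move/nmax; rewrite ltnn.
Qed.

(** A / A0 is cyclic of order e, generated by gamma. Division of z by e splits gamma z into an
    element of A0 and gamma j with j < e. *)
Lemma coset_reps_cyclic B A0 A T (t : T -> G) (gamma : G) e :
    subgroup B -> subgroup A0 -> B `<=` A0 -> (0 < e)%N -> A0 (gamma *+ e) ->
    (forall k, (0 < k)%N -> A0 (gamma *+ k) -> (e <= k)%N) ->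
    A = [set g + gamma *~ z | g in A0 & z in [set: int]] ->
  coset_reps B A0 t ->
  coset_reps B A (fun ij : T * 'I_e => t ij.1 + gamma *+ ij.2).
Proof.
move=> HB HA0 BA0 e0 A0e emin -> [At tP]; split=> [[i j]|_ [g A0g [z _ <-]]].
  by exists (t i) => //; exists (Posz j).
have eN : e%:Z != 0 by case: e e0 {A0e emin}.
have r0 : 0 <= (z %% e)%Z by apply: modz_ge0.
have rlt : (`|(z %% e)%Z|%N < e)%N by rewrite -ltz_nat gez0_abs // ltz_pmod.
have zE : gamma *~ z = gamma *+ e *~ (z %/ e)%Z + gamma *+ `|(z %% e)%Z|%N.
  rewrite {1}(divz_eq z e) mulrzDr mulrC mulrzA pmulrn; congr (_ + _).
  by rewrite -[in LHS](gez0_abs r0).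
have A0g' : A0 (g + gamma *+ e *~ (z %/ e)%Z) by apply: subgroupD => //; apply: subgroup_mulrz.
have [i [Bi iU]] := tP _ A0g'.
exists (i, Ordinal rlt); split=> /= [|[i' j] /=].
  by rewrite zE addrA opprD addrACA subrr addr0.
rewrite zE addrA opprD addrACA => Bij.
have A0d : A0 (gamma *+ `|(z %% e)%Z|%N - gamma *+ j).
  have := HA0.2 _ _ (BA0 _ Bij) (HA0.2 _ _ A0g' (At i')).
  by rewrite [X in A0 (X - _)]addrC addrK.
have jE : Ordinal rlt = j.
  apply/val_inj => /=; move: rlt A0d; move: `|_|%N => r rlt A0d.
  case: (ltngtP r j) => // lt.
    have A0k : A0 (gamma *+ (j - r)).
      by rewrite mulrnBr ?(ltnW lt) // -opprB; apply: subgroupN.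
    have := emin _ _ A0k; rewrite subn_gt0 lt => /(_ isT).
    by rewrite leqNgt (leq_ltn_trans (leq_subr _ _) (ltn_ord j)).
  have A0k : A0 (gamma *+ (r - j)) by rewrite mulrnBr ?(ltnW lt).
  have := emin _ _ A0k; rewrite subn_gt0 lt => /(_ isT).
  by rewrite leqNgt (leq_ltn_trans (leq_subr _ _) rlt).
congr (_, _) => //; apply: iU.
by move: Bij; rewrite -jE /= subrr addr0.
Qed.

End FiniteIndex.

Section FiniteDegree.
Variable L : fieldType.
Implicit Types (E F M : set L) (T : finType).

Definition independent F T (b : T -> L) : Prop :=
  forall c : T -> L, (forall i, F (c i)) -> \sum_i c i * b i = 0 -> forall i, c i = 0.

(** [is_basis] over any finite index type, with uniqueness of coordinates expressed as independence,
    the form in which bases multiply in towers. *)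
Definition fin_basis F E T (b : T -> L) : Prop :=
  [/\ forall i, E (b i), independent F b
    & forall y, E y -> exists c : T -> L, (forall i, F (c i)) /\ y = \sum_i c i * b i].

Lemma fin_basis_degree F E T (b : T -> L) : is_subfield F -> is_subfield E -> F `<=` E ->
  fin_basis F E b -> ext_degree F E = #|T|.
Proof.
move=> HF HE FE [Eb bI bS].
apply: (ext_degree_eq HF (b := fun i => b (enum_val i))); split=> // y /bS [c [Fc yE]].
have reidx (c' : T -> L) : \sum_(i < #|T|) c' (enum_val i) * b (enum_val i) = \sum_i c' i * b i.
  by rewrite [RHS](reindex (@enum_val T T)) //; apply: onW_bij; apply: enum_val_bij.
exists [ffun i => c (enum_val i)]; split=> [|c' [Fc' yE']].
  split=> [i|]; first by rewrite ffunE.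
  by rewrite yE -reidx; apply: eq_bigr => i _; rewrite ffunE.
apply/ffunP => i; rewrite ffunE; apply/eqP; rewrite -subr_eq0; apply/eqP.
have h : forall t, c t - c' (enum_rank t) = 0.
  apply: bI => [t|]; first exact: (subfieldB HF).
  under eq_bigr do rewrite mulrBl.
  rewrite sumrB -yE yE' -(reidx (fun t => c' (enum_rank t))) -sumrB big1 // => k _.
  by rewrite enum_valK subrr.
by rewrite -[X in _ - c' X]enum_valK h.
Qed.

Lemma fin_basis_tower F M E T T' (a : T -> L) (b : T' -> L) :
    is_subfield M -> is_subfield E -> F `<=` M -> M `<=` E ->
    fin_basis F M a -> fin_basis M E b ->
  fin_basis F E (fun ij : T * T' => a ij.1 * b ij.2).
Proof.
move=> HM HE FM ME [Ma aI aS] [Eb bI bS]; split=> [[i j]|c Fc s0 [i j]|y Ey].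
- by apply: (subfieldM HE) => //=; apply: ME.
- have sE : \sum_j (\sum_i c (i, j) * a i) * b j = 0.
    rewrite -[RHS]s0 (eq_bigr (fun j => \sum_i c (i, j) * (a i * b j))); last first.
      by move=> k _; rewrite mulr_suml; apply: eq_bigr => l _; rewrite mulrA.
    rewrite exchange_big /= pair_bigA /=.
    by apply: eq_bigr => -[].
  have Mc k : M (\sum_i c (i, k) * a i).
    by apply: (subfield_sum HM) => l _; apply: (subfieldM HM) => //; apply: FM.
  exact: (aI (fun i => c (i, j)) _ (bI _ Mc sE j)).
have [d [Md yE]] := bS _ Ey.
have [c cP] := choice (fun j => aS _ (Md j)).
exists (fun ij => c ij.2 ij.1); split=> [[i j] /=|]; first by have [] := cP j.
rewrite yE (eq_bigr (fun j => \sum_i c j i * (a i * b j))); last first.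
  move=> j _; have [_ ->] := cP j; rewrite mulr_suml.
  by apply: eq_bigr => i _; rewrite mulrA.
rewrite exchange_big /= pair_bigA /=.
by apply: eq_bigr => -[].
Qed.

Lemma bounded_fin_basis F E N : is_subfield F ->
    (forall k (b : 'I_k -> L), (forall i, E (b i)) -> independent F b -> (k <= N)%N) ->
  exists n (b : 'I_n -> L), fin_basis F E b.
Proof.
move=> HF bound.
pose P k := `[< exists b : 'I_k -> L, (forall i, E (b i)) /\ independent F b >].
have exP : exists k, P k.
  exists 0; apply/asboolP.
  have f : 'I_0 -> L by case.
  by exists f; split=> [[]|c _ _ []].
have bP k : P k -> (k <= N)%N by move=> /asboolP [b [Eb bI]]; apply: bound Eb bI.
case: (ex_maxnP exP bP) => n /asboolP [b [Eb bI]] nmax.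
exists n, b; split=> // y Ey; apply: contrapT => ny.
have : P n.+1.
  apply/asboolP; exists (fun i => if unlift ord0 i is Some j then b j else y).
  split=> [i|c Fc]; first by case: unliftP.
  rewrite big_ord_recl unlift_none => s0.
  have c0 : c ord0 = 0.
    apply: contrapT => /eqP c0; apply: ny.
    exists (fun i => - (c (lift ord0 i) / c ord0)); split=> [i|].
      by apply: (subfieldN HF); apply: (subfieldM HF) => //; apply: (subfieldV HF).
    apply: (mulfI c0); move/eqP: s0; rewrite addr_eq0 => /eqP ->.
    rewrite mulr_sumr -sumrN; apply: eq_bigr => i _; rewrite liftK.
    by field.
  move: s0; rewrite c0 mul0r add0r => s0 i.
  case: (unliftP ord0 i) => [j ->|->] //.
  apply: (bI (fun j => c (lift ord0 j))) => //.
  by rewrite -[RHS]s0; apply: eq_bigr => k _; rewrite liftK.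
by move/nmax; rewrite ltnn.
Qed.

End FiniteDegree.

(** * Finiteness of the index and of the residue degree *)

Section FundamentalInequality.
Variables (K L : fieldType) (iota : {rmorphism K -> L}).
Variables (G : oagType) (v : valuation L G).

Lemma value_group_subgroup E : is_subfield E -> subgroup (value_group v E).
Proof.
move=> HE; split=> [|a b [x Ex vx] [y Ey vy]].
  by exists 1; [exact: subfield1 HE|exact: v1 v].
exists (x / y); last by rewrite vM vx (vV vy).
by apply: (subfieldM HE) => //; apply: (subfieldV HE).
Qed.

Variables (x : L) (p : {poly K}).
Hypothesis px : is_min_poly iota x p.
Local Notation E := (simple_ext iota x).
Local Notation KS := (range iota).

Let HK : is_subfield KS. Proof. exact: is_subfield_range. Qed.
Let HE : is_subfield E. Proof. exact: adjoin_subfield. Qed.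
Let KE : KS `<=` E. Proof. exact: adjoin_sub. Qed.

(** The coordinates in the powers of x form a matrix with more rows than columns, whose left kernel
    is nonzero. *)
Lemma simple_ext_dependent k (z : 'I_k -> L) : (forall i, E (z i)) ->
    ((size p).-1 < k)%N ->
  exists c : 'I_k -> K, (exists i, c i != 0) /\ \sum_i iota (c i) * z i = 0.
Proof.
move=> Ez kp.
have gP i : {g : {poly K} | (size g < size p)%N & (map_poly iota g).[x] = z i}.
  by apply/cid2; have := Ez i; rewrite /simple_ext (adjoinE px) => -[g sg <-]; exists g.
pose A := \matrix_(i < k, j < (size p).-1) (s2val (gP i))`_j.
have /rowV0Pn [u /sub_kermxP uA u0] : kermx A != 0.
  rewrite kermx_eq0 /row_free neq_ltn (leq_ltn_trans (rank_leq_col A)) //.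
exists (fun i => u 0 i); split.
  by apply: contrapT => /forallNP h; case/eqP: u0; apply/rowP => i; rewrite mxE;
    have /negP := h i; rewrite negbK => /eqP.
have sp : ((size p).-1.+1 = size p)%N by rewrite prednK // ltnW // (min_poly_size px).
have zE i : z i = \sum_(j < (size p).-1) iota (A i j) * x ^+ j.
  rewrite -(s2valP' (gP i)) (horner_coef_wide _ (n := (size p).-1)).
    by apply: eq_bigr => j _; rewrite coef_map !mxE.
  by rewrite size_map_poly -ltnS sp; apply: (s2valP (gP i)).
rewrite (eq_bigr (fun i => \sum_j iota (u 0 i * A i j) * x ^+ j)); last first.
  by move=> i _; rewrite zE mulr_sumr; apply: eq_bigr => j _; rewrite rmorphM mulrA.
rewrite exchange_big big1 //= => j _; rewrite -mulr_suml -rmorph_sum /=.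
have := congr1 (fun B : 'rV_(size p).-1 => B 0 j) uA; rewrite !mxE => ->.
by rewrite rmorph0 mul0r.
Qed.

(** Elements with values in distinct cosets are independent over K, since two terms of a vanishing
    combination would share their value. The successor in the index type records that the index is
    positive, as the division in the defect requires. *)
Lemma value_group_finite :
  exists n (t : 'I_n.+1 -> G), coset_reps (value_group v KS) (value_group v E) t.
Proof.
have [|n [t tP]] := @bounded_coset_reps _ (value_group v KS) (value_group v E)
    (size p).-1 (value_group_subgroup HK).
  move=> k t Et tU; rewrite leqNgt; apply/negP => /simple_ext_dependent dep.
  have zP i : {z | E z & v z = Some (t i)} by apply/cid2; have [z Ez vz] := Et i; exists z.
  have [i|c [[i0 ci0] s0]] := dep (fun i => s2val (zP i)); first exact: (s2valP (zP i)).
  have zN i : s2val (zP i) != 0 by apply/(v_neq0 v); rewrite (s2valP' (zP i)).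
  have [|i [j [ij ci e]]] := sum0_equal_values v s0.
    by exists i0; rewrite mulf_neq0 ?fmorph_eq0.
  move: e; rewrite !vM (s2valP' (zP i)) (s2valP' (zP j)).
  move: ci; rewrite mulf_eq0 negb_or => /andP [/(val_neq0 v) [a va] _].
  rewrite va; case vb: (v (iota (c j))) => [b|] //= -[e].
  suff ji : j = i by rewrite ji ltnn in ij.
  apply: tU; exists (iota (c i / c j)); first by exists (c i / c j).
  rewrite fmorph_div vM va (vV vb) /=; congr Some.
  by apply/eqP; rewrite subr_eq addrAC [t j + b]addrC -e addrK.
case: n t tP => [|n] t tP; last by exists n, t.
have [_ /(_ 0) []] := tP; first by case: (value_group_subgroup HE).
by case.
Qed.

(** Lifts of independent residues are independent over K: a relation divided by its coefficient of
    least value has integral coefficients, one of them 1, and reduces to a nontrivial relation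
    between the residues. *)
Lemma residue_subfield_finite :
  exists n (b : 'I_n.+1 -> residue_field v),
    fin_basis (residue_subfield v KS) (residue_subfield v E) b.
Proof.
have HrK := residue_subfield_subfield v HK.
have HrE := residue_subfield_subfield v HE.
have [|n [b bP]] := @bounded_fin_basis _ (residue_subfield v KS) (residue_subfield v E)
    (size p).-1 HrK.
  move=> k b Eb bI; rewrite leqNgt; apply/negP => /simple_ext_dependent dep.
  have zP i : {z | E z /\ vle (Some 0) (v z) & residue v z = b i}.
    by apply/cid2; have [z Ez vz] := Eb i; exists z.
  pose z i := s2val (zP i).
  have zO i : vle (Some 0) (v (z i)) by have [] := s2valP (zP i).
  have zb i : residue v (z i) = b i by apply: (s2valP' (zP i)).
  have [i|c [[i0 ci0] s0]] := dep z; first by have [] := s2valP (zP i).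
  move: z zO zb s0 => z zO zb s0 {zP dep}.
  case: k b Eb bI z zO zb c i0 ci0 s0 => [|k] b Eb bI z zO zb c i0 ci0 s0.
    by case: i0 ci0.
  have [i1 i1min] := exists_min_value v (fun i => iota (c i)).
  have ci1 : iota (c i1) != 0.
    apply: contraNneq ci0 => c1; rewrite -(fmorph_eq0 iota); apply/eqP/(v_eq0 v).
    by apply: vle_anti (vleN _) _; rewrite -(v0 v) -c1.
  have dO i : vle (Some 0) (v (iota (c i / c i1))).
    by rewrite fmorph_div -(v1 v) vle_divE // mul1r.
  have r1 : residue v (iota (c i1 / c i1)) != 0.
    by rewrite divff -?(fmorph_eq0 iota) // rmorph1 residue1 oner_neq0.
  case/eqP: r1; apply: (bI (fun i => residue v (iota (c i / c i1)))).
    move=> i; exists (iota (c i / c i1)) => //.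
    by split; [exists (c i / c i1)|apply: dO].
  transitivity (residue v (\sum_i iota (c i / c i1) * z i)).
    rewrite residue_sum => [|i _]; last exact: vringM.
    by apply: eq_bigr => i _; rewrite residueM // zb.
  rewrite (_ : \sum_i _ = 0) ?residue0 //.
  rewrite (eq_bigr (fun i => (iota (c i1))^-1 * (iota (c i) * z i))).
    by rewrite -mulr_sumr s0 mulr0.
  by move=> i _; rewrite fmorph_div mulrA [_^-1 * _]mulrC.
case: n b bP => [|n] b bP; last by exists n, b.
have [_ _ bS] := bP; have [c [_]] := bS _ (subfield1 HrE).
by rewrite big_ord0 => /eqP; rewrite oner_eq0.
Qed.

End FundamentalInequality.

(** a and b stand for the index and residue degree of K(alpha), e and f for the further factors of
    K(theta), and m and n for the two degrees. *)
Lemma defect_quotient_eq (n m a b e f : nat) :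
    (0 < a)%N -> (0 < b)%N -> (0 < e)%N -> (0 < f)%N ->
  (n%:R / (a * e * (b * f))%:R = m%:R / (a * b)%:R :> rat) <-> n = (f * e * m)%N.
Proof.
move=> a0 b0 e0 f0.
have ab : (a * b)%:R != 0 :> rat by rewrite pnatr_eq0 -lt0n muln_gt0 a0.
have ef : (f * e)%:R != 0 :> rat by rewrite pnatr_eq0 -lt0n muln_gt0 f0.
have -> : (a * e * (b * f))%:R = (f * e)%:R * (a * b)%:R :> rat.
  by rewrite -natrM; congr (_%:R); ring.
split=> [h|->]; last first.
  by rewrite natrM -mulf_div mulrC divff // mulr1.
have := congr1 (fun q => q * ((f * e)%:R * (a * b)%:R)) h.
rewrite divfK ?mulf_neq0 // [(f * e)%:R * _]mulrC mulrA divfK // -natrM => /eqP.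
by rewrite eqr_nat mulnC => /eqP.
Qed.

(** * Comparison of defects and the equivalence *)

Section Main.
Variables (K : fieldType) (L : closedFieldType) (iota : {rmorphism K -> L}).
Hypothesis alg : forall x : L, algebraicOver iota x.
Variables (G : oagType) (v : valuation K G) (vbar : valuation L G).
Hypothesis vbar_ext : forall x : K, vbar (iota x) = v x.
Variables (theta alpha : L) (f phi : {poly K}).
Hypotheses (f_min : is_min_poly iota theta f) (phi_min : is_min_poly iota alpha phi).
Hypothesis theta_unib : unibranched iota v vbar (simple_ext iota theta).
Hypothesis alpha_unib : unibranched iota v vbar (simple_ext iota alpha).
Local Notation phit := ((map_poly iota phi).[theta]).
Local Notation ka := (residue_subfield vbar (simple_ext iota alpha)).

(** [GE] and [kE] supply towers of value groups and residue fields, where index and degree gain the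
    factors e and [k_alpha(Y) : k_alpha]. The numerators of the defects are the degrees of theta and
    alpha by [henselization_degree]. *)
Lemma defect_eq_iff gamma e (h : {poly K}) (Hka : is_subfield ka) Y mu :
    vbar phit = Some gamma -> (0 < e)%N -> (size h < size phi)%N ->
    vbar (map_poly iota h).[alpha] = Some (gamma *+ e) ->
    (forall k (p : {poly K}), (0 < k)%N -> (size p < size phi)%N ->
       vbar (map_poly iota p).[alpha] = Some (gamma *+ k) -> (e <= k)%N) ->
    value_group vbar (simple_ext iota theta) =
      [set g + gamma *~ n | g in value_group vbar (simple_ext iota alpha)
                          & n in [set: int]] ->
    residue_subfield vbar (simple_ext iota theta) = adjoin ka Y ->
    is_min_poly (subfield_incl Hka) Y mu ->
  defect vbar (range iota) (simple_ext iota theta) =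
    defect vbar (range iota) (simple_ext iota alpha) <->
  (size f).-1 = ((size mu).-1 * e * (size phi).-1)%N.
Proof.
move=> vphi e0 sh vh emin GE kE mu_min.
have HK := is_subfield_range iota.
have HEa : is_subfield (simple_ext iota alpha) by apply: adjoin_subfield.
have HEt : is_subfield (simple_ext iota theta) by apply: adjoin_subfield.
have KEa : range iota `<=` simple_ext iota alpha by apply: adjoin_sub.
have GK : subgroup (value_group vbar (range iota)) by apply: value_group_subgroup.
have [a [t tP]] := value_group_finite vbar phi_min.
have [b [s sP]] := residue_subfield_finite vbar phi_min.
have index_t : ramification_index vbar (range iota) (simple_ext iota theta) = (a.+1 * e)%N.
  rewrite /ramification_index (group_index_coset_reps GK (coset_reps_cyclic GK _ _ e0 _ _ GE tP)).
  - by rewrite card_prod !card_ord.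
  - exact: value_group_subgroup.
  - by move=> g [x Kx vx]; exists x => //; apply: KEa.
  - by exists (map_poly iota h).[alpha] => //; apply: adjoin_horner.
  move=> k k0 [x Ex vx]; have [p sp px] := simple_ext_small phi_min Ex.
  by apply: (emin k p) => //; rewrite px.
have deg_t : inertia_degree vbar (range iota) (simple_ext iota theta) = (b.+1 * (size mu).-1)%N.
  have HrK := residue_subfield_subfield vbar HK.
  have HrE := residue_subfield_subfield vbar HEt.
  have rKa : residue_subfield vbar (range iota) `<=` ka.
    by move=> _ [x [Kx Ox] <-]; exists x => //; split=> //; apply: KEa.
  have rat : ka `<=` residue_subfield vbar (simple_ext iota theta).
    by rewrite kE; apply: adjoin_sub.
  have bt : fin_basis ka (residue_subfield vbar (simple_ext iota theta))
      (fun i : 'I_(size mu).-1 => Y ^+ i).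
    rewrite kE; split=> [i|c Fc s0 i|y Ey].
    - by apply: (subfieldX (adjoin_subfield _ _)); apply: adjoin_mem.
    - pose q := \poly_(j < (size mu).-1) (if insub j is Some k then c k else 0).
      have qi (k : 'I_(size mu).-1) : q`_k = c k by rewrite coef_poly ltn_ord valK.
      have qk j : ka q`_j.
        rewrite coef_poly; case: ifP => _; last exact: subfield0.
        by case: insubP => [k _ _|_] //; apply: subfield0.
      have [q' q'E] := poly_lift Hka qk.
      have sq' : (size q' < size mu)%N.
        rewrite -(size_map_poly (subfield_incl Hka)) q'E.
        rewrite (leq_ltn_trans (size_poly _ _)) // ltn_predL.
        exact: ltnW (min_poly_size mu_min).
      have q'0 : q' = 0.
        apply: (min_poly_small_root mu_min sq'); rewrite q'E -[RHS]s0.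
        rewrite (horner_coef_wide _ (size_poly _ _)).
        by apply: eq_bigr => k _; rewrite qi.
      by rewrite -qi -q'E q'0 rmorph0 coef0.
    - have := (adjoin_basis mu_min).2 y; rewrite range_incl => /(_ Ey) [c [[Fc yE] _]].
      by exists c.
  rewrite /inertia_degree (fin_basis_degree HrK HrE _ (fin_basis_tower Hka HrE rKa rat sP bt)).
    by rewrite card_prod !card_ord.
  exact: subset_trans rat.
have index_a : ramification_index vbar (range iota) (simple_ext iota alpha) = a.+1.
  by rewrite /ramification_index (group_index_coset_reps GK tP) card_ord.
have deg_a : inertia_degree vbar (range iota) (simple_ext iota alpha) = b.+1.
  rewrite /inertia_degree (fin_basis_degree _ Hka _ sP) ?card_ord //.
    exact: residue_subfield_subfield.
  by move=> _ [x [Kx Ox] <-]; exists x => //; split=> //; apply: KEa.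
rewrite /defect index_t deg_t index_a deg_a.
rewrite (henselization_degree alg vbar_ext f_min theta_unib).
rewrite (henselization_degree alg vbar_ext phi_min alpha_unib).
apply: defect_quotient_eq => //.
by have := min_poly_size mu_min; case: (size mu) => [|[]].
Qed.

End Main.

Theorem theorem5p12
    (K : fieldType) (Kbar : closedFieldType) (iota : {rmorphism K -> Kbar})
    (Kbar_alg : forall x : Kbar, algebraicOver iota x)
    (G : oagType) (v : valuation K G) (vbar : valuation Kbar G)
    (vbar_ext : forall x : K, vbar (iota x) = v x)
    (theta alpha : Kbar) (f phi : {poly K})
    (f_min : is_min_poly iota theta f)
    (phi_min : is_min_poly iota alpha phi)
    (deg_lt : (size phi < size f)%N)
    (theta_unib : unibranched iota v vbar (simple_ext iota theta))
    (alpha_unib : unibranched iota v vbar (simple_ext iota alpha)) :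
  distinguished_pair iota vbar theta alpha <->
  [/\ (* (i) *)
      (exists2 delta : G, vbar (theta - alpha) = Some delta &
         minimal_pair iota vbar alpha delta) /\
      (forall alpha_i : Kbar, conjugates iota alpha alpha_i ->
         vle (vbar (theta - alpha_i)) (vbar (theta - alpha))),
      (* (ii) *)
      exists2 gamma : G, vbar (map_poly iota phi).[theta] = Some gamma &
        value_group vbar (simple_ext iota theta) =
        [set g + gamma *~ n | g in value_group vbar (simple_ext iota alpha)
                            & n in [set: int]],
      (* (iii) *)
      exists (gamma : G) (e : nat) (h : {poly K}),
        let reaches (k : nat) (p : {poly K}) :=
          [/\ (0 < k)%N, (size p < size phi)%N
            & vbar (map_poly iota p).[alpha] = Some (gamma *+ k)] in
        [/\ vbar (map_poly iota phi).[theta] = Some gamma,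
            reaches e h,
            (forall k p, reaches k p -> (e <= k)%N)
          & residue_subfield vbar (simple_ext iota theta) =
            adjoin (residue_subfield vbar (simple_ext iota alpha))
              (residue vbar ((map_poly iota phi).[theta] ^+ e
                             / (map_poly iota h).[alpha]))]
    & (* (iv) *)
      defect vbar (range iota) (simple_ext iota theta) =
      defect vbar (range iota) (simple_ext iota alpha)].
Proof.
have degt : deg iota theta = (size f).-1 := deg_min_poly f_min.
have dega : deg iota alpha = (size phi).-1 := deg_min_poly phi_min.
have sf := min_poly_size f_min; have sphi := min_poly_size phi_min.
have phit0 : (map_poly iota phi).[theta] != 0.
  apply/negP => /(min_poly_size_le f_min (min_poly_neq0 phi_min)).
  by rewrite leqNgt deg_lt.
have d0 : theta - alpha != 0.
  apply: contraNneq phit0 => /eqP; rewrite subr_eq0 => /eqP ->.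
  by rewrite (min_poly_root phi_min).
have [gamma vphi] := val_neq0 vbar phit0.
have vphiX k : vbar ((map_poly iota phi).[theta] ^+ k) = Some (gamma *+ k) := vX k vphi.
have m_le : ((size phi).-1 < (size f).-1)%N.
  by move: deg_lt sf sphi; case: (size f) (size phi) => [|k] [|l].
split=> [[_ [_ dmax] far]|[[[delta vd [_ amin]] conj] [gamma1 vphi1 GE] [gamma2 [e [h hP]]] dE]].
- have closest b : (deg iota b < (size f).-1)%N ->
      vle (vbar (theta - b)) (vbar (theta - alpha)).
    by move=> db; apply: dmax; exists b => //=; rewrite degt.
  (* A b this close to alpha is no farther from theta than alpha is, so the last condition on a
     distinguished pair bounds its degree from below. *)
  have amin b : vle (vbar (theta - alpha)) (vbar (alpha - b)) ->
      (deg iota alpha <= deg iota b)%N.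
    move=> ab; rewrite leqNgt; apply/negP => /far; rewrite /vlt => /negP; apply.
    have -> : theta - b = (theta - alpha) + (alpha - b) by ring.
    by apply: val_geD => //; apply: vle_refl.
  have conj b : root (map_poly iota phi) b -> vle (vbar (theta - b)) (vbar (theta - alpha)).
    move=> rb; apply: closest; apply: leq_ltn_trans m_le.
    have := deg_root_lt Kbar_alg (min_poly_neq0 phi_min) rb.
    by case: (size phi).
  pose P k := `[< (0 < k)%N /\ exists2 p : {poly K}, (size p < size phi)%N &
    vbar (map_poly iota p).[alpha] = Some (gamma *+ k) >].
  (* Some positive multiple of v(phi(theta)) is already a value of K, attained by a constant
     polynomial; hence e exists. *)
  have exP : exists k, P k.
    have alg : algebraicOver iota (map_poly iota phi).[theta] by [].
    have [k [c [k0 c0 kc]]] := value_torsion vbar alg phit0.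
    exists k; apply/asboolP; split=> //; exists c%:P.
      by rewrite size_polyC c0.
    by rewrite map_polyC hornerC -kc.
  case: (ex_minnP exP) => e /asboolP [e0 [h sh vh]] emin'.
  have emin k (p : {poly K}) : (0 < k)%N -> (size p < size phi)%N ->
      vbar (map_poly iota p).[alpha] = Some (gamma *+ k) -> (e <= k)%N.
    by move=> k0 sp vp; apply: emin'; apply/asboolP; split=> //; exists p.
  have vh' : vbar (map_poly iota h).[alpha] = vbar ((map_poly iota phi).[theta] ^+ e).
    by rewrite vphiX.
  have emin2 k (p : {poly K}) : (0 < k)%N -> (size p < size phi)%N ->
      vbar (map_poly iota p).[alpha] = vbar ((map_poly iota phi).[theta] ^+ k) -> (e <= k)%N.
    by rewrite vphiX; apply: emin.
  have Yalg := Y_algebraic Kbar_alg phi_min phit0 amin e0 vh' emin2 f_min.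
  have [mu mu_min] := min_poly_exists Yalg.
  have n_le := degree_le Kbar_alg phi_min phit0 amin conj e0 vh' mu_min closest.
  have n_ge := degree_ge Kbar_alg phi_min phit0 amin e0 vh' emin2 f_min mu_min.
  have GE := value_group_theta Kbar_alg phi_min phit0 amin e0 vh' emin2 f_min mu_min n_le vphi.
  have kE := residue_subfield_theta Kbar_alg phi_min phit0 amin e0 sh vh' emin2 f_min mu_min n_le.
  split.
  + split; last first.
      by move=> b [p pmin]; rewrite (min_poly_unique phi_min pmin); apply: conj.
    have [delta vd] := val_neq0 vbar d0; exists delta => //; split.
      by exists (theta - alpha).
    by move=> b; rewrite -vd; apply: amin.
  + by exists gamma.
  + by exists gamma, e, h; split=> // k p [k0 sp vp]; apply: emin vp.
  + apply/(defect_eq_iff Kbar_alg vbar_ext f_min phi_min theta_unib alpha_unib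
      vphi e0 sh vh emin GE kE mu_min).
    by apply/eqP; rewrite eqn_leq n_le n_ge.
- case: hP => vphi2 [e0 sh vh] emin' kE.
  move: vphi1 vphi2; rewrite vphi => -[?] [?]; subst gamma1 gamma2.
  have {}amin b : vle (vbar (theta - alpha)) (vbar (alpha - b)) ->
      (deg iota alpha <= deg iota b)%N by rewrite vd; apply: amin.
  have {}conj b : root (map_poly iota phi) b ->
      vle (vbar (theta - b)) (vbar (theta - alpha)).
    by move=> rb; apply: conj; exists phi.
  have emin k (p : {poly K}) : (0 < k)%N -> (size p < size phi)%N ->
      vbar (map_poly iota p).[alpha] = Some (gamma *+ k) -> (e <= k)%N.
    by move=> *; apply: (emin' k p).
  have vh' : vbar (map_poly iota h).[alpha] = vbar ((map_poly iota phi).[theta] ^+ e).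
    by rewrite vphiX.
  have emin2 k (p : {poly K}) : (0 < k)%N -> (size p < size phi)%N ->
      vbar (map_poly iota p).[alpha] = vbar ((map_poly iota phi).[theta] ^+ k) -> (e <= k)%N.
    by rewrite vphiX; apply: emin.
  have Yalg := Y_algebraic Kbar_alg phi_min phit0 amin e0 vh' emin2 f_min.
  have [mu mu_min] := min_poly_exists Yalg.
  have n_eq := (defect_eq_iff Kbar_alg vbar_ext f_min phi_min theta_unib alpha_unib
      vphi e0 sh vh emin GE kE mu_min).1 dE.
  have closest : forall b, (deg iota b < (size f).-1)%N ->
      vle (vbar (theta - b)) (vbar (theta - alpha)).
    apply: (closest_of_degree Kbar_alg phi_min d0 phit0 amin conj e0 vh' emin2 mu_min).
    by rewrite n_eq.
  split; first by rewrite degt dega.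
    split; first by exists alpha => //=; rewrite degt dega.
    by move=> _ [b db <-]; apply: closest; rewrite -degt.
  (* If b were as close to theta as alpha is, it would lie within v(theta - alpha) of alpha, against
     the minimality of the pair. *)
  move=> b; rewrite /vlt => bm; apply/negP => h1.
  have /amin : vle (vbar (theta - alpha)) (vbar (alpha - b)).
    have -> : alpha - b = (theta - b) - (theta - alpha) by ring.
    by apply: val_geD; rewrite ?vN ?vle_refl.
  by rewrite leqNgt bm.
Qed.
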